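(* Let $s\in\mathbb{C}$ with $0<\mathrm{Re}(s)<1$ and $\zeta(s)\neq0$, where $\zeta$ is the Riemann zeta function. Then $$\lim_{n\to\infty}\left|\frac{h_{n}(1-s)}{h_{n}(s)}\right|=1.$$
   Context: For $0<\mathrm{Re}(s)<1$ and integers $n\ge2$ define $$h_{n}(s)=(4\pi)^{s/2}\,\Gamma(s/2)\,n^{-s}\left(\zeta_{\mathbb{Z}/n\mathbb{Z}}(s/2)-n\,\zeta_{\mathbb{Z}}(s/2)\right),$$ where $$\zeta_{\mathbb{Z}/n\mathbb{Z}}(s)=\frac{1}{4^{s}}\sum_{k=1}^{n-1}\frac{1}{\sin^{2s}(\pi k/n)}$$ is the spectral zeta function of the cyclic graph $\mathbb{Z}/n\mathbb{Z}$, and $$\zeta_{\mathbb{Z}}(s)=\frac{1}{\Gamma(s)}\int_{0}^{\infty}e^{-2t}I_{0}(2t)\,t^{s}\frac{dt}{t}\qquad(0<\mathrm{Re}(s)<1/2)$$ is the spectral zeta function of the graph $\mathbb{Z}$, with $I_0(x)=\sum_{k\ge0}(x/2)^{2k}/(k!)^2$ the modified Bessel function. The quotient is considered for $n$ sufficiently large. *)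

(* Defs.v *)
From Stdlib Require Import Reals Factorial.
From Coquelicot Require Import Coquelicot.

Open Scope R_scope.

(* The principal power x^z = exp (z * ln x) of a positive real x; the value
   for x <= 0 is meaningless. *)
Definition rcpow (x : R) (z : C) : C :=
  (exp (Re z * ln x) * cos (Im z * ln x),
   exp (Re z * ln x) * sin (Im z * ln x)).

Definition RInt_0_infty (f : R -> C) : C :=
  RInt_gen (V := C_R_CompleteNormedModule) f (at_right 0) (Rbar_locally p_infty).

(* Euler's integral, convergent for 0 < Re z, the only range needed. *)
Definition CGamma (z : C) : C :=
  RInt_0_infty (fun t : R => (RtoC (exp (- t)) * rcpow t (z - RtoC 1))%C).

Definition BesselI0 (x : R) : R :=
  Series (fun k : nat => (x / 2) ^ (2 * k) / (INR (fact k)) ^ 2).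

Definition zeta_cyclic (n : nat) (s : C) : C :=
  (/ rcpow 4 s *
   sum_n_m (G := C_AbelianMonoid)
     (fun k : nat => / rcpow (sin (PI * INR k / INR n)) (RtoC 2 * s))
     1 (n - 1))%C.

(* Meaningful for 0 < Re s < 1/2, where the integral converges. *)
Definition zeta_Z (s : C) : C :=
  (/ CGamma s *
   RInt_0_infty (fun t : R =>
     RtoC (exp (- 2 * t) * BesselI0 (2 * t)) * rcpow t s / RtoC t))%C.

(* Meaningful for n >= 2 and 0 < Re s < 1. *)
Definition h (n : nat) (s : C) : C :=
  (rcpow (4 * PI) (s / RtoC 2) * CGamma (s / RtoC 2) * rcpow (INR n) (- s) *
   (zeta_cyclic n (s / RtoC 2) - RtoC (INR n) * zeta_Z (s / RtoC 2)))%C.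

Definition analytic_at (f : C -> C) (z0 : C) : Prop :=
  exists (a : nat -> C) (r : R), 0 < r /\
    forall z : C, Cmod (z - z0) < r ->
      is_pseries (K := C_AbsRing) (V := C_NormedModule) a (z - z0)%C (f z).

(* zeta is the analytic continuation to C \ {1} of the Dirichlet series
   sum_{m >= 1} m^(-z), Re z > 1. This determines zeta except for its
   irrelevant value at the pole 1. *)
Definition is_Riemann_zeta (zeta : C -> C) : Prop :=
  (forall z : C, 1 < Re z ->
     is_series (K := C_AbsRing) (V := C_NormedModule)
       (fun k : nat => rcpow (INR (S k)) (- z)) (zeta z)) /\
  (forall z : C, z <> RtoC 1 -> analytic_at zeta z).

(* Main.v *)
(* Write sigma = s / 2.  Taking Mellin transforms term by term, h_n(s) is the
   integral over v > 0 of
     (sum_(0 < k < n) g(k / n) - n * int_0^1 g) v^(sigma - 1),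
   g(x) = exp (- n^2 v sin^2(PI x) / PI), because e^(-2t) I_0(2t) is the integral of
   exp (- 4 t sin^2(PI x)) over [0, 1].  The bracket is at most the total variation
   of g up to a constant and is O(v^(-1/2)) for v >= 1, uniformly in n, so
   n |-> h_n(s) is bounded.

   In h_2n(s) - 2^(1-s) h_n(s) the zeta_Z terms cancel and an alternating sum over the
   2n-th roots of unity remains; it converges, and its limit is
   2 PI^(-sigma) Gamma(sigma) eta(s) with eta(s) = sum_k (-1)^(k-1) k^(-s).  Since
   |2^(1-s)| > 1, a bounded solution of this recursion must itself converge, and
     h_n(s) -> 2 PI^(-sigma) Gamma(sigma) eta(s) / (1 - 2^(1-s)).

   The same value is the Mellin transform at sigma of G(v) = theta(v) - 1 - v^(-1/2):
   in G(v) - 2 G(4v) the terms v^(-1/2) cancel and an alternating theta series remains.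
   The theta relation G(1/v) = sqrt(v) G(v) makes it invariant under s |-> 1 - s, so
   h_n(s) and h_n(1-s) have the same limit.  It is nonzero because Gamma has no zeros
   and eta(s) = (1 - 2^(1-s)) zeta(s), by analytic continuation along a horizontal line
   and, for real s, by continuity along the vertical line through s. *)

Require Import Defs.
From Stdlib Require Import Reals Factorial Lra Lia Psatz.
From Coquelicot Require Import Coquelicot.

(** * Principal powers *)

(** The recursion in n stands in for an asymptotic expansion of [zeta_cyclic]. Since |2^(1-s)| > 1
    exactly when Re s < 1, mere boundedness of h_n(s) singles out one solution, so the integral
    representation of h_n only has to supply an upper bound uniform in n. What is left is expressed
    through eta, whose terms taken in pairs form an absolutely convergent series on all of Re s > 0.
    The pairing is kept in every form of the series (chords, theta, powers of a shift), so that each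
    exchange of limits is dominated. The symmetry s |-> 1 - s is invisible on eta, whence the second
    description of the limit as a Mellin integral. The theta relation rests on the Dirichlet kernel:
    the integral of the Gaussian against it is evaluated both near the integers and frequency by
    frequency. That Gamma has no zeros follows from an inequality valid far to the right and from
    Gamma(z+1) = z Gamma(z). The identity theorem is applied on a real half-line only, entered from
    the region where the Dirichlet series converges. *)

Lemma sum_n_S (a : nat -> R) (n : nat) : sum_n a (S n) = sum_n a n + a (S n).
Proof. exact (sum_Sn (G := R_AbelianMonoid) a n). Qed.

Lemma ball_R (x eps y : R) : ball x eps y <-> Rabs (y - x) < eps.
Proof. reflexivity. Qed.

(** The uniform structure of C comes with its own balls, which match the modulus only up to
    [norm_factor]. *)
Lemma locally_Cmod (l : C) (eps : R) : 0 < eps ->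
  locally (T := C_R_CompleteNormedModule) l (fun y : C => Cmod (y - l) < eps).
Proof.
  intros Heps. assert (Hn := norm_factor_gt_0 (V := C_R_CompleteNormedModule)).
  exists (mkposreal _ (Rdiv_lt_0_compat _ _ Heps Hn)). intros y Hy.
  apply (norm_compat2 (V := C_R_CompleteNormedModule)) in Hy.
  rewrite <- Cmod_norm in Hy. simpl in Hy. field_simplify in Hy; [exact Hy | lra].
Qed.

(** C occurs with two structures: integrals see it as a space over R, the series defining zeta as a
    space over itself. *)
Lemma locally_C_NormedModule (l : C) (eps : R) : 0 < eps ->
  locally (T := C_NormedModule) l (fun y : C => Cmod (y - l) < eps).
Proof.
  intros Heps. assert (Hn := norm_factor_gt_0 (V := C_NormedModule)).
  exists (mkposreal _ (Rdiv_lt_0_compat _ _ Heps Hn)). intros y Hy.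
  apply (norm_compat2 (V := C_NormedModule)) in Hy.
  simpl in Hy. field_simplify in Hy; [exact Hy | lra].
Qed.

Lemma C_ext (z w : C) : Re z = Re w -> Im z = Im w -> z = w.
Proof. destruct z, w; simpl; intros; now f_equal. Qed.

Ltac ring_C := apply C_ext; unfold Re, Im; cbn; ring.

Lemma Cplus_minus_opp (u v : C) : (u + - (u - v) = v)%C.
Proof. ring. Qed.

Lemma RtoC_neq_0 (x : R) : x <> 0 -> RtoC x <> RtoC 0.
Proof. intros H E. apply H, RtoC_inj, E. Qed.

Lemma Rpower_pos (x y : R) : 0 < Rpower x y.
Proof. apply exp_pos. Qed.

Lemma Cmod_rcpow (x : R) (z : C) : Cmod (rcpow x z) = Rpower x (Re z).
Proof.
  unfold Cmod, rcpow, Rpower; simpl.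
  set (u := exp (Re z * ln x)). set (v := Im z * ln x).
  replace (u * cos v * (u * cos v * 1) + u * sin v * (u * sin v * 1))
    with (u ^ 2 * (Rsqr (sin v) + Rsqr (cos v))) by (unfold Rsqr; ring).
  rewrite sin2_cos2, Rmult_1_r. apply sqrt_pow2. left; apply exp_pos.
Qed.

Lemma rcpow_nonzero (x : R) (z : C) : rcpow x z <> RtoC 0.
Proof.
  intro H. apply (f_equal Cmod) in H. rewrite Cmod_rcpow, Cmod_0 in H.
  generalize (Rpower_pos x (Re z)); lra.
Qed.

Lemma rcpow_plus (x : R) (z w : C) : rcpow x (z + w) = (rcpow x z * rcpow x w)%C.
Proof.
  apply C_ext; unfold rcpow, Re, Im; simpl; rewrite !Rmult_plus_distr_r, exp_plus, ?cos_plus,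
      ?sin_plus; ring.
Qed.

Lemma rcpow_0 (x : R) : rcpow x (RtoC 0) = RtoC 1.
Proof. apply C_ext; unfold rcpow, Re, Im; simpl; rewrite !Rmult_0_l, exp_0, ?cos_0, ?sin_0; ring.
    Qed.

Lemma rcpow_opp (x : R) (z : C) : rcpow x (- z) = (/ rcpow x z)%C.
Proof.
  assert (H := rcpow_plus x (- z) z).
  replace (- z + z)%C with (RtoC 0) in H by ring. rewrite rcpow_0 in H.
  replace (rcpow x (- z)) with (rcpow x (- z) * rcpow x z * / rcpow x z)%C
    by (field; apply rcpow_nonzero).
  rewrite <- H. ring.
Qed.

Lemma rcpow_minus (x : R) (z w : C) : rcpow x (z - w) = (rcpow x z / rcpow x w)%C.
Proof. unfold Cminus. rewrite rcpow_plus, rcpow_opp. reflexivity. Qed.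

Lemma rcpow_mult (x y : R) (z : C) : 0 < x -> 0 < y ->
  rcpow (x * y) z = (rcpow x z * rcpow y z)%C.
Proof.
  intros. apply C_ext; unfold rcpow, Re, Im; simpl; rewrite ln_mult, !Rmult_plus_distr_l, exp_plus,
    ?cos_plus, ?sin_plus by assumption; ring.
Qed.

Lemma rcpow_inv (x : R) (z : C) : 0 < x -> rcpow (/ x) z = (/ rcpow x z)%C.
Proof.
  intros. rewrite <- rcpow_opp. unfold rcpow. rewrite ln_Rinv by assumption.
  simpl. apply C_ext; unfold rcpow, Re, Im; simpl; f_equal; f_equal; ring.
Qed.

Lemma rcpow_real (x a : R) : rcpow x (RtoC a) = RtoC (Rpower x a).
Proof.
  apply C_ext; unfold rcpow, Re, Im; simpl; rewrite Rmult_0_l, ?cos_0, ?sin_0; unfold Rpower; ring.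
Qed.

Lemma rcpow_1_r (x : R) : 0 < x -> rcpow x (RtoC 1) = RtoC x.
Proof. intros. rewrite rcpow_real, Rpower_1; auto. Qed.

Lemma rcpow_pow2 (x : R) (z : C) : 0 < x -> rcpow (x ^ 2) z = rcpow x (RtoC 2 * z).
Proof.
  intros. replace (x ^ 2) with (x * x) by ring. rewrite rcpow_mult by assumption.
  rewrite <- rcpow_plus. f_equal. ring.
Qed.

Lemma is_derive_pair (f g : R -> R) (t df dg : R) :
  is_derive f t df -> is_derive g t dg ->
  is_derive (V := C_R_NormedModule) (fun t => (f t, g t)) t (df, dg).
Proof.
  intros Hf Hg.
  apply (is_derive_ext (V := C_R_NormedModule)
    (fun t => plus (scal (f t) (1, 0) : C_R_NormedModule) (scal (g t) (0, 1) : C_R_NormedModule))).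
  - intros u. apply C_ext; cbn; ring.
  - replace ((df, dg) : C) with (plus (scal df ((1, 0) : C_R_NormedModule)) (scal dg ((0, 1):
      C_R_NormedModule)))
      by (apply C_ext; cbn; ring).
    apply @is_derive_plus; apply @is_derive_scal_l; assumption.
Qed.

Lemma continuous_C (f : R -> C) (t : R) :
  continuous (fun t => Re (f t)) t -> continuous (fun t => Im (f t)) t ->
  continuous (U := C_R_NormedModule) f t.
Proof.
  intros Hf Hg.
  apply (continuous_ext (T := R_UniformSpace) (U := C_R_NormedModule)
    (fun t => plus (scal (Re (f t)) (1, 0) : C_R_NormedModule) (scal (Im (f t)) (0, 1) :
        C_R_NormedModule))).
  - intros u. apply C_ext; cbn; ring.
  - apply (continuous_plus (V := C_R_NormedModule));
    apply (continuous_scal_l (V := C_R_NormedModule)); assumption.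
Qed.

Lemma continuous_Re (f : R -> C) (t : R) :
  continuous (U := C_R_NormedModule) f t -> continuous (fun t => Re (f t)) t.
Proof.
  intros H. apply (continuous_comp (U:=R_UniformSpace) (V := C_R_NormedModule) (W :=
      R_UniformSpace) f fst); [exact H | apply continuous_fst].
Qed.

Lemma continuous_Im (f : R -> C) (t : R) :
  continuous (U := C_R_NormedModule) f t -> continuous (fun t => Im (f t)) t.
Proof.
  intros H. apply (continuous_comp (U:=R_UniformSpace) (V := C_R_NormedModule) (W :=
      R_UniformSpace) f snd); [exact H | apply continuous_snd].
Qed.

Lemma continuous_Cmult (f g : R -> C) (t : R) :
  continuous (U := C_R_NormedModule) f t -> continuous (U := C_R_NormedModule) g t ->
  continuous (U := C_R_NormedModule) (fun t => (f t * g t)%C) t.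
Proof.
  intros Hf Hg.
  apply continuous_C; simpl.
  - apply (continuous_minus (V := R_NormedModule));
    apply (continuous_mult (K := R_AbsRing));
    first [apply continuous_Re; assumption | apply continuous_Im; assumption].
  - apply (continuous_plus (V := R_NormedModule));
    apply (continuous_mult (K := R_AbsRing));
    first [apply continuous_Re; assumption | apply continuous_Im; assumption].
Qed.

Lemma continuous_RtoC (f : R -> R) (t : R) :
  continuous f t -> continuous (U := C_R_NormedModule) (fun t => RtoC (f t)) t.
Proof. intros H. apply continuous_C; simpl; auto. apply continuous_const. Qed.

Lemma is_derive_rcpow (t : R) (z : C) : 0 < t ->
  is_derive (V := C_R_NormedModule) (fun t => rcpow t z) t (z * rcpow t (z - RtoC 1))%C.
Proof.
  intros Ht.
  replace (z * rcpow t (z - RtoC 1))%C with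
   ((exp (Re z * ln t) * (Re z / t)) * cos (Im z * ln t) + exp (Re z * ln t) * (- sin (Im z * ln
       t) * (Im z / t)),
   (exp (Re z * ln t) * (Re z / t)) * sin (Im z * ln t) + exp (Re z * ln t) * (cos (Im z * ln t)
       * (Im z / t))).
  - apply is_derive_pair; auto_derive; auto; field; lra.
  - rewrite rcpow_minus, rcpow_1_r by assumption.
    apply C_ext; unfold rcpow, Re, Im; simpl; field; lra.
Qed.

Lemma continuous_rcpow (t : R) (z : C) : 0 < t ->
  continuous (U := C_R_NormedModule) (fun t => rcpow t z) t.
Proof.
  intros Ht. apply (ex_derive_continuous (K := R_AbsRing) (V := C_R_NormedModule)).
  eexists; apply is_derive_rcpow; assumption.
Qed.

Lemma is_derive_Rpower (t a : R) : 0 < t ->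
  is_derive (fun t => Rpower t a) t (a * Rpower t (a - 1)).
Proof.
  intros Ht. unfold Rpower. auto_derive; auto.
  replace ((a - 1) * ln t) with (a * ln t + - ln t) by ring.
  rewrite exp_plus, exp_Ropp, exp_ln by assumption. field; lra.
Qed.

Lemma continuous_Rpower (t a : R) : 0 < t -> continuous (fun t => Rpower t a) t.
Proof.
  intros Ht. apply (ex_derive_continuous (K := R_AbsRing) (V := R_NormedModule)).
  eexists; apply is_derive_Rpower; assumption.
Qed.

Lemma Rpower_le_neg (a b p : R) : 0 < a <= b -> p <= 0 -> Rpower b p <= Rpower a p.
Proof.
  intros [Ha Hb] Hp. unfold Rpower.
  assert (ln a <= ln b) by (destruct Hb; [left; apply ln_increasing; auto | subst; lra]).
  assert (p * ln b <= p * ln a) by nra.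
  destruct H0; [left; apply exp_increasing; auto | rewrite H0; lra].
Qed.

(** The difference is an integral of the derivative [- z * t^(- z - 1)], whose modulus is largest at
    the left end. The gain of one power of a over the trivial bound is what makes paired alternating
    terms absolutely summable. *)
Lemma rcpow_diff_bound (a b : R) (z : C) : 0 < a <= b -> 0 <= Re z ->
  Cmod (rcpow a (- z) - rcpow b (- z)) <= Cmod z * (b - a) * Rpower a (- Re z - 1).
Proof.
  intros [Ha Hb] Hz.
  assert (HI : is_RInt (V := C_R_CompleteNormedModule)
      (fun t => ((- z) * rcpow t (- z - RtoC 1))%C) a b
      (minus (rcpow b (- z) : C_R_CompleteNormedModule) (rcpow a (- z)))).
  { apply (is_RInt_derive (V := C_R_CompleteNormedModule) (fun t => rcpow t (- z))).
    - intros t. rewrite Rmin_left, Rmax_right by assumption. intros Ht.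
      apply is_derive_rcpow; lra.
    - intros t. rewrite Rmin_left, Rmax_right by assumption. intros Ht.
      apply continuous_Cmult; [apply continuous_const | apply continuous_rcpow; lra]. }
  apply (norm_RInt_le_const _ _ _ _ (Cmod z * Rpower a (- Re z - 1))) in HI; auto.
  - rewrite <- Cmod_norm in HI.
    replace (rcpow a (- z) - rcpow b (- z))%C with (- (minus (rcpow b (- z) :
        C_R_CompleteNormedModule) (rcpow a (- z))))%C.
    + rewrite Cmod_opp. eapply Rle_trans; [exact HI | right; ring].
    + change (minus (rcpow b (- z) : C_R_CompleteNormedModule) (rcpow a (- z))) with (rcpow b (-
        z) - rcpow a (- z))%C. ring.
  - intros t Ht. rewrite <- Cmod_norm, Cmod_mult, Cmod_opp, Cmod_rcpow.
    apply Rmult_le_compat_l; [apply Cmod_ge_0|].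
    replace (Re (- z - RtoC 1)) with (- Re z - 1) by (unfold Re; simpl; ring).
    apply Rpower_le_neg; [lra | lra].
Qed.

(** * Improper integrals over the positive half-line *)

Definition is_RInt_0_infty (f : R -> C) (l : C) : Prop :=
  is_RInt_gen (V := C_R_CompleteNormedModule) f (at_right 0) (Rbar_locally p_infty) l.

(** The thresholds are normalised to A <= 1 <= B, so that a <= b holds automatically and the
    half-line can be cut at 1. *)
Lemma is_RInt_0_infty_eps (f : R -> C) (l : C) :
  is_RInt_0_infty f l <->
  forall eps, 0 < eps -> exists A B, 0 < A <= 1 /\ 1 <= B /\
    forall a b, 0 < a <= A -> B <= b ->
      exists y, is_RInt (V := C_R_CompleteNormedModule) f a b y /\ Cmod (y - l) < eps.
Proof.
  split.
  - intros H eps Heps.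
    assert (HP := locally_Cmod l eps Heps).
    destruct (H _ HP) as [Q S HQ HS Himp].
    destruct HQ as [d Hd]. destruct HS as [M HM].
    exists (Rmin (d / 2) 1), (Rmax (M + 1) 1).
    assert (Hd0 := cond_pos d).
    split; [split; [apply Rmin_glb_lt; lra | apply Rmin_r]|].
    split; [apply Rmax_r|].
    intros a b [Ha1 Ha2] Hb.
    apply (Himp a b).
    + apply Hd; [|exact Ha1].
      assert (a <= d / 2) by (eapply Rle_trans; [exact Ha2 | apply Rmin_l]).
      apply ball_R. rewrite Rabs_pos_eq; lra.
    + apply HM. assert (M + 1 <= b) by (eapply Rle_trans; [apply Rmax_l | exact Hb]). lra.
  - intros H P [eps HP].
    destruct (H eps (cond_pos eps)) as (A & B & HA & HB & HAB).
    apply Filter_prod with (Q := fun a => 0 < a <= A) (R := fun b => B <= b).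
    + assert (HA' : 0 < A) by lra. exists (mkposreal A HA'). intros y Hy Hy0.
      split; auto. apply (proj1 (ball_R _ _ _)) in Hy. simpl in Hy. rewrite Rabs_pos_eq in Hy by
          lra. lra.
    + exists B. intros x Hx; lra.
    + intros a b Ha Hb. destruct (HAB a b Ha Hb) as (y & Hy & Hyl).
      exists y. split; auto. apply HP.
      apply (norm_compat1 (V := C_R_CompleteNormedModule)).
      rewrite <- Cmod_norm. exact Hyl.
Qed.

Lemma is_RInt_0_infty_unique (f : R -> C) (l : C) :
  is_RInt_0_infty f l -> RInt_0_infty f = l.
Proof.
  intros H. unfold RInt_0_infty.
  apply (is_RInt_gen_unique (V := C_R_CompleteNormedModule) (Fa := at_right 0) (Fb :=
      Rbar_locally p_infty)).
  exact H.
Qed.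

Lemma is_RInt_0_infty_inj (f : R -> C) (l l' : C) :
  is_RInt_0_infty f l -> is_RInt_0_infty f l' -> l = l'.
Proof.
  intros H H'. apply is_RInt_0_infty_unique in H, H'. congruence.
Qed.

Lemma is_RInt_0_infty_ext (f g : R -> C) (l : C) :
  (forall t, 0 < t -> f t = g t) -> is_RInt_0_infty f l -> is_RInt_0_infty g l.
Proof.
  intros Hfg H. apply is_RInt_0_infty_eps. intros eps Heps.
  destruct (proj1 (is_RInt_0_infty_eps f l) H eps Heps) as (A & B & HA & HB & HAB).
  exists A, B. repeat split; try lra. intros a b Ha Hb.
  destruct (HAB a b Ha Hb) as (y & Hy & Hyl). exists y. split; auto.
  apply (is_RInt_ext (V := C_R_CompleteNormedModule) f); auto.
  intros t. rewrite Rmin_left by lra. intros Ht. apply Hfg. lra.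
Qed.

Lemma is_RInt_0_infty_plus (f g : R -> C) (lf lg : C) :
  is_RInt_0_infty f lf -> is_RInt_0_infty g lg ->
  is_RInt_0_infty (fun t => (f t + g t)%C) (lf + lg)%C.
Proof. intros Hf Hg. exact (is_RInt_gen_plus (V := C_R_CompleteNormedModule) (Fa := at_right 0)
    (Fb := Rbar_locally p_infty) f g lf lg Hf Hg). Qed.

Lemma is_RInt_0_infty_minus (f g : R -> C) (lf lg : C) :
  is_RInt_0_infty f lf -> is_RInt_0_infty g lg ->
  is_RInt_0_infty (fun t => (f t - g t)%C) (lf - lg)%C.
Proof. intros Hf Hg. exact (is_RInt_gen_minus (V := C_R_CompleteNormedModule) (Fa := at_right 0)
    (Fb := Rbar_locally p_infty) f g lf lg Hf Hg). Qed.

Lemma is_RInt_Cmult (f : R -> C) (a b : R) (c l : C) :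
  is_RInt (V := C_R_CompleteNormedModule) f a b l ->
  is_RInt (V := C_R_CompleteNormedModule) (fun t => (c * f t)%C) a b (c * l)%C.
Proof.
  intros H.
  assert (H1 := is_RInt_fct_extend_fst (U := R_NormedModule) (V := R_NormedModule) f a b l H).
  assert (H2 := is_RInt_fct_extend_snd (U := R_NormedModule) (V := R_NormedModule) f a b l H).
  apply (is_RInt_fct_extend_pair (U := R_NormedModule) (V := R_NormedModule)); simpl.
  - apply (is_RInt_minus (V := R_NormedModule)); apply (is_RInt_scal (V := R_NormedModule));
      assumption.
  - apply (is_RInt_plus (V := R_NormedModule)); apply (is_RInt_scal (V := R_NormedModule));
      assumption.
Qed.

Lemma is_RInt_0_infty_scal (f : R -> C) (c l : C) :
  is_RInt_0_infty f l -> is_RInt_0_infty (fun t => (c * f t)%C) (c * l)%C.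
Proof.
  intros H. apply is_RInt_0_infty_eps. intros eps Heps.
  assert (Hc := Cmod_ge_0 c).
  destruct (proj1 (is_RInt_0_infty_eps f l) H (eps / (Cmod c + 1))) as (A & B & HA & HB & HAB).
  { apply Rdiv_lt_0_compat; lra. }
  exists A, B. repeat split; try lra. intros a b Ha Hb.
  destruct (HAB a b Ha Hb) as (y & Hy & Hyl). exists (c * y)%C. split.
  - apply is_RInt_Cmult; auto.
  - replace (c * y - c * l)%C with (c * (y - l))%C by ring. rewrite Cmod_mult.
    apply Rle_lt_trans with ((Cmod c) * (eps / (Cmod c + 1))).
    + apply Rmult_le_compat_l; lra.
    + apply Rlt_le_trans with ((Cmod c + 1) * (eps / (Cmod c + 1))).
      * apply Rmult_lt_compat_r; [apply Rdiv_lt_0_compat; lra | lra].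
      * right; field; lra.
Qed.

Lemma is_RInt_0_infty_comp_scal (f : R -> C) (lam : R) (l : C) : 0 < lam ->
  is_RInt_0_infty f l -> is_RInt_0_infty (fun t => (RtoC lam * f (lam * t)%R)%C) l.
Proof.
  intros Hlam H. apply is_RInt_0_infty_eps. intros eps Heps.
  destruct (proj1 (is_RInt_0_infty_eps f l) H eps Heps) as (A & B & HA & HB & HAB).
  exists (Rmin (A / lam) 1), (Rmax (B / lam) 1).
  split; [split; [apply Rmin_glb_lt; [apply Rdiv_lt_0_compat|]; lra | apply Rmin_r]|].
  split; [apply Rmax_r|].
  intros a b [Ha1 Ha2] Hb.
  assert (Ha3 : a <= A / lam) by (eapply Rle_trans; [exact Ha2 | apply Rmin_l]).
  assert (Hb3 : B / lam <= b) by (eapply Rle_trans; [apply Rmax_l | exact Hb]).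
  destruct (HAB (lam * a) (lam * b)) as (y & Hy & Hyl).
  - split; [nra|]. apply (Rmult_le_compat_l lam) in Ha3; [|lra].
    replace (lam * (A / lam)) with A in Ha3 by (field; lra). exact Ha3.
  - apply (Rmult_le_compat_l lam) in Hb3; [|lra].
    replace (lam * (B / lam)) with B in Hb3 by (field; lra). exact Hb3.
  - exists y. split; auto.
    rewrite <- (Rplus_0_r (lam * a)), <- (Rplus_0_r (lam * b)) in Hy.
    apply (is_RInt_comp_lin (V := C_R_CompleteNormedModule)) in Hy.
    revert Hy. apply (is_RInt_ext (V := C_R_CompleteNormedModule)).
    intros t _. rewrite Rplus_0_r. rewrite scal_R_Cmult. reflexivity.
Qed.

(** The map t |-> 1/t is a nonlinear change of variables, whose rule asks for a continuous
    integrand. It exchanges the two ends, whence the thresholds 1/B and 1/A; the minus sign of its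
    derivative is absorbed by reversing the bounds. *)
Lemma is_RInt_0_infty_comp_inv (f : R -> C) (l : C) :
  (forall t, 0 < t -> continuous (U := C_R_NormedModule) f t) ->
  is_RInt_0_infty f l -> is_RInt_0_infty (fun t => (RtoC (/ t ^ 2) * f (/ t)%R)%C) l.
Proof.
  intros Hc H. apply is_RInt_0_infty_eps. intros eps Heps.
  destruct (proj1 (is_RInt_0_infty_eps f l) H eps Heps) as (A & B & HA & HB & HAB).
  exists (/ B), (/ A).
  split; [split; [apply Rinv_0_lt_compat; lra | rewrite <- Rinv_1; apply Rinv_le_contravar; lra]|].
  split; [rewrite <- Rinv_1; apply Rinv_le_contravar; lra|].
  intros a b [Ha1 Ha2] Hb.
  assert (HiA : 0 < / A) by (apply Rinv_0_lt_compat; lra).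
  assert (HiB : 0 < / B) by (apply Rinv_0_lt_compat; lra).
  destruct (HAB (/ b) (/ a)) as (y & Hy & Hyl).
  - split; [apply Rinv_0_lt_compat; lra|]. rewrite <- (Rinv_inv A). apply Rinv_le_contravar; lra.
  - rewrite <- (Rinv_inv B). apply Rinv_le_contravar; lra.
  - exists y. split; auto.
    assert (Hle : a <= b).
    { apply Rle_trans with 1; [|apply Rle_trans with (/ A); [|lra]].
      - apply Rle_trans with (/ B); auto. rewrite <- Rinv_1; apply Rinv_le_contravar; lra.
      - rewrite <- Rinv_1; apply Rinv_le_contravar; lra. }
    assert (HI := is_RInt_comp (V := C_R_CompleteNormedModule) f Rinv (fun t => - / t ^ 2) a b).
    assert (HI' : is_RInt (V := C_R_CompleteNormedModule)
       (fun t => (RtoC (/ t ^ 2) * f (/ t)%R)%C) a b (opp (RInt (V := C_R_CompleteNormedModule) f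
           (/ a) (/ b)))).
    { apply (is_RInt_ext (V := C_R_CompleteNormedModule)
         (fun t => opp (scal (- / t ^ 2) (f (/ t) : C_R_CompleteNormedModule)))).
      - intros t _. rewrite scal_R_Cmult. change (opp (RtoC (- / t ^ 2) * f (/ t)%R)%C) with (-
          (RtoC (- / t ^ 2) * f (/ t)%R))%C. rewrite RtoC_opp. ring_C.
      - apply (is_RInt_opp (V := C_R_CompleteNormedModule)). apply HI.
        + intros t. rewrite Rmin_left, Rmax_right by assumption. intros Ht.
          apply Hc. apply Rinv_0_lt_compat. lra.
        + intros t. rewrite Rmin_left, Rmax_right by assumption. intros Ht. split.
          * auto_derive; [lra|field; lra].
          * apply (ex_derive_continuous (K := R_AbsRing) (V := R_NormedModule)).
            auto_derive. apply Rgt_not_eq; nra. }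
    apply (is_RInt_swap (V := C_R_CompleteNormedModule)) in Hy.
    apply (is_RInt_unique (V := C_R_CompleteNormedModule)) in Hy.
    rewrite Hy, opp_opp in HI'. exact HI'.
Qed.

(** The interval [1, 2] has length 1 and contributes at least c; the rest is nonnegative. A positive
    c gives strict positivity of Gamma on the real axis, and c = 0 gives plain monotonicity of the
    integral. *)
Lemma is_RInt_0_infty_Re_ge (f : R -> C) (l : C) (c : R) : is_RInt_0_infty f l ->
  (forall t, 0 < t -> 0 <= Re (f t)) ->
  (forall t, 1 <= t <= 2 -> c <= Re (f t)) -> c <= Re l.
Proof.
  intros H Hpos Hc.
  apply Rnot_lt_le. intros Hlt.
  destruct (proj1 (is_RInt_0_infty_eps f l) H (c - Re l)) as (A & B & HA & HB & HAB); [lra|].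
  destruct (HAB A (Rmax B 2)) as (y & Hy & Hyl); [lra | apply Rmax_l|].
  set (b := Rmax B 2) in *. assert (Hb : 2 <= b) by apply Rmax_r.
  assert (H1 := is_RInt_fct_extend_fst (U := R_NormedModule) (V := R_NormedModule) f A b y Hy).
  simpl in H1.
  assert (E1 : ex_RInt (fun t => fst (f t)) A 1).
  { apply (ex_RInt_Chasles_1 (V := R_CompleteNormedModule)) with b; [lra|]. eexists; exact H1. }
  assert (E2 : ex_RInt (fun t => fst (f t)) 1 b).
  { apply (ex_RInt_Chasles_2 (V := R_CompleteNormedModule)) with A; [lra|]. eexists; exact H1. }
  assert (E3 : ex_RInt (fun t => fst (f t)) 1 2).
  { apply (ex_RInt_Chasles_1 (V := R_CompleteNormedModule)) with b; [lra|]. exact E2. }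
  assert (E4 : ex_RInt (fun t => fst (f t)) 2 b).
  { apply (ex_RInt_Chasles_2 (V := R_CompleteNormedModule)) with 1; [lra|]. exact E2. }
  apply (is_RInt_unique (V := R_CompleteNormedModule)) in H1.
  rewrite <- (RInt_Chasles (V := R_CompleteNormedModule) _ A 1 b) in H1; auto.
  rewrite <- (RInt_Chasles (V := R_CompleteNormedModule) _ 1 2 b) in H1; auto.
  unfold plus in H1; simpl in H1.
  assert (0 <= RInt (fun t => fst (f t)) A 1) by (apply RInt_ge_0; auto; [lra | intros t Ht;
      apply Hpos; lra]).
  assert (0 <= RInt (fun t => fst (f t)) 2 b) by (apply RInt_ge_0; auto; intros t Ht; apply Hpos;
      lra).
  assert (c <= RInt (fun t => fst (f t)) 1 2).
  { replace c with (RInt (fun _ => c) 1 2).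
    - apply RInt_le; auto; [lra | apply ex_RInt_const | intros t Ht; apply Hc; lra].
    - rewrite RInt_const. unfold scal; simpl; unfold mult; simpl. ring. }
  assert (Hr := re_le_Cmod (y - l)).
  assert (Re (y - l) = fst y - Re l) by (unfold Re; simpl; ring).
  assert (Hr2 := Rle_abs (Re (y - l))). lra.
Qed.

Lemma is_RInt_Rpower (a b p : R) : 0 < a <= b -> p <> 0 ->
  is_RInt (fun t => Rpower t (p - 1)) a b ((Rpower b p - Rpower a p) / p).
Proof.
  intros Hab Hp.
  replace ((Rpower b p - Rpower a p) / p) with (minus (Rpower b p / p) (Rpower a p / p))
    by (unfold minus, plus, opp; simpl; field; auto).
  apply (is_RInt_derive (V := R_CompleteNormedModule) (fun t => Rpower t p / p));
  intros t; rewrite Rmin_left, Rmax_right by lra; intros Ht.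
  - replace (Rpower t (p - 1)) with (scal (/ p) (p * Rpower t (p - 1)))
      by (unfold scal; simpl; unfold mult; simpl; field; auto).
    apply (is_derive_ext (fun t => scal (/ p) (Rpower t p))).
    + intros u. unfold scal; simpl; unfold mult; simpl. unfold Rdiv; ring.
    + apply @is_derive_scal. apply is_derive_Rpower. lra.
  - apply continuous_Rpower. lra.
Qed.

Lemma RInt_Rpower_bound (f : R -> C) (a b p K : R) (y : C) : 0 < a <= b -> p <> 0 ->
  (forall t, a <= t <= b -> Cmod (f t) <= K * Rpower t (p - 1)) ->
  is_RInt (V := C_R_CompleteNormedModule) f a b y ->
  Cmod y <= K * ((Rpower b p - Rpower a p) / p).
Proof.
  intros Hab Hp Hf Hy. rewrite Cmod_norm.
  apply (norm_RInt_le (V := C_R_CompleteNormedModule) f (fun t => K * Rpower t (p - 1)) a b);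
      [lra| |exact Hy|].
  - intros t Ht. rewrite <- Cmod_norm. auto.
  - apply (is_RInt_scal (V := R_NormedModule)). apply is_RInt_Rpower; auto.
Qed.

Lemma Rpower_small (p eps : R) : 0 < p -> 0 < eps -> exists A, 0 < A <= 1 /\
  forall a, 0 < a <= A -> Rpower a p < eps.
Proof.
  intros Hp He. exists (Rmin 1 (Rpower (eps / 2) (/ p))).
  split; [split; [apply Rmin_glb_lt; [lra|apply Rpower_pos] | apply Rmin_l]|].
  intros a [Ha1 Ha2].
  assert (Ha : a <= Rpower (eps / 2) (/ p)) by (eapply Rle_trans; [exact Ha2 | apply Rmin_r]).
  apply Rle_lt_trans with (Rpower (Rpower (eps / 2) (/ p)) p).
  - apply Rle_Rpower_l; lra.
  - rewrite Rpower_mult. replace (/ p * p) with 1 by (field; lra). rewrite Rpower_1; lra.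
Qed.

Lemma Rpower_large (p eps : R) : 0 < p -> 0 < eps -> exists B, 1 <= B /\
  forall b, B <= b -> Rpower b (- p) < eps.
Proof.
  intros Hp He. destruct (Rpower_small p eps Hp He) as (A & HA & H).
  exists (/ A). split; [rewrite <- Rinv_1; apply Rinv_le_contravar; lra|].
  intros b Hb. assert (0 < / A) by (apply Rinv_0_lt_compat; lra).
  replace (Rpower b (- p)) with (Rpower (/ b) p).
  - apply H. split; [apply Rinv_0_lt_compat; lra|]. rewrite <- (Rinv_inv A).
    apply Rinv_le_contravar; lra.
  - unfold Rpower. rewrite ln_Rinv by lra. f_equal; ring.
Qed.

(** The power majorants make both tails small, so the partial integrals form a Cauchy filter. The
    limit inherits the bound K / al + K / be of the two majorising integrals; its explicit form
    later gives estimates uniform in n. *)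
Lemma is_RInt_0_infty_ex (f : R -> C) (K al be : R) : 0 < al -> 0 < be ->
  (forall t, 0 < t -> continuous (U := C_R_NormedModule) f t) ->
  (forall t, 0 < t <= 1 -> Cmod (f t) <= K * Rpower t (al - 1)) ->
  (forall t, 1 <= t -> Cmod (f t) <= K * Rpower t (- be - 1)) ->
  exists l, is_RInt_0_infty f l /\ Cmod l <= K * (/ al + / be).
Proof.
  intros Hal Hbe Hc H0 H1.
  assert (HK : 0 <= K).
  { generalize (H1 1 (Rle_refl 1)) (Cmod_ge_0 (f 1)).
    replace (Rpower 1 (- be - 1)) with 1 by (unfold Rpower; rewrite ln_1, Rmult_0_r, exp_0;
        auto). lra. }
  set (F := fun a b => RInt (V := C_R_CompleteNormedModule) f a b).
  assert (HF : forall a b, 0 < a -> 0 < b -> is_RInt (V := C_R_CompleteNormedModule) f a b (F a b)).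
  { intros a b Ha Hb. apply (RInt_correct (V := C_R_CompleteNormedModule)).
    apply (ex_RInt_continuous (V := C_R_CompleteNormedModule)). intros t Ht. apply Hc.
    assert (0 < Rmin a b) by (apply Rmin_glb_lt; auto). lra. }
  assert (HFC : forall a b c, 0 < a -> 0 < b -> 0 < c -> (F a c = F a b + F b c)%C).
  { intros a b c Ha Hb Hc'. symmetry.
    apply (RInt_Chasles (V := C_R_CompleteNormedModule)); eexists; apply HF; auto. }
  assert (B0 : forall a b, 0 < a <= b -> b <= 1 -> Cmod (F a b) <= K * (Rpower b al / al)).
  { intros a b Ha Hb. eapply Rle_trans; [apply (RInt_Rpower_bound f a b al K); auto; [lra| |apply
      HF; lra]|].
    - intros t Ht. apply H0. lra.
    - apply Rmult_le_compat_l; auto. apply Rmult_le_compat_r; [left; apply Rinv_0_lt_compat; auto|].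
      generalize (Rpower_pos a al). lra. }
  assert (B1 : forall a b, 1 <= a <= b -> Cmod (F a b) <= K * (Rpower a (- be) / be)).
  { intros a b Ha. eapply Rle_trans; [apply (RInt_Rpower_bound f a b (- be) K); auto; [lra|lra|
      |apply HF; lra]|].
    - intros t Ht. apply H1. lra.
    - apply Rmult_le_compat_l; auto.
      replace ((Rpower b (- be) - Rpower a (- be)) / - be) with ((Rpower a (- be) - Rpower b (-
          be)) / be) by (field; lra).
      apply Rmult_le_compat_r; [left; apply Rinv_0_lt_compat; auto|].
      generalize (Rpower_pos b (- be)). lra. }
  assert (Hone : forall p, Rpower 1 p = 1) by (intros; unfold Rpower; rewrite ln_1, Rmult_0_r,
      exp_0; auto).
  assert (B2 : forall a b, 0 < a <= 1 -> 1 <= b -> Cmod (F a b) <= K * (/ al + / be)).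
  { intros a b Ha Hb. rewrite (HFC a 1 b) by lra.
    eapply Rle_trans; [apply Cmod_triangle|].
    generalize (B0 a 1 Ha (Rle_refl 1)) (B1 1 b (conj (Rle_refl 1) Hb)). rewrite !Hone.
    unfold Rdiv. lra. }
  assert (Hlim : exists l : C_R_CompleteNormedModule, filterlim (fun ab : R * R => F (fst ab)
      (snd ab))
     (filter_prod (at_right 0) (Rbar_locally p_infty)) (locally l)).
  { apply (filterlim_locally_cauchy (U := C_R_CompleteNormedModule)). intros eps.
    set (e := eps / (4 * (K + 1))).
    assert (He : 0 < e) by (apply Rdiv_lt_0_compat; [apply cond_pos | lra]).
    assert (HeK : K * e < eps / 4).
    { unfold e. assert (Hep := cond_pos eps). apply Rlt_le_trans with ((K + 1) * (eps / (4 * (K +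
        1)))).
      - apply Rmult_lt_compat_r; [exact He | lra].
      - right; field; lra. }
    destruct (Rpower_small al (e * al)) as (A & HA & HA'); auto; [nra|].
    destruct (Rpower_large be (e * be)) as (B & HB & HB'); auto; [nra|].
    exists (fun ab => 0 < fst ab <= A /\ B <= snd ab). split.
    - apply Filter_prod with (Q := fun a => 0 < a <= A) (R := fun b => B <= b).
      + assert (HA0 : 0 < A) by lra. exists (mkposreal A HA0). intros y Hy Hy0.
        split; auto. apply (proj1 (ball_R _ _ _)) in Hy. simpl in Hy. rewrite Rabs_pos_eq in Hy
            by lra. lra.
      + exists B. intros x Hx; lra.
      + intros a b Ha Hb. split; auto.
    - assert (S0 : forall a a', 0 < a <= A -> 0 < a' <= A -> Cmod (F a a') <= eps / 4).
      { assert (S00 : forall a a', 0 < a <= a' -> a' <= A -> Cmod (F a a') <= eps / 4).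
        { intros a a' Ha Ha'. eapply Rle_trans; [apply B0; lra|].
          apply Rle_trans with (K * e); [|lra]. apply Rmult_le_compat_l; auto.
          apply Rle_div_l; [lra|]. left; apply HA'; lra. }
        intros a a' Ha Ha'. destruct (Rle_dec a a') as [Hl|Hl]; [apply S00; lra|].
        replace (F a a') with (- F a' a)%C; [rewrite Cmod_opp; apply S00; lra|].
        unfold F. apply (opp_RInt_swap (V := C_R_CompleteNormedModule)). eexists; apply HF; lra. }
      assert (S1 : forall a a', B <= a -> B <= a' -> Cmod (F a a') <= eps / 4).
      { assert (S00 : forall a a', B <= a <= a' -> Cmod (F a a') <= eps / 4).
        { intros a a' Ha. eapply Rle_trans; [apply B1; lra|].
          apply Rle_trans with (K * e); [|lra]. apply Rmult_le_compat_l; auto.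
          apply Rle_div_l; [lra|]. left; apply HB'; lra. }
        intros a a' Ha Ha'. destruct (Rle_dec a a') as [Hl|Hl]; [apply S00; lra|].
        replace (F a a') with (- F a' a)%C; [rewrite Cmod_opp; apply S00; lra|].
        unfold F. apply (opp_RInt_swap (V := C_R_CompleteNormedModule)). eexists; apply HF; lra. }
      intros [a b] [a' b'] [Ha Hb] [Ha' Hb']; simpl in *.
      apply (norm_compat1 (V := C_R_CompleteNormedModule)). rewrite <- Cmod_norm.
      change (Cmod (F a' b' - F a b) < eps).
      replace (F a' b' - F a b)%C with (F a' a + F b b')%C.
      + eapply Rle_lt_trans; [apply Cmod_triangle|].
        generalize (S0 a' a Ha' Ha) (S1 b b' Hb Hb') (cond_pos eps). lra.
      + rewrite (HFC a' a b') by lra. rewrite (HFC a b b') by lra. ring. }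
  destruct Hlim as [l Hl]. exists l.
  assert (Hfl : is_RInt_0_infty f l).
  { intros P HP. specialize (Hl P HP).
    assert (Hpos : filter_prod (at_right 0) (Rbar_locally p_infty) (fun ab => 0 < fst ab /\ 0 <
        snd ab)).
    { apply Filter_prod with (Q := fun a => 0 < a) (R := fun b => 0 < b).
      - exists (mkposreal 1 Rlt_0_1). auto.
      - exists 0; auto.
      - auto. }
    unfold filtermapi. unfold filtermap in Hl.
    generalize (filter_and _ _ Hl Hpos). apply filter_imp.
    intros [a b] [H2 [H3 H4]]; simpl in *. exists (F a b); auto. }
  split; auto.
  apply Rnot_lt_le. intros Hlt.
  destruct (proj1 (is_RInt_0_infty_eps f l) Hfl (Cmod l - K * (/ al + / be))) as (A & B & HA & HB
      & HAB); [lra|].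
  destruct (HAB A B) as (y & Hy & Hyl); [lra|lra|].
  apply (is_RInt_unique (V := C_R_CompleteNormedModule)) in Hy. fold (F A B) in Hy.
  assert (Hy2 := B2 A B HA HB). rewrite Hy in Hy2.
  assert (Ht := Cmod_triangle y (- (y - l))). rewrite Cplus_minus_opp in Ht.
  rewrite Cmod_opp in Ht. lra.
Qed.

(** * The Gamma integral *)

Lemma exp_le_compat (x y : R) : x <= y -> exp x <= exp y.
Proof. intros [H | ->]; [left; apply exp_increasing; auto | lra]. Qed.

(** The exponent p ln t - t is maximal at t = p; the inequality is ln u <= u - 1 at u = t / p. *)
Lemma exp_Rpower_bound (p t : R) : 0 < p -> 0 < t ->
  exp (- t) * Rpower t p <= exp (p * ln p - p).
Proof.
  intros Hp Ht. unfold Rpower. rewrite <- exp_plus. apply exp_le_compat.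
  assert (Htp : 0 < t / p) by (apply Rdiv_lt_0_compat; auto).
  assert (H : ln (t / p) <= t / p - 1).
  { generalize (exp_ineq1_le (ln (t / p))). rewrite exp_ln by auto. lra. }
  rewrite ln_div in H by auto.
  apply (Rmult_le_compat_l p) in H; [|lra].
  replace (p * (t / p - 1)) with (t - p) in H by (field; lra). lra.
Qed.

Lemma continuous_exp_opp (t : R) : continuous (fun t => exp (- t)) t.
Proof.
  apply (ex_derive_continuous (K := R_AbsRing) (V := R_NormedModule)). auto_derive. auto.
Qed.

Lemma Cmod_RtoC_pos (x : R) : 0 <= x -> Cmod (RtoC x) = x.
Proof. intros. rewrite Cmod_R. apply Rabs_pos_eq; auto. Qed.

Lemma Cmod_Gamma_integrand (t : R) (z : C) :
  Cmod (RtoC (exp (- t)) * rcpow t (z - RtoC 1)) = exp (- t) * Rpower t (Re z - 1).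
Proof.
  rewrite Cmod_mult, Cmod_RtoC_pos, Cmod_rcpow by (left; apply exp_pos).
  reflexivity.
Qed.

Lemma is_RInt_CGamma (z : C) : 0 < Re z ->
  is_RInt_0_infty (fun t : R => (RtoC (exp (- t)) * rcpow t (z - RtoC 1))%C) (CGamma z).
Proof.
  (* [K] bounds e^(-t) t^(Re z + 1), so that for t >= 1 the integrand is at most K t^(-2). *)
  intros Hz. set (K := exp ((Re z + 1) * ln (Re z + 1) - (Re z + 1))).
  assert (HK : 0 < K) by apply exp_pos.
  destruct (is_RInt_0_infty_ex (fun t : R => (RtoC (exp (- t)) * rcpow t (z - RtoC 1))%C)
     (1 + K) (Re z) 1) as (l & Hl & _); auto; try lra.
  - intros t Ht. apply continuous_Cmult.
    + apply (continuous_RtoC (fun t => exp (- t))), continuous_exp_opp.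
    + apply continuous_rcpow; auto.
  - intros t Ht. rewrite Cmod_Gamma_integrand.
    apply Rmult_le_compat_r; [left; apply Rpower_pos|].
    assert (exp (- t) <= 1) by (rewrite <- exp_0; apply exp_le_compat; lra). lra.
  - intros t Ht. rewrite Cmod_Gamma_integrand.
    assert (H := exp_Rpower_bound (Re z + 1) t ltac:(lra) ltac:(lra)). fold K in H.
    replace (Re z - 1) with ((Re z + 1) + (- 1 - 1)) by ring. rewrite Rpower_plus.
    assert (H2 := Rpower_pos t (- 1 - 1)). rewrite <- Rmult_assoc.
    apply Rmult_le_compat_r; [left; exact H2 | eapply Rle_trans; [exact H | lra]].
  - replace (CGamma z) with l; auto. symmetry. apply is_RInt_0_infty_unique. exact Hl.
Qed.

Lemma is_RInt_CGamma_scal (lam : R) (z : C) : 0 < lam -> 0 < Re z ->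
  is_RInt_0_infty (fun t : R => (RtoC (exp (- (lam * t))) * rcpow t (z - RtoC 1))%C)
    (CGamma z * rcpow lam (- z))%C.
Proof.
  intros Hlam Hz.
  assert (H := is_RInt_0_infty_scal _ (rcpow lam (- z)) _
    (is_RInt_0_infty_comp_scal _ lam _ Hlam (is_RInt_CGamma z Hz))).
  rewrite Cmult_comm. revert H. apply is_RInt_0_infty_ext.
  intros t Ht. cbv beta.
  rewrite rcpow_mult by assumption. rewrite (rcpow_minus lam), rcpow_1_r, rcpow_opp by assumption.
  field. split; [apply RtoC_neq_0; lra | apply rcpow_nonzero].
Qed.

Lemma is_RInt_0_infty_derive (F f : R -> C) :
  (forall t, 0 < t -> is_derive (V := C_R_NormedModule) F t (f t)) ->
  (forall t, 0 < t -> continuous (U := C_R_NormedModule) f t) ->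
  (forall eps, 0 < eps -> exists A, 0 < A <= 1 /\ forall a, 0 < a <= A -> Cmod (F a) < eps) ->
  (forall eps, 0 < eps -> exists B, 1 <= B /\ forall b, B <= b -> Cmod (F b) < eps) ->
  is_RInt_0_infty f (RtoC 0).
Proof.
  intros Hd Hc H0 H1. apply is_RInt_0_infty_eps. intros eps Heps.
  destruct (H0 (eps / 2)) as (A & HA & HA'); [lra|].
  destruct (H1 (eps / 2)) as (B & HB & HB'); [lra|].
  exists A, B. repeat split; try lra. intros a b Ha Hb.
  exists (F b - F a)%C. split.
  - apply (is_RInt_derive (V := C_R_CompleteNormedModule) F f);
    intros t; rewrite Rmin_left by lra; intros Ht; [apply Hd | apply Hc]; lra.
  - replace (F b - F a - 0)%C with (F b + - F a)%C by ring_C.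
    eapply Rle_lt_trans; [apply Cmod_triangle|]. rewrite Cmod_opp.
    generalize (HA' a Ha) (HB' b Hb). lra.
Qed.

(** Integration by parts: the difference of the two integrands is the derivative of - e^(-t) t^z,
    which vanishes at both ends because Re z > 0. *)
Lemma CGamma_plus_1 (z : C) : 0 < Re z -> CGamma (z + RtoC 1) = (z * CGamma z)%C.
Proof.
  intros Hz.
  set (g := fun (z : C) (t : R) => (RtoC (exp (- t)) * rcpow t (z - RtoC 1))%C).
  assert (Hz1 : 0 < Re (z + RtoC 1)) by (unfold Re in *; simpl; lra).
  assert (H := is_RInt_0_infty_minus _ _ _ _ (is_RInt_CGamma (z + RtoC 1) Hz1)
     (is_RInt_0_infty_scal _ z _ (is_RInt_CGamma z Hz))).
  assert (Hmod : forall t, 0 < t -> Cmod (- (RtoC (exp (- t)) * rcpow t z)) = exp (- t) * Rpower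
      t (Re z)).
  { intros t Ht. rewrite Cmod_opp, Cmod_mult, Cmod_RtoC_pos, Cmod_rcpow by (left; apply exp_pos).
      auto. }
  assert (H' : is_RInt_0_infty (fun t => (g (z + RtoC 1)%C t - z * g z t)%C) (RtoC 0)).
  { apply (is_RInt_0_infty_derive (fun t => - (RtoC (exp (- t)) * rcpow t z))%C).
    - intros t Ht. unfold g.
      replace (z + RtoC 1 - RtoC 1)%C with z by ring.
      apply (is_derive_ext (V := C_R_NormedModule)
        (fun t => (- (exp (- t) * (exp (Re z * ln t) * cos (Im z * ln t))),
                   - (exp (- t) * (exp (Re z * ln t) * sin (Im z * ln t)))))).
      { intros u. apply C_ext; unfold rcpow, Re, Im; simpl; ring. }
      rewrite rcpow_minus, rcpow_1_r by assumption.
      replace (RtoC (exp (- t)) * rcpow t z - z * (RtoC (exp (- t)) * (rcpow t z / RtoC t)))%C with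
        (- (- exp (- t) * (exp (Re z * ln t) * cos (Im z * ln t)) +
          exp (- t) * (exp (Re z * ln t) * (Re z / t) * cos (Im z * ln t) + exp (Re z * ln t) *
              (- sin (Im z * ln t) * (Im z / t)))),
         - (- exp (- t) * (exp (Re z * ln t) * sin (Im z * ln t)) +
          exp (- t) * (exp (Re z * ln t) * (Re z / t) * sin (Im z * ln t) + exp (Re z * ln t) *
              (cos (Im z * ln t) * (Im z / t))))).
      + apply is_derive_pair; auto_derive; auto; field; lra.
      + apply C_ext; unfold rcpow, Re, Im; simpl; field; lra.
    - intros t Ht. unfold g. apply (continuous_minus (V := C_R_NormedModule)).
      + apply continuous_Cmult; [apply (continuous_RtoC (fun t => exp (- t))), continuous_exp_opp
          | apply continuous_rcpow; auto].
      + apply continuous_Cmult; [apply continuous_const|].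
        apply continuous_Cmult; [apply (continuous_RtoC (fun t => exp (- t))), continuous_exp_opp
            | apply continuous_rcpow; auto].
    - intros eps Heps. destruct (Rpower_small (Re z) eps Hz Heps) as (A & HA & HA').
      exists A. split; auto. intros a Ha. rewrite Hmod by lra.
      generalize (HA' a Ha) (Rpower_pos a (Re z)). intros.
      assert (exp (- a) <= 1) by (rewrite <- exp_0; apply exp_le_compat; lra).
      assert (0 < exp (- a)) by apply exp_pos. nra.
    - intros eps Heps. set (K := exp ((Re z + 1) * ln (Re z + 1) - (Re z + 1))).
      assert (HK : 0 < K) by apply exp_pos.
      exists (1 + K / eps). assert (0 < K / eps) by (apply Rdiv_lt_0_compat; auto).
      split; [lra|]. intros b Hb. rewrite Hmod by lra.
      assert (Hb2 := exp_Rpower_bound (Re z + 1) b ltac:(lra) ltac:(lra)). fold K in Hb2.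
      rewrite Rpower_plus, Rpower_1 in Hb2 by lra.
      apply Rmult_lt_reg_r with b; [lra|]. rewrite Rmult_assoc.
      apply Rle_lt_trans with K; auto.
      apply Rlt_le_trans with (eps * (1 + K / eps)).
      + replace (eps * (1 + K / eps)) with (eps + K) by (field; lra). lra.
      + apply Rmult_le_compat_l; lra. }
  assert (E := is_RInt_0_infty_inj _ _ _ H H').
  replace (CGamma (z + RtoC 1)) with ((CGamma (z + RtoC 1) - z * CGamma z) + z * CGamma z)%C by
      ring.
  rewrite E. ring.
Qed.

(** * Absence of zeros of Gamma *)

Lemma two_mul_le_exp_diff (y : R) : 0 <= y -> 2 * y <= exp y - exp (- y).
Proof.
  intros Hy. destruct Hy as [Hy | <-]; [|rewrite Ropp_0; lra].
  destruct (MVT_gen (fun y => exp y - exp (- y) - 2 * y) 0 y (fun y => exp y + exp (- y) - 2)) as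
      (c & Hc & E).
  - intros x _. auto_derive; auto. ring.
  - intros x _. apply derivable_continuous_pt.
    apply ex_derive_Reals_0. auto_derive; auto.
  - rewrite Ropp_0, exp_0 in E.
    assert (0 <= exp c + exp (- c) - 2).
    { assert (exp c * exp (- c) = 1) by (rewrite <- exp_plus, Rplus_opp_r; apply exp_0).
      assert (Hp := exp_pos c). apply Rmult_le_reg_l with (exp c); [exact Hp|].
      replace (exp c * (exp c + exp (- c) - 2)) with (exp c ^ 2 + exp c * exp (- c) - 2 * exp c)
          by ring.
      rewrite H, Rmult_0_r. replace (exp c ^ 2 + 1 - 2 * exp c) with ((exp c - 1) ^ 2) by ring.
      apply pow2_ge_0. }
    assert (0 <= (exp c + exp (- c) - 2) * (y - 0)) by (apply Rmult_le_pos; [assumption | rewrite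
        Rmin_left, Rmax_right in Hc by lra; lra]). lra.
Qed.

(** With u = e^x the right side is 4 sinh(x/2)^2, and sinh y >= y for y >= 0. The majorant is chosen
    among combinations of u, 1 and 1/u because at u = t / a these integrate against e^(-t) t^(a-1)
    to values of Gamma at a + 1, a and a - 1. *)
Lemma ln_sqr_le (u : R) : 0 < u -> ln u ^ 2 <= u - 2 + / u.
Proof.
  assert (A : forall x, 0 <= x -> x ^ 2 <= exp x - 2 + exp (- x)).
  { intros x Hx. assert (H := two_mul_le_exp_diff (x / 2) ltac:(lra)).
    replace (exp x) with (exp (x / 2) * exp (x / 2)) by (rewrite <- exp_plus; f_equal; field).
    replace (exp (- x)) with (exp (- (x / 2)) * exp (- (x / 2))) by (rewrite <- exp_plus;
        f_equal; field).
    assert (exp (x / 2) * exp (- (x / 2)) = 1) by (rewrite <- exp_plus, Rplus_opp_r; apply exp_0).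
    nra. }
  intros Hu. assert (E : u = exp (ln u)) by (symmetry; apply exp_ln; auto).
  assert (E' : / u = exp (- ln u)) by (rewrite exp_Ropp, exp_ln; auto).
  rewrite E' . rewrite E at 2. destruct (Rle_dec 0 (ln u)) as [H|H].
  - apply A; auto.
  - assert (H2 := A (- ln u) ltac:(lra)). rewrite Ropp_involutive in H2. nra.
Qed.

Lemma Rabs_sin_le (y : R) : Rabs (sin y) <= Rabs y.
Proof.
  assert (A : forall y, 0 <= y -> Rabs (sin y) <= y).
  { intros x Hx. destruct (Rle_dec 1 x) as [H|H].
    - apply Rle_trans with 1; auto. apply Rabs_le. apply SIN_bound.
    - destruct Hx as [Hx | <-]; [|rewrite sin_0, Rabs_R0; lra].
      assert (0 <= sin x) by (apply sin_ge_0; [lra | generalize PI2_1; lra]).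
      rewrite Rabs_pos_eq by auto. left; apply sin_lt_x; auto. }
  destruct (Rle_dec 0 y) as [H|H].
  - rewrite (Rabs_pos_eq y) by auto. auto.
  - rewrite (Rabs_left y) by lra. rewrite <- (Rabs_Ropp (sin y)), <- sin_neg. apply A. lra.
Qed.

Lemma cos_ge_quad (x : R) : 1 - x ^ 2 / 2 <= cos x.
Proof.
  replace x with (2 * (x / 2)) at 2 by field. rewrite cos_2a_sin.
  assert (H := Rabs_sin_le (x / 2)). apply Rsqr_le_abs_1 in H. unfold Rsqr in H. nra.
Qed.

(** Write z = a + iy. Multiplying Gamma(z) by a^(-iy) turns the phase into (t/a)^(iy), which is near
    1 around t = a where the weight e^(-t) t^(a-1) concentrates. Its real part is at least 1 -
    (y^2/2) ln(t/a)^2, hence at least 1 - (y^2/2)(t/a - 2 + a/t). Integrating and reducing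
    Gamma(a+1) and Gamma(a) to Gamma(a-1) leaves the lower bound Gamma(a-1) (a - 1 - y^2/2), which
    the hypothesis makes positive. *)
Lemma CGamma_nonzero_large (z : C) : 1 < Re z -> Im z ^ 2 < 2 * (Re z - 1) ->
  CGamma z <> RtoC 0.
Proof.
  intros Hz Hy E.
  set (a := Re z) in *. set (y := Im z) in *.
  assert (Ea : forall b, Re (RtoC b) = b) by reflexivity.
  assert (H1 := is_RInt_CGamma (RtoC a) ltac:(rewrite Ea; lra)).
  assert (H2 := is_RInt_CGamma (RtoC (a + 1)) ltac:(rewrite Ea; lra)).
  assert (H0 := is_RInt_CGamma (RtoC (a - 1)) ltac:(rewrite Ea; lra)).
  assert (Hzz := is_RInt_CGamma z ltac:(fold a; lra)).
  assert (G2 : CGamma (RtoC (a + 1)) = (RtoC a * CGamma (RtoC a))%C).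
  { rewrite RtoC_plus. apply CGamma_plus_1. rewrite Ea; lra. }
  assert (G1 : CGamma (RtoC a) = (RtoC (a - 1) * CGamma (RtoC (a - 1)))%C).
  { rewrite <- CGamma_plus_1 by (rewrite Ea; lra). f_equal. rewrite RtoC_minus. ring. }
  assert (Hpos : exp (- 2) * Rmin 1 (Rpower 2 (a - 1)) <= Re (CGamma (RtoC a))).
  { apply (is_RInt_0_infty_Re_ge _ _ _ H1); intros t Ht;
    rewrite <- RtoC_minus, rcpow_real, <- RtoC_mult, Ea.
    - apply Rmult_le_pos; left; [apply exp_pos | apply Rpower_pos].
    - apply Rmult_le_compat; [left; apply exp_pos | apply Rmin_glb; [lra | left; apply
        Rpower_pos] | |].
      + apply exp_le_compat; lra.
      + apply Rle_trans with 1; [apply Rmin_l|].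
        apply Rle_trans with (Rpower t 0); [rewrite Rpower_O; lra | apply Rle_Rpower; lra]. }
  assert (Hpos' : 0 < exp (- 2) * Rmin 1 (Rpower 2 (a - 1))).
  { apply Rmult_lt_0_compat; [apply exp_pos | apply Rmin_glb_lt; [lra | apply Rpower_pos]]. }
  set (c := rcpow a (0, - y)).
  assert (HD := is_RInt_0_infty_minus _ _ _ _ (is_RInt_0_infty_scal _ c _ Hzz)
    (is_RInt_0_infty_minus _ _ _ _ (is_RInt_0_infty_scal _ (RtoC (1 + y ^ 2)) _ H1)
      (is_RInt_0_infty_plus _ _ _ _ (is_RInt_0_infty_scal _ (RtoC (y ^ 2 / 2 / a)) _ H2)
      (is_RInt_0_infty_scal _ (RtoC (y ^ 2 / 2 * a)) _ H0)))).
  (* Up to the factor e^(-t) t^(a-1) this real part is cos(y ln(t/a)) - 1 + (y^2/2)(t/a - 2 +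
     a/t). *)
  assert (Hge : forall t, 0 < t -> 0 <= Re (c * (RtoC (exp (- t)) * rcpow t (z - RtoC 1)) -
    (RtoC (1 + y ^ 2) * (RtoC (exp (- t)) * rcpow t (RtoC a - RtoC 1)) -
    (RtoC (y ^ 2 / 2 / a) * (RtoC (exp (- t)) * rcpow t (RtoC (a + 1) - RtoC 1)) +
     RtoC (y ^ 2 / 2 * a) * (RtoC (exp (- t)) * rcpow t (RtoC (a - 1) - RtoC 1)))))%C).
  { intros t Ht.
    replace (z - RtoC 1)%C with (RtoC (a - 1) + (0, y))%C by (apply C_ext; unfold a, y, Re, Im;
        simpl; ring).
    rewrite rcpow_plus, <- !RtoC_minus, !rcpow_real.
    replace (a + 1 - 1) with ((a - 1) + 1) by ring.
    replace (Rpower t (a - 1 - 1)) with (Rpower t (a - 1) * / t).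
    2: { replace (a - 1 - 1) with ((a - 1) + Ropp 1) by ring. rewrite Rpower_plus, Rpower_Ropp,
        Rpower_1; auto. }
    rewrite Rpower_plus, Rpower_1 by auto.
    replace (c * (RtoC (exp (- t)) * (RtoC (Rpower t (a - 1)) * rcpow t (0, y))))%C
      with (RtoC (exp (- t) * Rpower t (a - 1)) * (c * rcpow t (0%R, y)))%C by (rewrite
          RtoC_mult; ring).
    replace (Re _) with (exp (- t) * Rpower t (a - 1) * (cos (y * (ln t - ln a)) - 1 + y ^ 2 / 2
        * (t / a - 2 + / (t / a)))).
    - apply Rmult_le_pos; [apply Rmult_le_pos; left; [apply exp_pos | apply Rpower_pos]|].
      assert (Hcos := cos_ge_quad (y * (ln t - ln a))).
      assert (Hln := ln_sqr_le (t / a) ltac:(apply Rdiv_lt_0_compat; lra)).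
      rewrite ln_div in Hln by lra.
      apply (Rmult_le_compat_l (y ^ 2 / 2)) in Hln; [|nra].
      replace ((y * (ln t - ln a)) ^ 2 / 2) with (y ^ 2 / 2 * (ln t - ln a) ^ 2) in Hcos by field.
      lra.
    - replace (y * (ln t - ln a)) with (y * ln t - y * ln a) by ring. rewrite cos_minus.
      unfold c, rcpow, Re, Im; simpl. rewrite !Rmult_0_l, exp_0.
      replace (- y * ln a) with (- (y * ln a)) by ring. rewrite cos_neg, sin_neg.
      field; lra. }
  assert (Hl := is_RInt_0_infty_Re_ge _ _ 0 HD Hge (fun t Ht => Hge t ltac:(lra))).
  rewrite E, G2 in Hl.
  set (A := Re (CGamma (RtoC a))) in *.
  set (B := Re (CGamma (RtoC (a - 1)))) in *.
  assert (EA : A = (a - 1) * B).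
  { unfold A. rewrite G1. unfold B, Re. simpl. ring. }
  replace (Re _) with (- ((1 + y ^ 2) * A - (y ^ 2 / 2 / a * (a * A) + y ^ 2 / 2 * a * B))) in Hl
    by (unfold A, B, Re; simpl; ring).
  assert (HB : 0 < B) by (apply Rmult_lt_reg_l with (a - 1); lra).
  replace (- ((1 + y ^ 2) * A - (y ^ 2 / 2 / a * (a * A) + y ^ 2 / 2 * a * B)))
    with (- (B * ((a - 1) - y ^ 2 / 2))) in Hl by (rewrite EA; field; lra).
  assert (0 < B * (a - 1 - y ^ 2 / 2)) by (apply Rmult_lt_0_compat; lra). lra.
Qed.

(** By [CGamma_plus_1] a zero at z propagates to z + 1, z + 2 and so on. The real part grows while
    the imaginary part stays, so that [CGamma_nonzero_large] eventually forbids it. *)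
Lemma CGamma_nonzero (z : C) : 0 < Re z -> CGamma z <> RtoC 0.
Proof.
  assert (A : forall n z, 0 < Re z -> 1 + Im z ^ 2 < Re z + INR n -> CGamma z <> RtoC 0).
  { induction n as [|n IH]; intros w Hw Hn.
    - simpl in Hn. apply CGamma_nonzero_large; nra.
    - intros E. apply (IH (w + RtoC 1)%C).
      + unfold Re in *; simpl; lra.
      + rewrite S_INR in Hn. unfold Re, Im in *. simpl in *. rewrite Rplus_0_r. lra.
      + rewrite CGamma_plus_1, E by auto. ring. }
  intros Hz. destruct (INR_archimed 1 (1 + Im z ^ 2)) as [n Hn]; [lra|].
  apply (A n); auto. lra.
Qed.

(** * Poisson summation for the Gaussian *)

Lemma continuous_is_derive (f : R -> R) (x l : R) : is_derive f x l -> continuous f x.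
Proof.
  intros H. apply (ex_derive_continuous (K := R_AbsRing) (V := R_NormedModule)).
  exists l. exact H.
Qed.

Lemma MVT_is_derive (f df : R -> R) (a b : R) : a < b ->
  (forall x, a <= x <= b -> is_derive f x (df x)) ->
  exists c, a < c < b /\ f b - f a = df c * (b - a).
Proof.
  intros Hab Hd.
  destruct (MVT_cor2 f df a b Hab) as (c & Hc & Hcb).
  - intros c Hc. apply is_derive_Reals. auto.
  - exists c. split; auto.
Qed.

Lemma Rabs_increment_le (f df : R -> R) (a b B : R) : a <= b ->
  (forall x, a <= x <= b -> is_derive f x (df x)) ->
  (forall x, a <= x <= b -> Rabs (df x) <= B) ->
  Rabs (f b - f a) <= B * (b - a).
Proof.
  intros [Hab | <-] Hd HB.
  - destruct (MVT_is_derive f df a b Hab Hd) as (c & Hc & ->).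
    rewrite Rabs_mult, (Rabs_pos_eq (b - a)) by lra.
    apply Rmult_le_compat_r; [lra | apply HB; lra].
  - rewrite !Rminus_diag, Rabs_R0. lra.
Qed.

(** Jordan's inequality, by concavity: sin(PI x) - 2x vanishes at 0 and 1/2, so a negative value in
    between would force its derivative to be negative before and positive after, although that
    derivative decreases. *)
Lemma sin_PI_ge (x : R) : 0 <= x <= 1 / 2 -> 2 * x <= sin (PI * x).
Proof.
  intros Hx. apply Rnot_lt_le. intros Hlt. assert (Hpi := PI_RGT_0).
  assert (H0 : 0 < x). { destruct Hx as [[Hx | <-] _]; auto. rewrite Rmult_0_r, sin_0 in Hlt. lra. }
  assert (H1 : x < 1 / 2). { destruct Hx as [_ [Hx | ->]]; auto. replace (PI * (1 / 2)) with (PI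
      / 2) in Hlt by field. rewrite sin_PI2 in Hlt. lra. }
  assert (Hd : forall y, is_derive (fun y => sin (PI * y) - 2 * y) y (PI * cos (PI * y) - 2)).
  { intros y. auto_derive; auto. ring. }
  destruct (MVT_is_derive _ _ 0 x H0 (fun y _ => Hd y)) as (c1 & Hc1 & E1).
  destruct (MVT_is_derive _ _ x (1 / 2) H1 (fun y _ => Hd y)) as (c2 & Hc2 & E2).
  rewrite Rmult_0_r, sin_0 in E1.
  replace (PI * (1 / 2)) with (PI / 2) in E2 by field. rewrite sin_PI2 in E2.
  assert (Hcos : cos (PI * c2) < cos (PI * c1)).
  { apply cos_decreasing_1; nra. }
  assert (PI * cos (PI * c2) < PI * cos (PI * c1)) by nra.
  assert (PI * cos (PI * c1) - 2 < 0).
  { apply Rnot_le_lt. intros Hn. apply (Rmult_le_compat_r (x - 0)) in Hn; lra. }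
  assert (0 < PI * cos (PI * c2) - 2).
  { apply Rnot_le_lt. intros Hn. apply (Rmult_le_compat_r (1 / 2 - x)) in Hn; lra. }
  lra.
Qed.

(** The sum of e^(2 PI i m x) over |m| <= M, folded into cosines. Integrated against the Gaussian it
    produces partial sums of theta at 1/v through its frequencies and of theta at v through its
    peaks at the integers. *)
Fixpoint dirichlet (M : nat) (x : R) : R :=
  match M with
  | O => 1
  | S m => dirichlet m x + 2 * cos (2 * PI * INR (S m) * x)
  end.

Lemma dirichlet_S (m : nat) (x : R) :
  dirichlet (S m) x = dirichlet m x + 2 * cos (2 * PI * INR (S m) * x).
Proof. reflexivity. Qed.

(** Each term 2 cos(2 PI m x) sin(PI x) is a difference of two sines, and these telescope. *)
Lemma dirichlet_sin (M : nat) (x : R) :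
  dirichlet M x * sin (PI * x) = sin ((2 * INR M + 1) * PI * x).
Proof.
  induction M as [|m IH].
  - simpl. rewrite Rmult_1_l. f_equal; ring.
  - rewrite ?dirichlet_S. rewrite Rmult_plus_distr_r, IH.
    replace ((2 * INR m + 1) * PI * x) with (2 * PI * INR (S m) * x - PI * x) by (rewrite S_INR;
        ring).
    replace ((2 * INR (S m) + 1) * PI * x) with (2 * PI * INR (S m) * x + PI * x) by ring.
    rewrite sin_plus, sin_minus. ring.
Qed.

Lemma Rabs_dirichlet_le (M : nat) (x : R) : Rabs (dirichlet M x) <= 2 * INR M + 1.
Proof.
  induction M as [|m IH].
  - simpl. rewrite Rabs_R1. lra.
  - rewrite S_INR. rewrite ?dirichlet_S. eapply Rle_trans; [apply Rabs_triang|].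
    assert (Rabs (2 * cos (2 * PI * INR (S m) * x)) <= 2); [|lra].
    rewrite Rabs_mult, (Rabs_pos_eq 2) by lra.
    assert (Rabs (cos (2 * PI * INR (S m) * x)) <= 1) by (apply Rabs_le, COS_bound). lra.
Qed.

Lemma continuous_cos_lin (w x : R) : continuous (fun x => cos (w * x)) x.
Proof. eapply continuous_is_derive. auto_derive; auto. Qed.

Lemma continuous_dirichlet (M : nat) (x : R) : continuous (dirichlet M) x.
Proof.
  induction M as [|m IH].
  - apply continuous_const.
  - apply (continuous_plus (V := R_NormedModule)); auto.
    apply (continuous_mult (K := R_AbsRing)); [apply continuous_const | apply continuous_cos_lin].
Qed.

Lemma dirichlet_opp (M : nat) (x : R) : dirichlet M (- x) = dirichlet M x.
Proof.
  induction M as [|m IH]; [reflexivity|]. rewrite ?dirichlet_S. rewrite IH. do 2 f_equal.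
  rewrite <- cos_neg. f_equal. ring.
Qed.

Lemma dirichlet_shift (M k : nat) (x : R) : dirichlet M (INR k + x) = dirichlet M x.
Proof.
  induction M as [|m IH]; [reflexivity|]. rewrite ?dirichlet_S. rewrite IH. do 2 f_equal.
  rewrite <- (cos_period (2 * PI * INR (S m) * x) (S m * k)). f_equal. rewrite mult_INR. ring.
Qed.

Lemma sin_INR_PI (m : nat) : sin (INR m * PI) = 0.
Proof.
  induction m as [|m IH]; [simpl; rewrite Rmult_0_l; apply sin_0|].
  rewrite S_INR, Rmult_plus_distr_r, Rmult_1_l, neg_sin, IH. ring.
Qed.

Lemma is_RInt_dirichlet (M : nat) : is_RInt (dirichlet M) 0 (1 / 2) (1 / 2).
Proof.
  induction M as [|m IH].
  - replace (1 / 2) with (scal (1 / 2 - 0) 1) at 2 by (unfold scal; simpl; unfold mult; simpl;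
      ring).
    apply (is_RInt_const (V := R_NormedModule)).
  - replace (1 / 2) with (plus (1 / 2) 0) at 2 by (unfold plus; simpl; ring).
    apply (is_RInt_plus (V := R_NormedModule)); auto.
    assert (Hs := sin_INR_PI (S m)).
    assert (Hm : 0 < INR (S m)) by (apply lt_0_INR; lia).
    change (is_RInt (fun x => 2 * cos (2 * PI * INR (S m) * x)) 0 (1 / 2) 0).
    revert Hs Hm. generalize (INR (S m)). intros n Hs Hm. assert (Hpi := PI_RGT_0).
    replace 0 with (minus (sin (2 * PI * n * (1 / 2)) / (PI * n)) (sin (2 * PI * n * 0) / (PI *
        n))) at 2.
    + apply (is_RInt_derive (V := R_CompleteNormedModule) (fun x => sin (2 * PI * n * x) / (PI *
        n))).
      * intros x _. auto_derive; auto. field. lra.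
      * intros x _. apply (continuous_mult (K := R_AbsRing)); [apply continuous_const | apply
          continuous_cos_lin].
    + replace (2 * PI * n * (1 / 2)) with (n * PI) by field.
      rewrite Hs, Rmult_0_r, sin_0. unfold minus, plus, opp; simpl. field. lra.
Qed.

Lemma ex_RInt_cont (f : R -> R) (a b : R) : (forall x, continuous f x) -> ex_RInt f a b.
Proof. intros H. apply (ex_RInt_continuous (V := R_CompleteNormedModule)). auto. Qed.

Lemma Rabs_is_RInt_le (f : R -> R) (a b l B : R) : a <= b ->
  (forall x, a <= x <= b -> Rabs (f x) <= B) -> is_RInt f a b l -> Rabs l <= B * (b - a).
Proof.
  intros Hab HB Hl. rewrite Rmult_comm.
  exact (norm_RInt_le_const (V := R_NormedModule) f a b l B Hab HB Hl).
Qed.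

(* The quotient q x = (phi x - phi 0) / sin (PI x) is Lipschitz, and integrating
   q x * sin ((2M+1) PI x) by parts gains the factor 1 / (2M+1). *)
Lemma dirichlet_localization (phi dphi ddphi : R -> R) (B : R) (M : nat) :
  (forall x, is_derive phi x (dphi x)) -> (forall x, is_derive dphi x (ddphi x)) ->
  (forall x, 0 <= x <= 1 / 2 -> Rabs (dphi x) <= B) ->
  (forall x, 0 <= x <= 1 / 2 -> Rabs (ddphi x) <= B) ->
  Rabs (RInt (fun x => phi x * dirichlet M x) 0 (1 / 2) - phi 0 / 2) <= 10 * B / (2 * INR M + 1).
Proof.
  intros Hd Hdd HB1 HB2.
  assert (HM : 0 <= INR M) by apply pos_INR.
  set (N := 2 * INR M + 1). assert (HN : 1 <= N) by (unfold N; lra).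
  assert (HB : 0 <= B) by (eapply Rle_trans; [apply Rabs_pos | apply (HB1 0); lra]).
  assert (Hpi := PI_RGT_0). assert (Hpi4 := PI_4). assert (Hpi3 : 3 <= PI) by (generalize
      PI2_3_2; lra).
  assert (Hc : forall x, continuous phi x) by (intros; eapply continuous_is_derive; apply Hd).
  assert (Hdc : forall x, continuous dphi x) by (intros; eapply continuous_is_derive; apply Hdd).
  assert (HI : is_RInt (fun x => (phi x - phi 0) * dirichlet M x) 0 (1 / 2)
     (RInt (fun x => phi x * dirichlet M x) 0 (1 / 2) - phi 0 / 2)).
  { apply (is_RInt_ext (V := R_NormedModule) (fun x => minus (phi x * dirichlet M x) (scal (phi
      0) (dirichlet M x)))).
    - intros x _. unfold minus, plus, opp, scal; simpl; unfold mult; simpl. ring.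
    - replace (phi 0 / 2) with (scal (phi 0) (1 / 2)) by (unfold scal; simpl; unfold mult; simpl;
        field).
      apply (is_RInt_minus (V := R_NormedModule)).
      + apply (RInt_correct (V := R_CompleteNormedModule)), ex_RInt_cont. intros x.
        apply (continuous_mult (K := R_AbsRing)); [apply Hc | apply continuous_dirichlet].
      + apply (is_RInt_scal (V := R_NormedModule)). apply is_RInt_dirichlet. }
  set (I := RInt (fun x => phi x * dirichlet M x) 0 (1 / 2) - phi 0 / 2) in *.
  assert (Hphi : forall x, 0 <= x <= 1 / 2 -> Rabs (phi x - phi 0) <= B * x).
  { intros x Hx. replace x with (x - 0) at 2 by ring.
    apply (Rabs_increment_le phi dphi 0 x B); [lra | auto | intros; apply HB1; lra]. }
  assert (Hcg : forall x, continuous (fun x => (phi x - phi 0) * dirichlet M x) x).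
  { intros x. apply (continuous_mult (K := R_AbsRing)); [|apply continuous_dirichlet].
    apply (continuous_minus (V := R_NormedModule)); [apply Hc | apply continuous_const]. }
  assert (Hsin : forall x, 0 < x <= 1 / 2 -> 0 < 2 * x <= sin (PI * x)).
  { intros x Hx. split; [lra | apply sin_PI_ge; lra]. }
  (* The numerator of the derivative of q. In its own derivative the cosine terms cancel and (phi''
     + PI^2 (phi - phi 0)) sin(PI x) remains, of order x; hence [num] is of order x^2, which the
     sin^2 of the denominator compensates. *)
  set (num := fun x => dphi x * sin (PI * x) - (phi x - phi 0) * (PI * cos (PI * x))).
  assert (Hnum : forall x, 0 <= x <= 1 / 2 -> Rabs (num x) <= 36 * B * x ^ 2).
  { intros x Hx. replace (num x) with (num x - num 0) by (unfold num; rewrite Rmult_0_r, sin_0;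
      ring).
    replace (36 * B * x ^ 2) with (36 * B * x * (x - 0)) by ring.
    apply (Rabs_increment_le num (fun x => (ddphi x + PI ^ 2 * (phi x - phi 0)) * sin (PI * x)));
        [lra| |].
    - intros y _. unfold num.
      assert (E1 := is_derive_unique _ _ _ (Hd y)). assert (E2 := is_derive_unique _ _ _ (Hdd y)).
      auto_derive; [split; [eexists; apply Hdd | split; [eexists; apply Hd | auto]]|].
      replace (Derive (fun x => dphi x) y) with (ddphi y). replace (Derive (fun x => phi x) y)
          with (dphi y). ring.
    - intros y Hy. rewrite Rabs_mult.
      assert (S1 : Rabs (sin (PI * y)) <= 4 * x).
      { eapply Rle_trans; [apply Rabs_sin_le|]. rewrite Rabs_pos_eq by nra. nra. }
      assert (S2 : Rabs (ddphi y + PI ^ 2 * (phi y - phi 0)) <= 9 * B).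
      { eapply Rle_trans; [apply Rabs_triang|]. rewrite Rabs_mult, (Rabs_pos_eq (PI ^ 2)) by nra.
        assert (A1 := HB2 y ltac:(lra)). assert (A2 := Hphi y ltac:(lra)).
        assert (A3 : PI ^ 2 <= 16) by nra.
        assert (A4 : Rabs (phi y - phi 0) <= B / 2) by nra.
        assert (PI ^ 2 * Rabs (phi y - phi 0) <= 16 * (B / 2)); [|lra].
        apply Rmult_le_compat; auto; [nra | apply Rabs_pos]. }
      replace (36 * B * x) with ((9 * B) * (4 * x)) by ring.
      apply Rmult_le_compat; auto; apply Rabs_pos. }
  apply Rnot_lt_le. intros Hlt.
  (* q is a quotient by zero at 0, so the integral is cut at [eps]. The piece over [0, eps] is at
     most B N eps, and [eps] is chosen so that this cannot account for the assumed excess of |I|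
     over 10 B / N. *)
  set (eps := Rmin (1 / 2) ((Rabs I - 10 * B / N) / (B * N + 1))).
  assert (HBN : 0 <= B * N) by nra.
  assert (Heps : 0 < eps <= 1 / 2).
  { split; [apply Rmin_glb_lt; [lra | apply Rdiv_lt_0_compat; lra] | apply Rmin_l]. }
  assert (Heps2 : (B * N + 1) * eps <= Rabs I - 10 * B / N).
  { apply Rle_trans with ((B * N + 1) * ((Rabs I - 10 * B / N) / (B * N + 1))).
    - apply Rmult_le_compat_l; [lra | apply Rmin_r].
    - right; field; lra. }
  assert (I1 := RInt_correct (V := R_CompleteNormedModule) _ 0 eps (ex_RInt_cont _ 0 eps Hcg)).
  assert (I2 := RInt_correct (V := R_CompleteNormedModule) _ eps (1 / 2) (ex_RInt_cont _ eps (1 /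
      2) Hcg)).
  assert (EI : I = plus (RInt (fun x => (phi x - phi 0) * dirichlet M x) 0 eps) (RInt (fun x =>
      (phi x - phi 0) * dirichlet M x) eps (1 / 2))).
  { rewrite <- (is_RInt_unique (V := R_CompleteNormedModule) _ _ _ _ HI).
    apply (is_RInt_unique (V := R_CompleteNormedModule)).
    apply (is_RInt_Chasles (V := R_NormedModule) _ 0 eps); auto. }
  set (i1 := RInt (fun x => (phi x - phi 0) * dirichlet M x) 0 eps) in *.
  set (i2 := RInt (fun x => (phi x - phi 0) * dirichlet M x) eps (1 / 2)) in *.
  assert (B1 : Rabs i1 <= B * N * eps).
  { replace (B * N * eps) with (B * N * (eps - 0)) by ring.
    apply (Rabs_is_RInt_le (fun x => (phi x - phi 0) * dirichlet M x) 0 eps); auto; [lra|].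
    intros x Hx. rewrite Rabs_mult. apply Rmult_le_compat; try apply Rabs_pos; [|apply
        Rabs_dirichlet_le].
    assert (Hp := Hphi x ltac:(lra)). nra. }
  set (q := fun x => (phi x - phi 0) / sin (PI * x)).
  set (dq := fun x => num x / sin (PI * x) ^ 2).
  assert (Hq : forall x, 0 < x <= 1 / 2 -> Rabs (q x) <= B / 2).
  { intros x Hx. unfold q. destruct (Hsin x Hx) as [S0 S1].
    unfold Rdiv. rewrite Rabs_mult, Rabs_inv, (Rabs_pos_eq (sin _)) by lra.
    apply Rmult_le_reg_r with (sin (PI * x)); [lra|]. rewrite Rmult_assoc, Rinv_l, Rmult_1_r by lra.
    assert (Hp := Hphi x ltac:(lra)). nra. }
  assert (Hdq : forall x, 0 < x <= 1 / 2 -> Rabs (dq x) <= 9 * B).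
  { intros x Hx. unfold dq. destruct (Hsin x Hx) as [S0 S1].
    assert (0 < sin (PI * x) ^ 2) by nra.
    unfold Rdiv. rewrite Rabs_mult, Rabs_inv, (Rabs_pos_eq (sin _ ^ 2)) by lra.
    apply Rmult_le_reg_r with (sin (PI * x) ^ 2); [lra|]. rewrite Rmult_assoc, Rinv_l, Rmult_1_r
        by lra.
    assert (Hp := Hnum x ltac:(lra)).
    assert (4 * x ^ 2 <= sin (PI * x) ^ 2) by nra. nra. }
  assert (HNpi : 0 < N * PI) by nra.
  (* The integration by parts: by [dirichlet_sin], (phi - phi 0) times the kernel is q(x) sin(N PI
     x), and - q(x) cos(N PI x) / (N PI) is the antiderivative up to the term in [dq]. *)
  assert (I3 : is_RInt (fun x => (phi x - phi 0) * dirichlet M x - dq x * (cos (N * PI * x) / (N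
      * PI))) eps (1 / 2)
     (minus (- (q (1 / 2) * (cos (N * PI * (1 / 2)) / (N * PI)))) (- (q eps * (cos (N * PI * eps)
         / (N * PI)))))).
  { apply (is_RInt_derive (V := R_CompleteNormedModule) (fun x => - (q x * (cos (N * PI * x) / (N
      * PI)))));
    intros x; rewrite Rmin_left, Rmax_right by lra; intros Hx; destruct (Hsin x ltac:(lra)) as
        [S0 S1].
    - assert (E1 := is_derive_unique _ _ _ (Hd x)).
      assert (ED : dirichlet M x = sin (N * PI * x) / sin (PI * x)).
      { unfold N. rewrite <- dirichlet_sin. field. lra. }
      unfold q, dq, num. auto_derive.
      + repeat split; try lra. eexists; apply Hd.
      + replace (Derive (fun x => phi x) x) with (dphi x). rewrite ED. field. repeat split; try lra.
    - apply (continuous_minus (V := R_NormedModule)); [apply Hcg|].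
      apply (continuous_mult (K := R_AbsRing)).
      + unfold dq, num. apply (continuous_mult (K := R_AbsRing)).
        * apply (continuous_minus (V := R_NormedModule)); apply (continuous_mult (K := R_AbsRing)).
          -- apply Hdc.
          -- eapply continuous_is_derive. auto_derive; auto.
          -- apply (continuous_minus (V := R_NormedModule)); [apply Hc | apply continuous_const].
          -- eapply continuous_is_derive. auto_derive; auto.
        * eapply continuous_is_derive. auto_derive; auto. apply Rgt_not_eq. nra.
      + eapply continuous_is_derive. auto_derive; auto. }
  assert (Ecos : forall w, Rabs (cos w / (N * PI)) <= / (3 * N)).
  { intros w. unfold Rdiv. rewrite Rabs_mult, Rabs_inv, (Rabs_pos_eq (N * PI)) by lra.
    rewrite <- (Rmult_1_l (/ (3 * N))). apply Rmult_le_compat; try apply Rabs_pos.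
    - left; apply Rinv_0_lt_compat; lra.
    - apply Rabs_le, COS_bound.
    - apply Rinv_le_contravar; nra. }
  assert (HiN : 0 < / (3 * N)) by (apply Rinv_0_lt_compat; lra).
  set (bd := minus (- (q (1 / 2) * (cos (N * PI * (1 / 2)) / (N * PI)))) (- (q eps * (cos (N * PI
      * eps) / (N * PI))))) in *.
  assert (Bbd : Rabs bd <= B * / (3 * N)).
  { unfold bd, minus, plus, opp; simpl. eapply Rle_trans; [apply Rabs_triang|].
    rewrite !Rabs_Ropp, !Rabs_mult.
    assert (Rabs (q (1 / 2)) * Rabs (cos (N * PI * (1 / 2)) / (N * PI)) <= B / 2 * / (3 * N)).
    { apply Rmult_le_compat; try apply Rabs_pos; auto. apply Hq; lra. }
    assert (Rabs (q eps) * Rabs (cos (N * PI * eps) / (N * PI)) <= B / 2 * / (3 * N)).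
    { apply Rmult_le_compat; try apply Rabs_pos; auto. }
    lra. }
  assert (I4 := is_RInt_minus (V := R_NormedModule) _ _ _ _ _ _ I2 I3).
  assert (B4 : Rabs (minus i2 bd) <= (9 * B * / (3 * N)) * (1 / 2 - eps)).
  { refine (Rabs_is_RInt_le _ eps (1 / 2) _ _ _ _ I4); [lra|].
    intros x Hx. unfold minus, plus, opp; simpl.
    replace (_ + - _) with (dq x * (cos (N * PI * x) / (N * PI))) by ring.
    rewrite Rabs_mult. apply Rmult_le_compat; try apply Rabs_pos; auto. apply Hdq; lra. }
  assert (B4' : Rabs (minus i2 bd) <= 9 * B * / (3 * N)).
  { eapply Rle_trans; [exact B4|]. rewrite <- (Rmult_1_r (9 * B * / (3 * N))) at 2.
    apply Rmult_le_compat_l; [|lra]. apply Rmult_le_pos; [lra | left; exact HiN]. }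
  assert (Bi2 : Rabs i2 <= Rabs (minus i2 bd) + Rabs bd).
  { replace i2 with (minus i2 bd + bd) at 1 by (unfold minus, plus, opp; simpl; ring). apply
      Rabs_triang. }
  assert (BI : Rabs I <= Rabs i1 + Rabs i2) by (rewrite EI; apply Rabs_triang).
  (* Boundary values contribute B / (3N) and the [dq] integral 9B / (3N), where 3 is a lower bound
     of PI; the total stays below 10 B / N. *)
  replace (10 * B / N) with (10 * B * (3 * / (3 * N))) in Heps2 by (field; lra).
  assert (0 <= B * / (3 * N)) by (apply Rmult_le_pos; lra).
  nra.
Qed.

(** * The Gaussian, its decay and its Fourier integral *)

Definition gauss (v x : R) : R := exp (- (PI * v * x ^ 2)).

Lemma gauss_pos (v x : R) : 0 < gauss v x.
Proof. apply exp_pos. Qed.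

Lemma continuous_gauss (v x : R) : continuous (gauss v) x.
Proof. eapply continuous_is_derive. unfold gauss. auto_derive; auto. Qed.

Lemma exp_opp_le (u : R) : 0 <= u -> exp (- u) <= / (1 + u).
Proof.
  intros Hu. rewrite exp_Ropp. apply Rinv_le_contravar; [lra | apply exp_ineq1_le].
Qed.

(** The exponential is split into two equal halves, and each absorbs one factor 1 + x^2 by e^(-u) <=
    1 / (1 + u). *)
Lemma gauss_weight_le (v x : R) : 0 < v -> (1 + x ^ 2) ^ 2 * gauss v x <= (1 + 2 / (PI * v)) ^ 2.
Proof.
  intros Hv. assert (Ha : 0 < PI * v) by (apply Rmult_lt_0_compat; [apply PI_RGT_0 | auto]).
  assert (H2a : 0 < 2 / (PI * v)) by (apply Rdiv_lt_0_compat; lra).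
  replace ((1 + x ^ 2) ^ 2 * gauss v x) with (((1 + x ^ 2) * exp (- (PI * v * x ^ 2 / 2))) ^ 2).
  - assert (Hx : 0 <= x ^ 2) by apply pow2_ge_0.
    assert (He := exp_pos (- (PI * v * x ^ 2 / 2))).
    apply pow_incr. split; [nra|].
    apply Rle_trans with ((1 + x ^ 2) * / (1 + PI * v * x ^ 2 / 2)).
    + apply Rmult_le_compat_l; [lra|]. apply exp_opp_le. nra.
    + apply Rmult_le_reg_r with (1 + PI * v * x ^ 2 / 2); [nra|].
      rewrite Rmult_assoc, Rinv_l, Rmult_1_r by nra.
      replace ((1 + 2 / (PI * v)) * (1 + PI * v * x ^ 2 / 2)) with (1 + 2 / (PI * v) + PI * v * x
          ^ 2 / 2 + x ^ 2)
        by (field; split; [lra | apply Rgt_not_eq, PI_RGT_0]).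
      nra.
  - unfold gauss. replace (- (PI * v * x ^ 2)) with (- (PI * v * x ^ 2 / 2) + - (PI * v * x ^ 2 /
      2)) by field.
    rewrite exp_plus. ring.
Qed.

Definition dgauss (v x : R) : R := - (2 * PI * v * x) * gauss v x.
Definition ddgauss (v x : R) : R := (4 * PI ^ 2 * v ^ 2 * x ^ 2 - 2 * PI * v) * gauss v x.

Lemma is_derive_gauss (v x : R) : is_derive (gauss v) x (dgauss v x).
Proof. unfold dgauss, gauss. auto_derive; auto. simpl. ring. Qed.

Lemma is_derive_dgauss (v x : R) : is_derive (dgauss v) x (ddgauss v x).
Proof. unfold ddgauss, dgauss, gauss. auto_derive; auto. simpl. ring. Qed.

(** Of the two factors 1 + x^2 in [gauss_weight_le], one absorbs the polynomial in front of the
    Gaussian. The other remains as a decay summable over the integers. *)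
Lemma gauss_derivatives_le (v : R) : 0 < v -> exists K, 0 < K /\
  forall x, Rabs (dgauss v x) <= K / (1 + x ^ 2) /\ Rabs (ddgauss v x) <= K / (1 + x ^ 2).
Proof.
  intros Hv. assert (Ha : 0 < PI * v) by (apply Rmult_lt_0_compat; [apply PI_RGT_0 | auto]).
  set (a := PI * v) in *.
  set (W := (1 + 2 / a) ^ 2).
  assert (HW : 0 < W). { unfold W. assert (0 < 2 / a) by (apply Rdiv_lt_0_compat; lra). nra. }
  exists ((4 * a ^ 2 + 2 * a) * W). split; [nra|]. intros x.
  assert (Hw := gauss_weight_le v x Hv). fold a in Hw. fold W in Hw.
  assert (Hg := gauss_pos v x). assert (Hx : 0 <= x ^ 2) by apply pow2_ge_0.
  assert (Hxa : 2 * Rabs x <= 1 + x ^ 2).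
  { rewrite <- (pow2_abs x). assert (0 <= (Rabs x - 1) ^ 2) by apply pow2_ge_0. nra. }
  assert (Hxp := Rabs_pos x).
  assert (Key : forall c, 0 <= c -> c <= (4 * a ^ 2 + 2 * a) * (1 + x ^ 2) -> c * gauss v x <= (4
      * a ^ 2 + 2 * a) * W / (1 + x ^ 2)).
  { intros c Hc0 Hc. apply Rmult_le_reg_r with (1 + x ^ 2); [lra|].
    unfold Rdiv; rewrite (Rmult_assoc _ (/ _)), Rinv_l, Rmult_1_r by lra.
    apply Rle_trans with ((4 * a ^ 2 + 2 * a) * (1 + x ^ 2) * gauss v x * (1 + x ^ 2)).
    - apply Rmult_le_compat_r; [lra|]. apply Rmult_le_compat_r; lra.
    - replace ((4 * a ^ 2 + 2 * a) * (1 + x ^ 2) * gauss v x * (1 + x ^ 2))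
        with ((4 * a ^ 2 + 2 * a) * ((1 + x ^ 2) ^ 2 * gauss v x)) by ring.
      apply Rmult_le_compat_l; [nra | exact Hw]. }
  split; unfold dgauss, ddgauss; rewrite Rabs_mult, (Rabs_pos_eq (gauss v x)) by lra; apply Key;
      try apply Rabs_pos.
  - replace (2 * PI * v * x) with (2 * a * x) by (unfold a; ring).
    rewrite Rabs_Ropp, !Rabs_mult, (Rabs_pos_eq 2), (Rabs_pos_eq a) by lra.
    assert (2 * a * Rabs x <= a * (1 + x ^ 2)) by nra. assert (0 <= a ^ 2 * (1 + x ^ 2)) by nra.
        nra.
  - replace (4 * PI ^ 2 * v ^ 2 * x ^ 2 - 2 * PI * v) with (4 * a ^ 2 * x ^ 2 - 2 * a) by (unfold
      a; ring).
    apply Rabs_le. assert (0 <= a ^ 2) by nra. assert (0 <= a ^ 2 * x ^ 2) by nra. assert (0 <= a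
        * x ^ 2) by nra. split; lra.
Qed.

(** A contour shift in real terms: the integrand is the real part of exp(- PI v (x - iy)^2), so its
    y-derivative is the x-derivative of exp(PI v (y^2 - x^2)) sin(2 PI v y x). That function
    vanishes at x = 0, so only the value at L survives. *)
Lemma gauss_fourier_derive (v L y : R) :
  is_derive (fun y => RInt (fun x => exp (PI * v * (y ^ 2 - x ^ 2)) * cos (2 * PI * v * y * x)) 0
      L) y
    (exp (PI * v * (y ^ 2 - L ^ 2)) * sin (2 * PI * v * y * L)).
Proof.
  set (f := fun y x => exp (PI * v * (y ^ 2 - x ^ 2)) * cos (2 * PI * v * y * x)).
  set (df := fun y x => 2 * PI * v * (exp (PI * v * (y ^ 2 - x ^ 2)) * (y * cos (2 * PI * v * y *
      x) - x * sin (2 * PI * v * y * x)))).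
  assert (Hd : forall y x, is_derive (fun y => f y x) y (df y x)).
  { intros u x. unfold f, df. auto_derive; auto. unfold Rminus; simpl. ring. }
  assert (Hdf : forall y x, Derive (fun z => f z x) y = df y x).
  { intros u x. apply is_derive_unique, Hd. }
  replace (exp (PI * v * (y ^ 2 - L ^ 2)) * sin (2 * PI * v * y * L))
    with (RInt (fun x => Derive (fun u => f u x) y) 0 L).
  - apply (is_derive_RInt_param f 0 L y).
    + apply filter_forall. intros u x _. eexists; apply Hd.
    + intros x _. apply continuity_2d_pt_ext with df; [intros; symmetry; apply Hdf|].
      unfold df.
      assert (C1 : continuity_2d_pt (fun u x => PI * v * (u * u - x * x)) y x).
      { apply (continuity_2d_pt_mult (fun _ _ => PI * v)); [apply continuity_2d_pt_const|].
        apply (continuity_2d_pt_minus (fun u x => u * u) (fun u x => x * x)); apply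
            continuity_2d_pt_mult;
        first [apply continuity_2d_pt_id1 | apply continuity_2d_pt_id2]. }
      assert (C2 : continuity_2d_pt (fun u x => 2 * PI * v * u * x) y x).
      { apply (continuity_2d_pt_mult (fun u _ => 2 * PI * v * u) (fun _ x => x)); [|apply
          continuity_2d_pt_id2].
        apply (continuity_2d_pt_mult (fun u _ => 2 * PI * v) (fun u _ => u)); [apply
            continuity_2d_pt_const | apply continuity_2d_pt_id1]. }
      apply (continuity_2d_pt_mult (fun _ _ => 2 * PI * v)); [apply continuity_2d_pt_const|].
      apply (continuity_2d_pt_mult (fun u x => exp (PI * v * (u ^ 2 - x ^ 2)))).
      * apply continuity_2d_pt_ext with (fun u x => exp (PI * v * (u * u - x * x))); [intros; do
          2 f_equal; ring|].
        apply (continuity_1d_2d_pt_comp exp (fun u x => PI * v * (u * u - x * x))); auto.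
        apply derivable_continuous_pt, derivable_pt_exp.
      * apply (continuity_2d_pt_minus (fun u x => u * cos (2 * PI * v * u * x)) (fun u x => x *
          sin (2 * PI * v * u * x))).
        -- apply (continuity_2d_pt_mult (fun u _ => u)); [apply continuity_2d_pt_id1|].
           apply (continuity_1d_2d_pt_comp cos (fun u x => 2 * PI * v * u * x)); auto. apply
               continuity_cos.
        -- apply (continuity_2d_pt_mult (fun _ x => x)); [apply continuity_2d_pt_id2|].
           apply (continuity_1d_2d_pt_comp sin (fun u x => 2 * PI * v * u * x)); auto. apply
               continuity_sin.
    + apply filter_forall. intros u. apply ex_RInt_cont. intros x.
      eapply continuous_is_derive. unfold f. auto_derive; auto.
  - rewrite (RInt_ext _ (df y)) by (intros; apply Hdf).
    apply (is_RInt_unique (V := R_CompleteNormedModule)).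
    replace (exp (PI * v * (y ^ 2 - L ^ 2)) * sin (2 * PI * v * y * L)) with
      (minus (exp (PI * v * (y ^ 2 - L ^ 2)) * sin (2 * PI * v * y * L)) (exp (PI * v * (y ^ 2 -
          0 ^ 2)) * sin (2 * PI * v * y * 0)))
      by (rewrite Rmult_0_r, sin_0; unfold minus, plus, opp; simpl; ring).
    apply (is_RInt_derive (V := R_CompleteNormedModule) (fun x => exp (PI * v * (y ^ 2 - x ^ 2))
        * sin (2 * PI * v * y * x))).
    + intros x _. unfold df. auto_derive; auto. unfold Rminus; simpl. ring.
    + intros x _. unfold df. eapply continuous_is_derive. auto_derive; auto.
Qed.

(** Completing the square with y = m / v brings out the factor [gauss (/ v) (INR m)] and leaves the
    integral of [gauss_fourier_derive] at height y, compared with its value at height 0. The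
    endpoint L stays finite, with an explicit error, because it is sent to infinity only after
    summation over m. *)
Lemma gauss_fourier (v L : R) (m : nat) : 0 < v -> 0 <= L ->
  Rabs (RInt (fun x => gauss v x * cos (2 * PI * INR m * x)) 0 L - gauss (/ v) (INR m) * RInt
      (gauss v) 0 L)
    <= INR m / v * gauss v L.
Proof.
  intros Hv HL. set (y := INR m / v).
  assert (Hy : 0 <= y) by (apply Rdiv_le_0_compat; [apply pos_INR | auto]).
  set (A := fun y => RInt (fun x => exp (PI * v * (y ^ 2 - x ^ 2)) * cos (2 * PI * v * y * x)) 0 L).
  assert (Hpi := PI_RGT_0).
  assert (H : Rabs (A y - A 0) <= exp (PI * v * (y ^ 2 - L ^ 2)) * (y - 0)).
  { apply (Rabs_increment_le A (fun y => exp (PI * v * (y ^ 2 - L ^ 2)) * sin (2 * PI * v * y *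
      L))); auto.
    - intros u _. apply gauss_fourier_derive.
    - intros u Hu. rewrite Rabs_mult, (Rabs_pos_eq (exp _)) by (left; apply exp_pos).
      rewrite <- (Rmult_1_r (exp (PI * v * (y ^ 2 - L ^ 2)))).
      apply Rmult_le_compat; try apply Rabs_pos; [left; apply exp_pos | | apply Rabs_le, SIN_bound].
      apply exp_le_compat. apply Rmult_le_compat_l; nra. }
  assert (E0 : A 0 = RInt (gauss v) 0 L).
  { apply RInt_ext. intros x _. rewrite Rmult_0_r, Rmult_0_l, cos_0. unfold gauss. rewrite
      Rmult_1_r. f_equal. ring. }
  assert (Ey : RInt (fun x => gauss v x * cos (2 * PI * INR m * x)) 0 L = gauss (/ v) (INR m) * A
      y).
  { unfold A. rewrite <- (RInt_scal (V := R_CompleteNormedModule)).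
    - apply RInt_ext. intros x _. unfold scal; simpl; unfold mult; simpl. rewrite <- Rmult_assoc.
      unfold gauss. rewrite <- exp_plus. f_equal.
      + f_equal. unfold y. field. lra.
      + f_equal. unfold y. field. lra.
    - apply ex_RInt_cont. intros x. eapply continuous_is_derive. auto_derive; auto. }
  rewrite Ey, <- E0.
  replace (gauss (/ v) (INR m) * A y - gauss (/ v) (INR m) * A 0) with (gauss (/ v) (INR m) * (A
      y - A 0)) by ring.
  assert (Hg := gauss_pos (/ v) (INR m)).
  rewrite Rabs_mult, (Rabs_pos_eq (gauss _ _)) by lra.
  replace (y * gauss v L) with (gauss (/ v) (INR m) * (exp (PI * v * (y ^ 2 - L ^ 2)) * (y - 0))).
  - apply Rmult_le_compat_l; lra.
  - rewrite <- Rmult_assoc. unfold gauss. rewrite <- exp_plus. rewrite Rminus_0_r, Rmult_comm.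
      f_equal. f_equal.
    unfold y. field. lra.
Qed.

(* Half of the K-th partial sum of theta, the constant term included. *)
Fixpoint half_theta (u : R) (K : nat) : R :=
  match K with
  | O => 1 / 2
  | S k => half_theta u k + gauss u (INR (S k))
  end.

Lemma half_theta_S (u : R) (k : nat) : half_theta u (S k) = half_theta u k + gauss u (INR (S k)).
Proof. reflexivity. Qed.

Lemma ex_RInt_gauss_dirichlet (v a b : R) (M : nat) : ex_RInt (fun x => gauss v x * dirichlet M
    x) a b.
Proof.
  apply ex_RInt_cont. intros x.
  apply (continuous_mult (K := R_AbsRing)); [apply continuous_gauss | apply continuous_dirichlet].
Qed.

(** The frequency side of Poisson summation. The errors 2 m / v of [gauss_fourier] add up to M (M +
    1) / v, at most 2 M^2 / v. *)
Lemma gauss_dirichlet_spectral (v L : R) (M : nat) : 0 < v -> 0 <= L ->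
  Rabs (RInt (fun x => gauss v x * dirichlet M x) 0 L - 2 * half_theta (/ v) M * RInt (gauss v) 0 L)
    <= 2 * INR M ^ 2 / v * gauss v L.
Proof.
  intros Hv HL. induction M as [|m IH].
  - rewrite (RInt_ext _ (gauss v)) by (intros; simpl; ring).
    simpl half_theta. replace (_ - _) with 0 by field. rewrite Rabs_R0. simpl.
    generalize (gauss_pos v L). intros. apply Rmult_le_pos; [apply Rdiv_le_0_compat; lra | lra].
  - assert (HF := gauss_fourier v L (S m) Hv HL).
    assert (E : RInt (fun x => gauss v x * dirichlet (S m) x) 0 L =
      RInt (fun x => gauss v x * dirichlet m x) 0 L + 2 * RInt (fun x => gauss v x * cos (2 * PI
          * INR (S m) * x)) 0 L).
    { apply (is_RInt_unique (V := R_CompleteNormedModule)).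
      apply (is_RInt_ext (V := R_NormedModule) (fun x => plus (gauss v x * dirichlet m x) (scal 2
          (gauss v x * cos (2 * PI * INR (S m) * x))))).
      - intros x _. rewrite dirichlet_S. unfold plus, scal; simpl plus; unfold mult; simpl mult.
          cbn [plus scal].
        match goal with |- ?a = ?b => change (gauss v x * dirichlet m x + 2 * (gauss v x * cos (2
            * PI * INR (S m) * x)) = b) end. ring.
      - apply (is_RInt_plus (V := R_NormedModule)).
        + apply (RInt_correct (V := R_CompleteNormedModule)), ex_RInt_gauss_dirichlet.
        + apply (is_RInt_scal (V := R_NormedModule)).
          apply (RInt_correct (V := R_CompleteNormedModule)), ex_RInt_cont. intros x.
          apply (continuous_mult (K := R_AbsRing)); [apply continuous_gauss | apply
              continuous_cos_lin]. }
    rewrite E, half_theta_S.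
    set (X := RInt (fun x => gauss v x * dirichlet m x) 0 L) in *.
    set (Y := RInt (fun x => gauss v x * cos (2 * PI * INR (S m) * x)) 0 L) in *.
    set (J := RInt (gauss v) 0 L) in *.
    replace (X + 2 * Y - 2 * (half_theta (/ v) m + gauss (/ v) (INR (S m))) * J)
      with ((X - 2 * half_theta (/ v) m * J) + 2 * (Y - gauss (/ v) (INR (S m)) * J)) by ring.
    eapply Rle_trans; [apply Rabs_triang|]. rewrite Rabs_mult, (Rabs_pos_eq 2) by lra.
    assert (Hm := pos_INR m). rewrite S_INR in *.
    assert (Hg := gauss_pos v L). assert (Hiv : 0 < / v) by (apply Rinv_0_lt_compat; auto).
    assert (0 < / v * gauss v L) by (apply Rmult_lt_0_compat; auto).
    unfold Rdiv in *.
    replace (2 * (INR m + 1) ^ 2 * / v * gauss v L) with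
      (2 * INR m ^ 2 * / v * gauss v L + (4 * INR m + 2) * (/ v * gauss v L)) by ring.
    assert ((INR m + 1) * / v * gauss v L <= (2 * INR m + 1) * (/ v * gauss v L)).
    { rewrite Rmult_assoc. apply Rmult_le_compat_r; lra. }
    lra.
Qed.

(** The space side of Poisson summation. By periodicity [dirichlet_localization] applies on each
    half-interval next to an integer k and extracts half of the Gaussian at k. The errors are O(1 /
    (1 + k^2)) by [gauss_derivatives_le], which makes the bound uniform in K. *)
Lemma gauss_dirichlet_spatial (v : R) : 0 < v -> exists C, 0 < C /\
  forall M K, Rabs (RInt (fun x => gauss v x * dirichlet M x) 0 (INR K + 1 / 2) - half_theta v K)
    <= C / (2 * INR M + 1).
Proof.
  intros Hv. destruct (gauss_derivatives_le v Hv) as (B & HB & HBx).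
  exists (80 * B * 3). split; [lra|]. intros M.
  set (N := 2 * INR M + 1). assert (HN : 0 < N) by (unfold N; generalize (pos_INR M); lra).
  (* The sign [sg] selects the half-interval to the right or to the left of k; at k = 0 only the
     right one lies in the domain. The factor 4 comes from 1 + (k + sg x)^2 >= (1 + k^2) / 4 for x
     <= 1/2. *)
  assert (Hloc : forall (k : nat) (sg : R), sg ^ 2 = 1 -> (sg = 1 \/ (1 <= INR k /\ sg = -1)) ->
    Rabs (RInt (fun x => gauss v (INR k + sg * x) * dirichlet M x) 0 (1 / 2) - gauss v (INR k) / 2)
      <= 10 * (4 * B / (1 + INR k ^ 2)) / N).
  { intros k sg Hsg2 Hsg. assert (Hk := pos_INR k).
    assert (Hfar : forall x, 0 <= x <= 1 / 2 -> B / (1 + (INR k + sg * x) ^ 2) <= 4 * B / (1 +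
        INR k ^ 2)).
    { intros x Hx. replace (4 * B / (1 + INR k ^ 2)) with (B * / ((1 + INR k ^ 2) / 4)) by
        (field; nra).
      apply Rmult_le_compat_l; [lra|]. apply Rinv_le_contravar; [nra|].
      destruct Hsg as [-> | [Hk1 ->]]; nra. }
    assert (Hsga : Rabs sg = 1) by (destruct Hsg as [-> | [_ ->]]; [apply Rabs_R1 | rewrite
        Rabs_left; lra]).
    assert (H := dirichlet_localization (fun x => gauss v (INR k + sg * x)) (fun x => sg * dgauss
        v (INR k + sg * x))
      (fun x => ddgauss v (INR k + sg * x)) (4 * B / (1 + INR k ^ 2)) M).
    cbv beta in H. rewrite Rmult_0_r, Rplus_0_r in H. apply H.
    - intros x. apply (is_derive_comp (V := R_NormedModule) (gauss v) (fun x => INR k + sg * x)).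
      + apply is_derive_gauss.
      + auto_derive; auto. ring.
    - intros x. replace (ddgauss v (INR k + sg * x)) with (sg * (sg * ddgauss v (INR k + sg *
        x))) by (rewrite <- Rmult_assoc; replace (sg * sg) with (sg ^ 2) by ring; rewrite Hsg2;
        ring).
      apply (is_derive_scal (fun x => dgauss v (INR k + sg * x))).
      apply (is_derive_comp (V := R_NormedModule) (dgauss v) (fun x => INR k + sg * x)).
      + apply is_derive_dgauss.
      + auto_derive; auto. ring.
    - intros x Hx. rewrite Rabs_mult, Hsga, Rmult_1_l. eapply Rle_trans; [apply HBx | auto].
    - intros x Hx. eapply Rle_trans; [apply HBx | auto]. }
  (* 3 - 2 / (K + 1) is a telescoping majorant of the sum of 1 / (1 + k^2): its increments are 2 /
     ((k + 1)(k + 2)). The 80 is twice 10 * 4, for the two sides of each integer. *)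
  assert (Hstep : forall K, Rabs (RInt (fun x => gauss v x * dirichlet M x) 0 (INR K + 1 / 2) -
      half_theta v K)
    <= 80 * B / N * (3 - 2 / (INR K + 1))).
  { assert (HBN : 0 < B / N) by (apply Rdiv_lt_0_compat; auto).
    induction K as [|K IH].
    - assert (H := Hloc 0%nat 1 ltac:(ring) ltac:(auto)). simpl INR in *.
      rewrite (RInt_ext _ (fun x => gauss v x * dirichlet M x)) in H by (intros; do 2 f_equal;
          ring).
      replace (gauss v 0 / 2) with (1 / 2) in H.
      2: { unfold gauss. replace (- (PI * v * 0 ^ 2)) with 0 by ring. rewrite exp_0. auto. }
      rewrite Rplus_0_l. simpl half_theta. eapply Rle_trans; [exact H|].
      replace (10 * (4 * B / (1 + 0 ^ 2)) / N) with (40 * (B / N)) by (field; lra).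
      replace (80 * B / N * (3 - 2 / (0 + 1))) with (80 * (B / N)) by (field; lra). lra.
    - assert (Hk := pos_INR K).
      assert (Hp := Hloc (S K) 1 ltac:(ring) ltac:(auto)).
      assert (Hm := Hloc (S K) (-1) ltac:(ring) ltac:(right; rewrite S_INR; lra)).
      assert (E1 : RInt (fun x => gauss v x * dirichlet M x) (INR (S K)) (INR (S K) + 1 / 2) =
                   RInt (fun x => gauss v (INR (S K) + 1 * x) * dirichlet M x) 0 (1 / 2)).
      { symmetry. apply (is_RInt_unique (V := R_CompleteNormedModule)).
        assert (HI := RInt_correct (V := R_CompleteNormedModule) _ _ _ (ex_RInt_gauss_dirichlet v
            (INR (S K)) (INR (S K) + 1 / 2) M)).
        replace (INR (S K)) with (1 * 0 + INR (S K)) in HI at 1 by ring.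
        replace (INR (S K) + 1 / 2) with (1 * (1 / 2) + INR (S K)) in HI at 1 by ring.
        apply (is_RInt_comp_lin (V := R_NormedModule)) in HI.
        revert HI. apply (is_RInt_ext (V := R_NormedModule)). intros x _.
        replace (1 * x + INR (S K)) with (INR (S K) + 1 * x) by ring.
        rewrite <- (dirichlet_shift M (S K) x). rewrite (Rmult_1_l x). apply Rmult_1_l. }
      assert (E2 : RInt (fun x => gauss v x * dirichlet M x) (INR (S K) - 1 / 2) (INR (S K)) =
                   RInt (fun x => gauss v (INR (S K) + -1 * x) * dirichlet M x) 0 (1 / 2)).
      { symmetry. apply (is_RInt_unique (V := R_CompleteNormedModule)).
        assert (HI := RInt_correct (V := R_CompleteNormedModule) _ _ _ (ex_RInt_gauss_dirichlet v
            (INR (S K) - 1 / 2) (INR (S K)) M)).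
        apply (is_RInt_swap (V := R_NormedModule)) in HI.
        replace (INR (S K)) with (-1 * 0 + INR (S K)) in HI at 1 by ring.
        replace (INR (S K) - 1 / 2) with (-1 * (1 / 2) + INR (S K)) in HI at 1 by ring.
        apply (is_RInt_comp_lin (V := R_NormedModule)) in HI.
        apply (is_RInt_opp (V := R_NormedModule)) in HI. rewrite opp_opp in HI.
        revert HI. apply (is_RInt_ext (V := R_NormedModule)). intros x _.
        replace (-1 * x + INR (S K)) with (INR (S K) + -1 * x) by ring.
        replace (-1 * x) with (- x) by ring.
        rewrite dirichlet_shift, dirichlet_opp.
        change (- (-1 * (gauss v (INR (S K) + - x) * dirichlet M x)) = gauss v (INR (S K) + - x)
            * dirichlet M x). ring. }
      rewrite <- E1 in Hp. rewrite <- E2 in Hm.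
      assert (E : RInt (fun x => gauss v x * dirichlet M x) 0 (INR (S K) + 1 / 2) =
        RInt (fun x => gauss v x * dirichlet M x) 0 (INR K + 1 / 2) +
        (RInt (fun x => gauss v x * dirichlet M x) (INR (S K) - 1 / 2) (INR (S K)) +
         RInt (fun x => gauss v x * dirichlet M x) (INR (S K)) (INR (S K) + 1 / 2))).
      { replace (INR K + 1 / 2) with (INR (S K) - 1 / 2) by (rewrite S_INR; field).
        symmetry. etransitivity; [|apply (RInt_Chasles (V := R_CompleteNormedModule)) with (b :=
            INR (S K) - 1 / 2); apply ex_RInt_gauss_dirichlet].
        apply (f_equal (Rplus _)).
        apply (RInt_Chasles (V := R_CompleteNormedModule)); apply ex_RInt_gauss_dirichlet. }
      rewrite E, half_theta_S.
      set (X := RInt _ 0 (INR K + 1 / 2)) in *. set (Y := RInt _ (INR (S K) - 1 / 2) _) in *. set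
          (Z := RInt _ (INR (S K)) _) in *.
      replace (X + (Y + Z) - (half_theta v K + gauss v (INR (S K)))) with
        ((X - half_theta v K) + ((Y - gauss v (INR (S K)) / 2) + (Z - gauss v (INR (S K)) / 2)))
            by field.
      eapply Rle_trans; [apply Rabs_triang|]. eapply Rle_trans; [apply Rplus_le_compat_l,
          Rabs_triang|].
      rewrite S_INR in *. set (k := INR K) in *.
      replace (10 * (4 * B / (1 + (k + 1) ^ 2)) / N) with (40 * (B / N) * / (1 + (k + 1) ^ 2)) in
          Hp, Hm by (field; nra).
      replace (80 * B / N * (3 - 2 / (k + 1))) with (80 * (B / N) * (3 - 2 / (k + 1))) in IH by
          (field; lra).
      replace (80 * B / N * (3 - 2 / (k + 1 + 1))) with (80 * (B / N) * (3 - 2 / (k + 1)) + 80 *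
          (B / N) * (2 / ((k + 1) * (k + 2)))) by (field; lra).
      assert (/ (1 + (k + 1) ^ 2) <= 2 / ((k + 1) * (k + 2))).
      { replace (2 / ((k + 1) * (k + 2))) with (/ ((k + 1) * (k + 2) / 2)) by (field; lra). apply
          Rinv_le_contravar; nra. }
      assert (80 * (B / N) * / (1 + (k + 1) ^ 2) <= 80 * (B / N) * (2 / ((k + 1) * (k + 2)))) by
          (apply Rmult_le_compat_l; lra).
      lra. }
  intros K. eapply Rle_trans; [apply Hstep|].
  replace (80 * B * 3 / N) with (80 * B / N * 3) by (field; lra).
  apply Rmult_le_compat_l; [apply Rdiv_le_0_compat; lra|].
  assert (0 < 2 / (INR K + 1)) by (apply Rdiv_lt_0_compat; [lra | generalize (pos_INR K); lra]).
      lra.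
Qed.

(** The integral increases with L and is bounded by comparison with 1 / (1 + x^2), that is, by
    [atan]. The value of [I] emerges in [theta_functional_equation]. *)
Lemma gauss_integral_limit : exists I, forall eps, 0 < eps -> exists L0, forall L, L0 <= L ->
  Rabs (RInt (gauss 1) 0 L - I) < eps.
Proof.
  set (J := fun L => RInt (gauss 1) 0 L).
  assert (Hex : forall a b, ex_RInt (gauss 1) a b) by (intros; apply ex_RInt_cont; intros; apply
      continuous_gauss).
  assert (Hmono : forall a b, a <= b -> J a <= J b).
  { intros a b Hab. unfold J. rewrite <- (RInt_Chasles (V := R_CompleteNormedModule) (gauss 1) 0
      a b) by auto.
    assert (0 <= RInt (gauss 1) a b) by (apply RInt_ge_0; auto; intros; left; apply gauss_pos).
    change (RInt (gauss 1) 0 a <= RInt (gauss 1) 0 a + RInt (gauss 1) a b). lra. }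
  assert (Hbd : forall L, 0 <= L -> J L <= PI / 2).
  { intros L HL. apply Rle_trans with (atan L); [|left; apply atan_bound].
    assert (Hat : is_RInt (fun x => / (1 + x ^ 2)) 0 L (minus (atan L) (atan 0))).
    { apply (is_RInt_derive (V := R_CompleteNormedModule) atan).
      - intros x _. auto_derive; auto. unfold Rsqr. field. nra.
      - intros x _. eapply continuous_is_derive. auto_derive; auto. apply Rgt_not_eq. nra. }
    rewrite atan_0 in Hat. unfold minus, plus, opp in Hat; simpl in Hat. rewrite Ropp_0,
        Rplus_0_r in Hat.
    rewrite <- (is_RInt_unique (V := R_CompleteNormedModule) _ _ _ _ Hat).
    apply RInt_le; auto; [eexists; exact Hat|].
    intros x _. unfold gauss. eapply Rle_trans; [apply exp_opp_le|apply Rinv_le_contravar];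
    generalize (pow2_ge_0 x) PI2_3_2; intros; [nra | nra | nra]. }
  destruct (ex_finite_lim_seq_incr (fun n => J (INR n)) (PI / 2)) as [I HI].
  - intros n. apply Hmono. rewrite S_INR; lra.
  - intros n. apply Hbd, pos_INR.
  - exists I. intros eps Heps.
    assert (HJI : forall L, J L <= I).
    { intros L. destruct (INR_unbounded L) as [n Hn].
      apply Rle_trans with (J (INR n)); [apply Hmono; lra|].
      apply (is_lim_seq_incr_compare (fun n => J (INR n))); auto.
      intros k. apply Hmono. rewrite S_INR; lra. }
    apply is_lim_seq_spec in HI. destruct (HI (mkposreal eps Heps)) as [n Hn].
    exists (INR n). intros L HL. specialize (Hn n (le_n n)). simpl in Hn.
    assert (H1 := Hmono _ _ HL). assert (H2 := HJI L). assert (H3 := HJI (INR n)).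
    fold (J L). rewrite Rabs_left1 by lra. rewrite Rabs_left1 in Hn by lra. lra.
Qed.

Lemma RInt_gauss_scal (v L : R) : 0 < v -> RInt (gauss v) 0 L = / sqrt v * RInt (gauss 1) 0 (sqrt
    v * L).
Proof.
  intros Hv. assert (Hs := sqrt_lt_R0 v Hv).
  apply (is_RInt_unique (V := R_CompleteNormedModule)).
  assert (HI := RInt_correct (V := R_CompleteNormedModule) (gauss 1) 0 (sqrt v * L)
    (ex_RInt_cont _ _ _ (continuous_gauss 1))).
  replace 0 with (sqrt v * 0 + 0) in HI at 1 by ring.
  replace (sqrt v * L) with (sqrt v * L + 0) in HI at 1 by ring.
  apply (is_RInt_comp_lin (V := R_NormedModule)) in HI.
  apply (is_RInt_scal (V := R_NormedModule) _ _ _ (/ sqrt v)) in HI.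
  revert HI. apply (is_RInt_ext (V := R_NormedModule)). intros x _.
  change (/ sqrt v * (sqrt v * gauss 1 (sqrt v * x + 0)) = gauss v x).
  rewrite <- Rmult_assoc, Rinv_l, Rmult_1_l by lra. unfold gauss. f_equal.
  replace ((sqrt v * x + 0) ^ 2) with (sqrt v ^ 2 * x ^ 2) by ring. rewrite pow2_sqrt by lra. ring.
Qed.

(** Half of theta(v) - 1, so that 1/2 + [psi v] is the limit of [half_theta v]. *)
Definition psi (v : R) : R := Series (fun k => gauss v (INR (S k))).

Lemma exp_pow (x : R) (n : nat) : exp x ^ n = exp (INR n * x).
Proof.
  induction n as [|n IH]; [simpl; rewrite Rmult_0_l, exp_0; auto|].
  rewrite S_INR, Rmult_plus_distr_r, exp_plus, Rmult_1_l, <- IH. simpl. ring.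
Qed.

Lemma gauss_le_geom (v : R) (k : nat) : 0 < v -> gauss v (INR (S k)) <= exp (- (PI * v)) * exp (-
    (PI * v)) ^ k.
Proof.
  intros Hv. change (gauss v (INR (S k)) <= exp (- (PI * v)) ^ S k).
  rewrite exp_pow. apply exp_le_compat.
  assert (0 < PI * v) by (apply Rmult_lt_0_compat; [apply PI_RGT_0 | auto]).
  assert (1 <= INR (S k)) by (rewrite S_INR; generalize (pos_INR k); lra).
  assert (H1 : INR (S k) <= INR (S k) ^ 2) by nra.
  apply (Rmult_le_compat_l (PI * v)) in H1; lra.
Qed.

Lemma exp_opp_lt_1 (v : R) : 0 < v -> 0 < exp (- (PI * v)) < 1.
Proof.
  intros Hv. split; [apply exp_pos|]. rewrite <- exp_0. apply exp_increasing.
  assert (0 < PI * v) by (apply Rmult_lt_0_compat; [apply PI_RGT_0 | auto]). lra.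
Qed.

Lemma is_series_psi (v : R) : 0 < v -> is_series (fun k => gauss v (INR (S k))) (psi v).
Proof.
  intros Hv. apply Series_correct.
  apply (ex_series_le (K := R_AbsRing) (V := R_CompleteNormedModule) _ (fun k => exp (- (PI * v))
      * exp (- (PI * v)) ^ k)).
  - intros k. change (Rabs (gauss v (INR (S k))) <= exp (- (PI * v)) * exp (- (PI * v)) ^ k).
    rewrite Rabs_pos_eq by (left; apply gauss_pos). apply gauss_le_geom; auto.
  - apply (ex_series_scal_l (K := R_AbsRing) (V := R_NormedModule) (exp (- (PI * v))) (fun k =>
      exp (- (PI * v)) ^ k)). apply ex_series_geom.
    destruct (exp_opp_lt_1 v Hv). rewrite Rabs_pos_eq; lra.
Qed.

Lemma half_theta_limit (v : R) : 0 < v -> is_lim_seq (half_theta v) (1 / 2 + psi v).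
Proof.
  intros Hv. apply is_lim_seq_incr_1.
  apply is_lim_seq_ext with (fun n => 1 / 2 + sum_n (fun k => gauss v (INR (S k))) n).
  - induction n as [|n IH].
    + rewrite sum_O. reflexivity.
    + rewrite sum_n_S, half_theta_S, <- IH. ring.
  - apply (is_lim_seq_plus' _ _ (1 / 2) (psi v)); [apply is_lim_seq_const | apply (is_series_psi
      v Hv)].
Qed.

Lemma psi_pos (v : R) : 0 < v -> 0 <= psi v.
Proof.
  intros Hv.
  assert (H : Rbar_le (1 / 2) (1 / 2 + psi v)).
  { apply (is_lim_seq_le (fun _ => 1 / 2) (half_theta v)).
    - induction n as [|n IH]; [apply Rle_refl|]. rewrite half_theta_S.
      generalize (gauss_pos v (INR (S n))). lra.
    - apply is_lim_seq_const.
    - apply half_theta_limit; auto. }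
  simpl in H. lra.
Qed.

Lemma is_lim_seq_inv_S : is_lim_seq (fun n => / INR (S n)) 0.
Proof.
  change (Finite 0) with (Rbar_inv p_infty). apply is_lim_seq_inv; [|discriminate].
  apply (is_lim_seq_incr_1 INR), is_lim_seq_INR.
Qed.

(** The two evaluations of the integral of the Gaussian against the kernel over [0, K + 1/2] are
    compared. The order of the limits matters: the spectral error grows with M but vanishes as K
    tends to infinity for fixed M, whereas the spatial error is uniform in K and vanishes as M tends
    to infinity. *)
Lemma theta_functional_equation (v : R) : 0 < v -> 1 / 2 + psi v = (1 / 2 + psi (/ v)) / sqrt v.
Proof.
  destruct gauss_integral_limit as [I HI].
  assert (Main : forall v, 0 < v -> 1 / 2 + psi v = 2 * (1 / 2 + psi (/ v)) * (/ sqrt v * I)).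
  { intros u Hu. assert (Hs := sqrt_lt_R0 u Hu).
    assert (Hiu : 0 < / u) by (apply Rinv_0_lt_compat; auto).
    destruct (gauss_dirichlet_spatial u Hu) as (C & HC & Hsp).
    assert (HJ : is_lim_seq (fun K => RInt (gauss u) 0 (INR K + 1 / 2)) (/ sqrt u * I)).
    { apply is_lim_seq_ext with (fun K => / sqrt u * RInt (gauss 1) 0 (sqrt u * (INR K + 1 / 2))).
      - intros K. symmetry. apply RInt_gauss_scal; auto.
      - apply (is_lim_seq_scal_l _ (/ sqrt u) I). apply is_lim_seq_spec. intros eps.
        destruct (HI eps (cond_pos eps)) as [L0 HL0].
        destruct (INR_unbounded (L0 / sqrt u)) as [n Hn]. exists n. intros K HK. apply HL0.
        apply le_INR in HK. apply Rlt_div_l in Hn; [|lra]. nra. }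
    assert (Hgl : is_lim_seq (fun K => gauss u (INR K + 1 / 2)) 0).
    { apply is_lim_seq_le_le with (fun _ => 0) (fun K => 4 / (PI * u) * / INR (S K)); [|apply
        is_lim_seq_const|].
      - intros K. split; [left; apply gauss_pos|]. unfold gauss.
        assert (Hp : 0 < PI * u) by (apply Rmult_lt_0_compat; [apply PI_RGT_0 | auto]).
        assert (HK := pos_INR K).
        rewrite S_INR. eapply Rle_trans; [apply exp_opp_le; nra|].
        replace (4 / (PI * u) * / (INR K + 1)) with (/ (PI * u * ((INR K + 1) / 4))) by (field;
            repeat split; try lra; apply Rgt_not_eq, PI_RGT_0).
        apply Rinv_le_contravar; [apply Rmult_lt_0_compat; lra|].
        assert (PI * u * ((INR K + 1) / 4) <= PI * u * (INR K + 1 / 2) ^ 2) by (apply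
            Rmult_le_compat_l; nra). lra.
      - replace (Finite 0) with (Rbar_mult (4 / (PI * u)) 0) by (simpl; f_equal; ring).
        apply is_lim_seq_scal_l, is_lim_seq_inv_S. }
    assert (HM : forall M, Rabs ((1 / 2 + psi u) - 2 * half_theta (/ u) M * (/ sqrt u * I)) <= C
        / (2 * INR M + 1)).
    { intros M.
      assert (Hlim : is_lim_seq (fun K => Rabs (half_theta u K - 2 * half_theta (/ u) M * RInt
          (gauss u) 0 (INR K + 1 / 2)))
         (Rabs ((1 / 2 + psi u) - 2 * half_theta (/ u) M * (/ sqrt u * I)))).
      { apply (is_lim_seq_abs _ (Finite _)). apply is_lim_seq_minus'; [apply half_theta_limit;
          auto|].
        apply (is_lim_seq_scal_l _ _ (Finite _)). exact HJ. }
      assert (Hlim2 : is_lim_seq (fun K => C / (2 * INR M + 1) + 2 * INR M ^ 2 / u * gauss u (INR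
          K + 1 / 2)) (C / (2 * INR M + 1))).
      { replace (Finite (C / (2 * INR M + 1))) with (Finite (C / (2 * INR M + 1) + 2 * INR M ^ 2
          / u * 0)) by (f_equal; ring).
        apply is_lim_seq_plus'; [apply is_lim_seq_const | apply (is_lim_seq_scal_l _ _ (Finite
            _)); exact Hgl]. }
      refine (is_lim_seq_le _ _ _ _ _ Hlim Hlim2).
      intros K. assert (H1 := Hsp M K).
      assert (H2 := gauss_dirichlet_spectral u (INR K + 1 / 2) M Hu ltac:(generalize (pos_INR K);
          lra)).
      set (X := RInt (fun x => gauss u x * dirichlet M x) 0 (INR K + 1 / 2)) in *.
      rewrite <- Rabs_Ropp in H1.
      replace (half_theta u K - 2 * half_theta (/ u) M * RInt (gauss u) 0 (INR K + 1 / 2))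
        with (- (X - half_theta u K) + (X - 2 * half_theta (/ u) M * RInt (gauss u) 0 (INR K + 1
            / 2))) by ring.
      eapply Rle_trans; [apply Rabs_triang|]. lra. }
    assert (Hz : Rabs ((1 / 2 + psi u) - 2 * (1 / 2 + psi (/ u)) * (/ sqrt u * I)) <= 0).
    { refine (is_lim_seq_le _ (fun M => C / (2 * INR M + 1)) (Finite _) (Finite 0) HM _ _).
      - apply (is_lim_seq_abs _ (Finite _)). apply is_lim_seq_minus'; [apply is_lim_seq_const|].
        apply (is_lim_seq_scal_r _ (/ sqrt u * I) (Finite _)). apply (is_lim_seq_scal_l _ 2
            (Finite _)). apply half_theta_limit; auto.
      - apply is_lim_seq_le_le with (fun _ => 0) (fun M => C * / INR (S M)); [|apply
          is_lim_seq_const|].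
        + intros M. rewrite S_INR. assert (HM' := pos_INR M). split.
          * apply Rdiv_le_0_compat; lra.
          * apply Rmult_le_compat_l; [lra|]. apply Rinv_le_contravar; lra.
        + replace (Finite 0) with (Rbar_mult C 0) by (simpl; f_equal; ring).
          apply is_lim_seq_scal_l, is_lim_seq_inv_S. }
    assert (Hz2 := Rabs_pos ((1 / 2 + psi u) - 2 * (1 / 2 + psi (/ u)) * (/ sqrt u * I))).
    destruct (Req_dec ((1 / 2 + psi u) - 2 * (1 / 2 + psi (/ u)) * (/ sqrt u * I)) 0) as [E|E];
        [lra|].
    apply Rabs_pos_lt in E. lra. }
  intros Hv. rewrite (Main v Hv).
  (* At v = 1 both sides contain the same positive number 1/2 + psi 1, and dividing by it yields the
     Gaussian integral I = 1/2. *)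
  assert (H1 := Main 1 Rlt_0_1). rewrite Rinv_1, sqrt_1, Rinv_1 in H1.
  assert (HI2 : I = 1 / 2).
  { apply Rmult_eq_reg_l with (2 * (1 / 2 + psi 1)); [lra|]. generalize (psi_pos 1 Rlt_0_1); lra. }
  rewrite HI2. assert (Hs := sqrt_lt_R0 v Hv). field. lra.
Qed.

(** * Complex sequences and the Dirichlet eta series *)

Definition Clim (u : nat -> C) (l : C) : Prop := is_lim_seq (fun n => Cmod (u n - l)) 0.

Lemma Clim_eps (u : nat -> C) (l : C) :
  Clim u l <-> forall eps, 0 < eps -> exists N, forall n, (N <= n)%nat -> Cmod (u n - l) < eps.
Proof.
  unfold Clim. rewrite <- is_lim_seq_spec. split.
  - intros H eps Heps. destruct (H (mkposreal eps Heps)) as [N HN]. exists N. intros n Hn.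
    specialize (HN n Hn). simpl in HN. rewrite Rminus_0_r, Rabs_pos_eq in HN by apply Cmod_ge_0.
        auto.
  - intros H eps. destruct (H eps (cond_pos eps)) as [N HN]. exists N. intros n Hn.
    rewrite Rminus_0_r, Rabs_pos_eq by apply Cmod_ge_0. auto.
Qed.

Lemma Clim_bound (u : nat -> C) (l : C) (b : nat -> R) :
  (forall n, Cmod (u n - l) <= b n) -> is_lim_seq b 0 -> Clim u l.
Proof.
  intros H Hb. apply (is_lim_seq_le_le (fun _ => 0) _ b); auto.
  - intros n. split; [apply Cmod_ge_0 | auto].
  - apply is_lim_seq_const.
Qed.

Lemma Clim_ext (u v : nat -> C) (l : C) : (forall n, u n = v n) -> Clim u l -> Clim v l.
Proof. intros H. apply is_lim_seq_ext. intros n. rewrite H. reflexivity. Qed.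

Lemma Clim_const (l : C) : Clim (fun _ => l) l.
Proof.
  apply Clim_bound with (fun _ => 0); [|apply is_lim_seq_const].
  intros _. replace (l - l)%C with (RtoC 0) by ring. rewrite Cmod_0. lra.
Qed.

Lemma Clim_plus (u v : nat -> C) (l m : C) :
  Clim u l -> Clim v m -> Clim (fun n => (u n + v n)%C) (l + m)%C.
Proof.
  intros Hu Hv. apply Clim_bound with (fun n => Cmod (u n - l) + Cmod (v n - m)).
  - intros n. replace (u n + v n - (l + m))%C with ((u n - l) + (v n - m))%C by ring. apply
      Cmod_triangle.
  - replace (Finite 0) with (Finite (0 + 0)) by (f_equal; ring). apply is_lim_seq_plus'; auto.
Qed.

Lemma Clim_scal (u : nat -> C) (c l : C) : Clim u l -> Clim (fun n => (c * u n)%C) (c * l)%C.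
Proof.
  intros Hu. apply Clim_bound with (fun n => Cmod c * Cmod (u n - l)).
  - intros n. replace (c * u n - c * l)%C with (c * (u n - l))%C by ring. rewrite Cmod_mult. lra.
  - replace (Finite 0) with (Rbar_mult (Cmod c) 0) by (simpl; f_equal; ring). apply
      is_lim_seq_scal_l; auto.
Qed.

Lemma Clim_minus (u v : nat -> C) (l m : C) :
  Clim u l -> Clim v m -> Clim (fun n => (u n - v n)%C) (l - m)%C.
Proof.
  intros Hu Hv. apply (Clim_scal v (- RtoC 1)) in Hv. assert (H := Clim_plus _ _ _ _ Hu Hv).
  replace (l - m)%C with (l + - RtoC 1 * m)%C by ring. revert H. apply Clim_ext. intros n. ring.
Qed.

Lemma Clim_unique (u : nat -> C) (l m : C) : Clim u l -> Clim u m -> l = m.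
Proof.
  intros Hl Hm. assert (H := Clim_minus _ _ _ _ Hl Hm).
  assert (E : Cmod (l - m) = 0).
  { assert (H' : is_lim_seq (fun _ : nat => Cmod (l - m)) 0).
    { revert H. unfold Clim. apply is_lim_seq_ext. intros n.
      replace (u n - u n - (l - m))%C with (- (l - m))%C by ring. apply Cmod_opp. }
    apply is_lim_seq_unique in H'. rewrite Lim_seq_const in H'. congruence. }
  apply Cmod_eq_0 in E. replace l with (l - m + m)%C by ring. rewrite E. ring.
Qed.

Lemma Clim_Cmod (u : nat -> C) (l : C) : Clim u l -> is_lim_seq (fun n => Cmod (u n)) (Cmod l).
Proof.
  intros H. apply is_lim_seq_spec. intros eps.
  destruct (proj1 (Clim_eps u l) H eps (cond_pos eps)) as [N HN]. exists N. intros n Hn.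
  apply Rle_lt_trans with (Cmod (u n - l)); [|auto].
  apply Rabs_le.
  assert (H1 := Cmod_triangle (u n - l) l). replace (u n - l + l)%C with (u n) in H1 by ring.
  assert (H2 := Cmod_triangle (- (u n - l)) (u n)). replace (- (u n - l) + u n)%C with l in H2 by
      ring.
  rewrite Cmod_opp in H2. lra.
Qed.

(** The sum stops before n and is empty at 0, whereas [sum_n] includes its upper index; hence the
    shift in [sum_n_csum]. *)
Fixpoint csum (a : nat -> C) (n : nat) : C :=
  match n with
  | O => RtoC 0
  | S m => (csum a m + a m)%C
  end.

Lemma csum_S (a : nat -> C) (n : nat) : csum a (S n) = (csum a n + a n)%C.
Proof. reflexivity. Qed.

Lemma sum_n_csum (a : nat -> C) (n : nat) : sum_n (G := C_AbelianMonoid) a n = csum a (S n).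
Proof.
  induction n as [|n IH].
  - rewrite sum_O. simpl. ring.
  - rewrite sum_Sn, IH. reflexivity.
Qed.

Lemma sum_n_m_csum (a : nat -> C) (n : nat) :
  sum_n_m (G := C_AbelianMonoid) a 1 n = csum (fun k => a (S k)) n.
Proof.
  induction n as [|n IH].
  - rewrite sum_n_m_zero by lia. reflexivity.
  - rewrite sum_n_Sm by lia. rewrite IH. reflexivity.
Qed.

Lemma csum_ext (a b : nat -> C) (n : nat) : (forall k, (k < n)%nat -> a k = b k) -> csum a n =
    csum b n.
Proof.
  induction n as [|n IH]; intros H; [reflexivity|]. rewrite !csum_S, IH, H; auto.
Qed.

Lemma csum_scal (c : C) (a : nat -> C) (n : nat) : csum (fun k => (c * a k)%C) n = (c * csum a n)%C.
Proof. induction n as [|n IH]; [simpl; ring|]. rewrite !csum_S, IH. ring. Qed.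

Lemma csum_minus (a b : nat -> C) (n : nat) : csum (fun k => (a k - b k)%C) n = (csum a n - csum
    b n)%C.
Proof. induction n as [|n IH]; [simpl; ring|]. rewrite !csum_S, IH. ring. Qed.

Lemma csum_add (a : nat -> C) (m n : nat) : csum a (m + n) = (csum a m + csum (fun k => a (m +
    k)%nat) n)%C.
Proof.
  induction n as [|n IH]; [rewrite Nat.add_0_r; simpl; ring|].
  rewrite Nat.add_succ_r, !csum_S, IH. ring.
Qed.

Lemma csum_first (a : nat -> C) (n : nat) : csum a (S n) = (a O + csum (fun k => a (S k)) n)%C.
Proof.
  change (S n) with (1 + n)%nat. rewrite csum_add. simpl. ring.
Qed.

Lemma csum_rev (a : nat -> C) (n : nat) : csum (fun k => a (n - 1 - k)%nat) n = csum a n.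
Proof.
  revert a. induction n as [|n IH]; intros a; [reflexivity|].
  rewrite csum_first, csum_S, <- (IH a), Cplus_comm. f_equal.
  - apply csum_ext. intros k Hk. f_equal. lia.
  - f_equal. lia.
Qed.

Lemma csum_pair (b : nat -> C) (m : nat) :
  csum b (2 * m) = csum (fun j => (b (2 * j)%nat + b (2 * j + 1)%nat)%C) m.
Proof.
  induction m as [|m IH]; [reflexivity|].
  replace (2 * S m)%nat with (S (S (2 * m))) by lia. rewrite !csum_S, IH.
  replace (2 * m + 1)%nat with (S (2 * m)) by lia. ring.
Qed.

Lemma Clim_csum (a : nat -> nat -> C) (c : nat -> C) (K : nat) :
  (forall k, Clim (fun n => a n k) (c k)) -> Clim (fun n => csum (a n) K) (csum c K).
Proof.
  intros H. induction K as [|K IH]; [exact (Clim_const (RtoC 0))|]. apply (Clim_plus (fun n =>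
      csum (a n) K) (fun n => a n K)); auto.
Qed.

(** K is found from the majorant b alone. This uniformity over all sequences below b is the core of
    both dominated limit theorems. *)
Lemma series_tail_small (b : nat -> R) : ex_series b -> (forall k, 0 <= b k) ->
  forall eps, 0 < eps -> exists K, forall m, (K <= m)%nat -> forall (a : nat -> C),
    (forall k, (k < m)%nat -> Cmod (a k) <= b k) -> Cmod (csum a m - csum a K) < eps.
Proof.
  intros [l Hl] Hb eps Heps. apply (is_lim_seq_spec (sum_n b) l) in Hl.
  destruct (Hl (mkposreal (eps / 2) ltac:(lra))) as [N HN]. exists (S N). intros m Hm a Ha.
  replace m with (S N + (m - S N))%nat by lia. rewrite csum_add.
  replace (_ - _)%C with (csum (fun k => a (S N + k)%nat) (m - S N)) by ring.
  assert (A : forall p, (p <= m - S N)%nat -> Cmod (csum (fun k => a (S N + k)%nat) p) <= sum_n b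
      (N + p) - sum_n b N).
  { induction p as [|p IH]; intros Hp.
    - rewrite Nat.add_0_r. simpl. rewrite Cmod_0. lra.
    - rewrite csum_S, Nat.add_succ_r, sum_n_S. eapply Rle_trans; [apply Cmod_triangle|].
      specialize (IH ltac:(lia)). assert (H2 := Ha (S N + p)%nat ltac:(lia)).
      simpl in *. lra. }
  eapply Rle_lt_trans; [apply A; lia|].
  assert (H1 := HN N (le_n N)). assert (H2 := HN (N + (m - S N))%nat ltac:(lia)). simpl in H1, H2.
  apply Rabs_def2 in H1. apply Rabs_def2 in H2. lra.
Qed.

Lemma Cseries_ex (a : nat -> C) (b : nat -> R) : (forall k, Cmod (a k) <= b k) -> ex_series b ->
  exists l, Clim (csum a) l.
Proof.
  intros Ha Hb.
  destruct (ex_series_le (K := R_AbsRing) (V := C_R_CompleteNormedModule) a b) as [l Hl]; auto.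
  { intros n. rewrite <- Cmod_norm. auto. }
  exists l. apply Clim_eps. intros eps Heps.
  destruct (Hl _ (locally_Cmod l eps Heps)) as [N HN]. exists (S N). intros n Hn.
  destruct n as [|n]; [lia|]. rewrite <- sum_n_csum. apply HN. lia.
Qed.

(** Tannery's theorem for finite sums whose length grows with n. *)
Lemma dominated_series (a : nat -> nat -> C) (c : nat -> C) (b : nat -> R) (m : nat -> nat) (l :
    C) :
  ex_series b -> (forall k, 0 <= b k) ->
  (forall n k, (k < m n)%nat -> Cmod (a n k) <= b k) ->
  (forall k, Cmod (c k) <= b k) ->
  (forall k, Clim (fun n => a n k) (c k)) ->
  (forall K, exists N, forall n, (N <= n)%nat -> (K <= m n)%nat) ->
  Clim (csum c) l -> Clim (fun n => csum (a n) (m n)) l.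
Proof.
  intros Hb Hb0 Ha Hcb Hc Hm Hl. apply Clim_eps. intros eps Heps.
  destruct (series_tail_small b Hb Hb0 (eps / 4) ltac:(lra)) as [K HK].
  destruct (proj1 (Clim_eps _ _) Hl (eps / 4) ltac:(lra)) as [N1 HN1].
  destruct (proj1 (Clim_eps _ _) (Clim_csum a c K Hc) (eps / 4) ltac:(lra)) as [N2 HN2].
  destruct (Hm K) as [N3 HN3].
  exists (max N2 N3). intros n Hn.
  assert (H1 := HK (m n) (HN3 n ltac:(lia)) (a n) (Ha n)).
  assert (H2 := HN2 n ltac:(lia)).
  assert (H3 := HK (max N1 K) ltac:(lia) c (fun k _ => Hcb k)).
  assert (H4 := HN1 (max N1 K) ltac:(lia)).
  replace (csum (a n) (m n) - l)%C with
    ((csum (a n) (m n) - csum (a n) K) + ((csum (a n) K - csum c K) +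
    ((- (csum c (max N1 K) - csum c K)) + (csum c (max N1 K) - l))))%C by ring.
  eapply Rle_lt_trans; [apply Cmod_triangle|].
  eapply Rle_lt_trans; [apply Rplus_le_compat_l, Cmod_triangle|].
  eapply Rle_lt_trans; [apply Rplus_le_compat_l, Rplus_le_compat_l, Cmod_triangle|].
  rewrite Cmod_opp. lra.
Qed.

(** By the mean value theorem each term is at most a difference of consecutive values of t^(-x)
    divided by x, and these differences telescope. *)
Lemma ex_series_Rpower (x : R) : 0 < x -> ex_series (fun k => Rpower (INR (S k)) (- x - 1)).
Proof.
  intros Hx.
  assert (A : forall n, sum_n (fun k => Rpower (INR (S k)) (- x - 1)) n <= 1 + / x * (1 - Rpower
      (INR (S n)) (- x))).
  { assert (Hone : forall p, Rpower 1 p = 1) by (intros; unfold Rpower; rewrite ln_1, Rmult_0_r,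
      exp_0; auto).
    induction n as [|n IH].
    - rewrite sum_O. simpl. rewrite !Hone. lra.
    - rewrite sum_n_S.
      assert (Hn : 0 < INR (S n)) by (apply lt_0_INR; lia).
      rewrite (S_INR (S n)).
      destruct (MVT_is_derive (fun t => Rpower t (- x)) (fun t => - x * Rpower t (- x - 1)) (INR
          (S n)) (INR (S n) + 1)) as (c & Hc & E); [lra| |].
      + intros t Ht. apply is_derive_Rpower. lra.
      + assert (Rpower (INR (S n) + 1) (- x - 1) <= Rpower c (- x - 1)) by (apply Rpower_le_neg;
          lra).
        assert (Rpower c (- x - 1) = / x * (Rpower (INR (S n)) (- x) - Rpower (INR (S n) + 1) (-
            x))).
        { replace (Rpower (INR (S n)) (- x) - Rpower (INR (S n) + 1) (- x)) with (x * Rpower c (-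
            x - 1)) by lra. field; lra. }
        rewrite Rmult_minus_distr_l in *. lra. }
  destruct (ex_finite_lim_seq_incr (sum_n (fun k => Rpower (INR (S k)) (- x - 1))) (1 + / x)) as
      [l Hl].
  - intros n. rewrite sum_n_S.
    generalize (Rpower_pos (INR (S (S n))) (- x - 1)). lra.
  - intros n. eapply Rle_trans; [apply A|].
    assert (0 < / x * Rpower (INR (S n)) (- x)) by (apply Rmult_lt_0_compat; [apply
        Rinv_0_lt_compat; auto | apply Rpower_pos]).
    lra.
  - exists l. exact Hl.
Qed.

(** Two consecutive terms of the alternating series form one term. Singly they have size k^(-Re z);
    a pair has size k^(-Re z - 1), summable for every Re z > 0. *)
Definition eta_term (z : C) (j : nat) : C :=
  (rcpow (INR (2 * j + 1)) (- z) - rcpow (INR (2 * j + 2)) (- z))%C.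

Lemma Cmod_eta_term (z : C) (j : nat) : 0 < Re z ->
  Cmod (eta_term z j) <= Cmod z * Rpower (INR (S j)) (- Re z - 1).
Proof.
  intros Hz. assert (Hj := pos_INR j). unfold eta_term.
  assert (E1 : INR (2 * j + 1) = 2 * INR j + 1) by (rewrite plus_INR, mult_INR; simpl; ring).
  assert (E2 : INR (2 * j + 2) = 2 * INR j + 2) by (rewrite plus_INR, mult_INR; simpl; ring).
  rewrite E1, E2, S_INR.
  eapply Rle_trans; [apply rcpow_diff_bound; lra|].
  replace (Cmod z * (2 * INR j + 2 - (2 * INR j + 1))) with (Cmod z) by ring.
  apply Rmult_le_compat_l; [apply Cmod_ge_0|]. apply Rpower_le_neg; lra.
Qed.

Lemma ex_series_eta_bound (c x : R) : 0 < x -> ex_series (fun j => c * Rpower (INR (S j)) (- x -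
    1)).
Proof.
  intros Hx. apply (ex_series_scal_l (K := R_AbsRing) (V := R_NormedModule) c (fun j => Rpower
      (INR (S j)) (- x - 1))).
  apply ex_series_Rpower; auto.
Qed.

Lemma eta_ex (z : C) : 0 < Re z -> exists l, Clim (csum (eta_term z)) l.
Proof.
  intros Hz. apply Cseries_ex with (fun j => Cmod z * Rpower (INR (S j)) (- Re z - 1)).
  - intros j. apply Cmod_eta_term; auto.
  - apply ex_series_eta_bound; auto.
Qed.

(* Read backwards, d (2 n) = r d n + e n with |r| > 1 is a contraction. *)
Lemma expanding_recursion (d e : nat -> C) (r : C) (B : R) : 1 < Cmod r ->
  (forall n, (1 <= n)%nat -> Cmod (d n) <= B) ->
  (forall n, (1 <= n)%nat -> d (2 * n)%nat = (r * d n + e n)%C) ->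
  Clim e (RtoC 0) -> Clim d (RtoC 0).
Proof.
  intros Hr HB Hrec He. set (rho := Cmod r) in *.
  assert (HB0 : 0 <= B) by (eapply Rle_trans; [apply Cmod_ge_0 | apply (HB 1%nat); lia]).
  apply Clim_eps. intros eps Heps.
  (* With this tolerance eps / 2 is a fixed point of the backward step x |-> (x + eps/2 (rho - 1)) /
     rho, so that only the part B rho^(-m) shrinks from step to step. *)
  destruct (proj1 (Clim_eps _ _) He (eps / 2 * (rho - 1)) ltac:(nra)) as [N HN].
  assert (A : forall m n, (1 <= n)%nat -> (N <= n)%nat -> Cmod (d n) <= B * (/ rho) ^ m + eps / 2).
  { induction m as [|m IH]; intros n H1 Hn.
    - simpl. assert (H := HB n H1). lra.
    - assert (H2 := IH (2 * n)%nat ltac:(lia) ltac:(lia)).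
      assert (H3 := HN n Hn). replace (e n - RtoC 0)%C with (e n) in H3 by ring.
      assert (E : (r * d n = d (2 * n)%nat + - e n)%C) by (rewrite Hrec by auto; ring).
      assert (H4 : rho * Cmod (d n) <= Cmod (d (2 * n)%nat) + Cmod (e n)).
      { unfold rho. rewrite <- Cmod_mult, E. eapply Rle_trans; [apply Cmod_triangle|]. rewrite
          Cmod_opp. lra. }
      apply Rmult_le_reg_l with rho; [lra|].
      replace (rho * (B * (/ rho) ^ S m + eps / 2)) with (B * (/ rho) ^ m + rho * (eps / 2)) by
          (simpl; field; lra).
      lra. }
  destruct (pow_lt_1_zero (/ rho)) with (y := eps / 2 / (B + 1)) as [M HM].
  - rewrite Rabs_pos_eq by (left; apply Rinv_0_lt_compat; lra). rewrite <- Rinv_1. apply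
      Rinv_lt_contravar; lra.
  - apply Rdiv_lt_0_compat; lra.
  - exists (S N). intros n Hn. replace (d n - RtoC 0)%C with (d n) by ring.
    assert (H1 := A M n ltac:(lia) ltac:(lia)). specialize (HM M (le_n M)).
    assert (0 < (/ rho) ^ M) by (apply pow_lt, Rinv_0_lt_compat; lra).
    rewrite Rabs_pos_eq in HM by lra.
    apply Rlt_div_r in HM; [|lra]. nra.
Qed.

(** * Doubling the length of the cycle *)

Lemma Clim_bound_loc (u : nat -> C) (l : C) (b : nat -> R) (N : nat) :
  (forall n, (N <= n)%nat -> Cmod (u n - l) <= b n) -> is_lim_seq b 0 -> Clim u l.
Proof.
  intros H Hb. unfold Clim.
  apply (is_lim_seq_le_le_loc (fun _ => 0) _ b); auto.
  - exists N. intros n Hn. split; [apply Cmod_ge_0 | auto].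
  - apply is_lim_seq_const.
Qed.

Lemma Clim_unshift (u : nat -> C) (l : C) : Clim (fun n => u (S n)) l -> Clim u l.
Proof. intros H. apply (is_lim_seq_incr_1 (fun n => Cmod (u n - l))). exact H. Qed.

(* 2 n times the square root of the k-th eigenvalue 4 sin^2(PI k / 2n) of Z/2nZ. *)
Definition chord (n k : nat) : R := 4 * INR n * sin (PI * (INR k / (2 * INR n))).

Lemma chord_arg (n k : nat) : (1 <= n)%nat -> (k <= n)%nat -> 0 <= INR k / (2 * INR n) <= 1 / 2.
Proof.
  intros Hn Hk. apply le_INR in Hn, Hk. simpl in Hn. assert (H0 := pos_INR k). split.
  - apply Rdiv_le_0_compat; lra.
  - apply Rle_div_l; [lra|]. lra.
Qed.

(** Jordan's inequality. The lower bound is linear in k and free of n, as the domination in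
    [chord_pairs_limit] demands. *)
Lemma chord_ge (n k : nat) : (1 <= n)%nat -> (k <= n)%nat -> 4 * INR k <= chord n k.
Proof.
  intros Hn Hk. assert (H := sin_PI_ge _ (chord_arg n k Hn Hk)). apply le_INR in Hn. simpl in Hn.
  unfold chord. apply (Rmult_le_compat_l (4 * INR n)) in H; [|lra].
  replace (4 * INR n * (2 * (INR k / (2 * INR n)))) with (4 * INR k) in H by (field; lra). auto.
Qed.

(** Up to k = n the angle stays in the first quadrant, where the sine increases. The increment is at
    most 4n * PI / (2n) = 2 PI, rounded up to 8. *)
Lemma chord_step (n k : nat) : (1 <= n)%nat -> (S k <= n)%nat ->
  chord n k <= chord n (S k) <= chord n k + 8.
Proof.
  intros Hn Hk. assert (A0 := chord_arg n k Hn ltac:(lia)). assert (A1 := chord_arg n (S k) Hn Hk).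
  assert (Hpi := PI_RGT_0). apply le_INR in Hn. simpl in Hn.
  assert (E : INR (S k) / (2 * INR n) = INR k / (2 * INR n) + / (2 * INR n)) by (rewrite S_INR;
      field; lra).
  rewrite E in A1. unfold chord. rewrite E. assert (Hi : 0 < / (2 * INR n)) by (apply
      Rinv_0_lt_compat; lra).
  set (t := INR k / (2 * INR n)) in *. split.
  - apply Rmult_le_compat_l; [lra|]. apply sin_incr_1; nra.
  - assert (H := Rabs_increment_le (fun t => sin (PI * t)) (fun t => PI * cos (PI * t)) t (t + /
      (2 * INR n)) PI).
    assert (H' : Rabs (sin (PI * (t + / (2 * INR n))) - sin (PI * t)) <= PI * (t + / (2 * INR n)
        - t)).
    { apply H; [lra| |].
      - intros x _. auto_derive; auto. ring.
      - intros x _. rewrite Rabs_mult, (Rabs_pos_eq PI) by lra.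
        apply Rle_trans with (PI * 1); [|lra].
        apply Rmult_le_compat_l; [lra | apply Rabs_le, COS_bound]. }
    assert (H2 := Rle_abs (sin (PI * (t + / (2 * INR n))) - sin (PI * t))).
    replace (t + / (2 * INR n) - t) with (/ (2 * INR n)) in H' by ring.
    assert (H3 : 4 * INR n * (PI * / (2 * INR n)) <= 8).
    { replace (4 * INR n * (PI * / (2 * INR n))) with (2 * PI) by (field; lra). generalize PI_4;
        lra. }
    assert (H4 : 4 * INR n * (sin (PI * (t + / (2 * INR n))) - sin (PI * t)) <= 4 * INR n * (PI *
        / (2 * INR n)))
      by (apply Rmult_le_compat_l; lra).
    lra.
Qed.

Lemma sin_taylor_bounds (u : R) : 0 <= u -> 0 <= u - sin u <= u ^ 3 / 2.
Proof.
  intros Hu. split.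
  - assert (H := Rabs_sin_le u). rewrite (Rabs_pos_eq u) in H by auto. generalize (Rle_abs (sin
      u)). lra.
  - assert (H := Rabs_increment_le (fun t => t - sin t) (fun t => 1 - cos t) 0 u (u ^ 2 / 2) Hu).
    cbv beta in H. rewrite sin_0 in H. replace (0 - 0) with 0 in H by ring. rewrite !Rminus_0_r
        in H.
    eapply Rle_trans; [apply Rle_abs|]. eapply Rle_trans; [apply H|].
    + intros x _. auto_derive; auto. ring.
    + intros x Hx. assert (H1 := cos_ge_quad x). assert (H2 := COS_bound x). rewrite Rabs_pos_eq
        by lra.
      assert (x ^ 2 <= u ^ 2) by (apply pow_incr; lra). lra.
    + right; field.
Qed.

(** The gap is 4n (u - sin u) with u = PI k / (2n) <= 2k / n, and u - sin u <= u^3 / 2 makes it at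
    most 16 k^3 / n^2; one factor 1/n is given away. *)
Lemma chord_near (n k : nat) : (1 <= n)%nat -> (1 <= k)%nat ->
  0 <= 2 * PI * INR k - chord n k <= 16 * INR k ^ 3 * / INR n.
Proof.
  intros Hn Hk. apply le_INR in Hn, Hk. simpl in Hn, Hk. assert (Hpi := PI_RGT_0). assert (Hpi4
      := PI_4).
  assert (Hin : 0 < / INR n) by (apply Rinv_0_lt_compat; lra).
  set (u := PI * (INR k / (2 * INR n))).
  assert (Hu : 0 <= u). { unfold u. apply Rmult_le_pos; [lra|]. apply Rdiv_le_0_compat; lra. }
  assert (H := sin_taylor_bounds u Hu).
  replace (2 * PI * INR k - chord n k) with (4 * INR n * (u - sin u)) by (unfold chord, u; field;
      lra).
  split; [apply Rmult_le_pos; lra|].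
  apply Rle_trans with (4 * INR n * (u ^ 3 / 2)); [apply Rmult_le_compat_l; lra|].
  assert (Hu2 : u <= 2 * INR k * / INR n).
  { unfold u. replace (PI * (INR k / (2 * INR n))) with (PI / 2 * INR k * / INR n) by (field; lra).
    apply Rmult_le_compat_r; [lra|]. apply Rmult_le_compat_r; lra. }
  assert (Hu3 : u ^ 3 <= (2 * INR k * / INR n) ^ 3) by (apply pow_incr; lra).
  apply Rle_trans with (4 * INR n * ((2 * INR k * / INR n) ^ 3 / 2)); [apply Rmult_le_compat_l;
      lra|].
  replace (4 * INR n * ((2 * INR k * / INR n) ^ 3 / 2)) with (16 * INR k ^ 3 * / INR n * / INR n)
      by (field; lra).
  apply Rle_trans with (16 * INR k ^ 3 * / INR n * 1); [|lra].
  apply Rmult_le_compat_l.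
  - apply Rmult_le_pos; [|lra]. assert (0 <= INR k ^ 3) by (apply pow_le; lra). lra.
  - rewrite <- Rinv_1. apply Rinv_le_contravar; lra.
Qed.

Lemma chord_rcpow_limit (s : C) (k : nat) : 0 < Re s -> (1 <= k)%nat ->
  Clim (fun n => rcpow (chord n k) (- s)) (rcpow (2 * PI * INR k) (- s)).
Proof.
  intros Hs Hk. assert (Hk1 := le_INR _ _ Hk). simpl in Hk1.
  apply Clim_unshift.
  apply Clim_bound_loc with (b := fun n => (Cmod s * (16 * INR k ^ 3) * Rpower (4 * INR k) (- Re
      s - 1)) * / INR (S n)) (N := k).
  - intros n Hn. assert (H1 := chord_ge (S n) k ltac:(lia) ltac:(lia)).
    assert (H2 := chord_near (S n) k ltac:(lia) Hk).
    eapply Rle_trans; [apply rcpow_diff_bound; lra|].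
    replace (Cmod s * (16 * INR k ^ 3) * Rpower (4 * INR k) (- Re s - 1) * / INR (S n))
      with (Cmod s * (16 * INR k ^ 3 * / INR (S n)) * Rpower (4 * INR k) (- Re s - 1)) by ring.
    apply Rmult_le_compat.
    + apply Rmult_le_pos; [apply Cmod_ge_0 | lra].
    + left; apply Rpower_pos.
    + apply Rmult_le_compat_l; [apply Cmod_ge_0 | lra].
    + apply Rpower_le_neg; lra.
  - replace (Finite 0) with (Rbar_mult (Cmod s * (16 * INR k ^ 3) * Rpower (4 * INR k) (- Re s -
      1)) 0) by (simpl; f_equal; ring).
    apply is_lim_seq_scal_l, is_lim_seq_inv_S.
Qed.

(** Each chord tends to 2 PI k, so each pair tends to (2 PI)^(-s) times a term of eta. The majorant
    takes its factor 8 from [chord_step] and its decay from [chord_ge]; [Nat.div2 n] pairs keep the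
    indices at most n, where both hold. *)
Lemma chord_pairs_limit (s eta : C) : 0 < Re s -> Clim (csum (eta_term s)) eta ->
  Clim (fun n => csum (fun j => (rcpow (chord n (2 * j + 1)) (- s) - rcpow (chord n (2 * j + 2))
      (- s))%C) (Nat.div2 n))
    (rcpow (2 * PI) (- s) * eta).
Proof.
  intros Hs Heta. assert (Hpi := PI_RGT_0).
  apply dominated_series with (c := fun j => (rcpow (2 * PI) (- s) * eta_term s j)%C)
    (b := fun j => (8 * Cmod s) * Rpower (INR (S j)) (- Re s - 1)).
  - apply ex_series_eta_bound; auto.
  - intros k. apply Rmult_le_pos; [|left; apply Rpower_pos]. generalize (Cmod_ge_0 s). lra.
  - intros n j Hj. assert (H2j : (2 * j + 2 <= n)%nat).
    { assert (H := Nat.div2_odd n). destruct (Nat.odd n); simpl in H; lia. }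
    assert (Hst := chord_step n (2 * j + 1) ltac:(lia) ltac:(lia)).
    replace (S (2 * j + 1)) with (2 * j + 2)%nat in Hst by lia.
    assert (Hge := chord_ge n (2 * j + 1) ltac:(lia) ltac:(lia)).
    assert (E1 : INR (2 * j + 1) = 2 * INR j + 1) by (rewrite plus_INR, mult_INR; simpl; ring).
    assert (Hj0 := pos_INR j). rewrite E1 in Hge.
    eapply Rle_trans; [apply rcpow_diff_bound; lra|].
    apply Rmult_le_compat.
    + apply Rmult_le_pos; [apply Cmod_ge_0 | lra].
    + left; apply Rpower_pos.
    + rewrite Rmult_comm. apply Rmult_le_compat_r; [apply Cmod_ge_0 | lra].
    + apply Rpower_le_neg; [rewrite S_INR; lra | lra].
  - intros j. rewrite Cmod_mult, Cmod_rcpow.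
    assert (H1 := Cmod_eta_term s j Hs).
    assert (H2 : Rpower (2 * PI) (Re (- s)) <= 1).
    { apply Rle_trans with (Rpower (2 * PI) 0); [|rewrite Rpower_O; lra].
      apply Rle_Rpower; [generalize PI2_1; lra | unfold Re in *; simpl; lra]. }
    assert (H3 := Rpower_pos (2 * PI) (Re (- s))). assert (H4 := Cmod_ge_0 (eta_term s j)).
    assert (H5 : 0 <= Cmod s * Rpower (INR (S j)) (- Re s - 1)) by lra.
    rewrite Rmult_assoc. nra.
  - intros j. unfold eta_term.
    replace (rcpow (2 * PI) (- s) * (rcpow (INR (2 * j + 1)) (- s) - rcpow (INR (2 * j + 2)) (-
        s)))%C
      with (rcpow (2 * PI * INR (2 * j + 1)) (- s) - rcpow (2 * PI * INR (2 * j + 2)) (- s))%C.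
    + apply Clim_minus; apply chord_rcpow_limit; auto; lia.
    + rewrite !(rcpow_mult (2 * PI)); try lra; try (apply lt_0_INR; lia). ring.
  - intros K. exists (2 * K)%nat. intros n Hn.
    assert (H := Nat.div2_odd n). destruct (Nat.odd n); simpl in H; lia.
  - assert (H := Clim_scal _ (rcpow (2 * PI) (- s)) _ Heta). revert H. apply Clim_ext.
    intros n. rewrite csum_scal. reflexivity.
Qed.

(** * The alternating sum over the 2n-cycle *)

Definition alt_chord (s : C) (n k : nat) : C := (RtoC ((-1) ^ k) * rcpow (chord n (S k)) (- s))%C.

Lemma Cmod_alt_chord (s : C) (n k : nat) : Cmod (alt_chord s n k) = Rpower (chord n (S k)) (- Re s).
Proof.
  unfold alt_chord. rewrite Cmod_mult, Cmod_R, pow_1_abs, Rmult_1_l, Cmod_rcpow. reflexivity.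
Qed.

Lemma pow_m1_even (j : nat) : (-1) ^ (2 * j) = 1.
Proof. rewrite pow_mult. replace ((-1) ^ 2) with 1 by ring. apply pow1. Qed.

Lemma csum_alt_pairs (s : C) (n m : nat) :
  csum (alt_chord s n) (2 * m) =
  csum (fun j => (rcpow (chord n (2 * j + 1)) (- s) - rcpow (chord n (2 * j + 2)) (- s))%C) m.
Proof.
  rewrite csum_pair. apply csum_ext. intros j _. unfold alt_chord.
  rewrite pow_add, pow_m1_even. replace (S (2 * j + 1)) with (2 * j + 2)%nat by lia.
  replace (S (2 * j)) with (2 * j + 1)%nat by lia.
  replace (1 * (-1) ^ 1) with (-(1)) by ring. rewrite RtoC_opp. ring.
Qed.

Lemma chord_sym (n k : nat) : (1 <= n)%nat -> (k <= 2 * n)%nat -> chord n (2 * n - k) = chord n k.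
Proof.
  intros Hn Hk. unfold chord. f_equal. rewrite <- sin_PI_x. f_equal.
  rewrite minus_INR, mult_INR by auto. apply le_INR in Hn. simpl in *. field. lra.
Qed.

Lemma csum_symmetric (b : nat -> C) (p : nat) : (forall k, (k < p)%nat -> b (2 * p - k)%nat = b
    k) ->
  csum b (2 * p + 1) = (RtoC 2 * csum b (S p) - b p)%C.
Proof.
  intros H. replace (2 * p + 1)%nat with (S p + p)%nat by lia. rewrite csum_add.
  rewrite (csum_ext (fun k => b (S p + k)%nat) (fun k => b (p - 1 - k)%nat)).
  - rewrite csum_rev, csum_S. ring.
  - intros k Hk. rewrite <- (H (p - 1 - k)%nat) by lia. f_equal. lia.
Qed.

(** Reflection k |-> 2n - k preserves chords and signs and fixes k = n. Folding along it brings the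
    sum into the range k <= n where chords increase; the middle term, at index n - 1, would be
    counted twice. *)
Lemma csum_alt_chord_full (s : C) (n : nat) : (1 <= n)%nat ->
  csum (alt_chord s n) (2 * n - 1) = (RtoC 2 * csum (alt_chord s n) n - alt_chord s n (n - 1))%C.
Proof.
  intros Hn. destruct n as [|p]; [lia|].
  replace (2 * S p - 1)%nat with (2 * p + 1)%nat by lia.
  replace (S p - 1)%nat with p by lia. apply csum_symmetric.
  intros k Hk. unfold alt_chord.
  replace (S (2 * p - k)) with (2 * S p - S k)%nat by lia. rewrite chord_sym by lia.
  do 2 f_equal.
  apply Rmult_eq_reg_r with ((-1) ^ k); [|apply pow_nonzero; lra].
  rewrite <- !pow_add. replace (2 * p - k + k)%nat with (2 * p)%nat by lia.
  replace (k + k)%nat with (2 * k)%nat by lia. rewrite !pow_m1_even. reflexivity.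
Qed.

(** Removing the even-indexed terms twice flips their sign. For the 2n-cycle these are the
    eigenvalues it shares with the n-cycle. *)
Lemma csum_alt_identity (w : nat -> C) (n : nat) : (1 <= n)%nat ->
  (csum (fun k => w (S k)) (2 * n - 1) - RtoC 2 * csum (fun k => w (2 * S k)%nat) (n - 1))%C =
  csum (fun k => RtoC ((-1) ^ k) * w (S k))%C (2 * n - 1).
Proof.
  intros Hn. destruct n as [|p]; [lia|]. clear Hn.
  replace (2 * S p - 1)%nat with (S (2 * p)) by lia. replace (S p - 1)%nat with p by lia.
  induction p as [|p IH]; [simpl; ring|].
  replace (2 * S p)%nat with (S (S (2 * p))) by lia.
  rewrite (csum_S _ (S (S (2 * p)))), (csum_S _ (S (2 * p))), (csum_S _ p).
  rewrite (csum_S (fun k => RtoC ((-1) ^ k) * w (S k))%C (S (S (2 * p)))).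
  rewrite (csum_S (fun k => RtoC ((-1) ^ k) * w (S k))%C (S (2 * p))).
  rewrite <- IH.
  replace ((-1) ^ S (S (2 * p))) with 1 by (rewrite <- !tech_pow_Rmult, pow_m1_even; ring).
  replace ((-1) ^ S (2 * p)) with (-(1)) by (rewrite <- !tech_pow_Rmult, pow_m1_even; ring).
  replace (2 * S p)%nat with (S (S (2 * p))) by lia.
  rewrite RtoC_opp. ring.
Qed.

Lemma alt_chord_last_limit (s : C) : 0 < Re s -> Clim (fun n => alt_chord s n (n - 1)) (RtoC 0).
Proof.
  intros Hs. apply Clim_eps. intros eps Heps.
  destruct (Rpower_large (Re s) eps Hs Heps) as (B & HB & HB').
  destruct (INR_unbounded B) as [N HN]. exists (S N). intros n Hn.
  replace (alt_chord s n (n - 1) - RtoC 0)%C with (alt_chord s n (n - 1)) by ring.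
  rewrite Cmod_alt_chord. apply HB'. replace (S (n - 1)) with n by lia.
  eapply Rle_trans; [|apply chord_ge; lia]. assert (Hn' : INR N <= INR n) by (apply le_INR; lia).
      lra.
Qed.

Lemma csum_alt_chord_limit (s eta : C) : 0 < Re s -> Clim (csum (eta_term s)) eta ->
  Clim (fun n => csum (alt_chord s n) (2 * n - 1)) (RtoC 2 * (rcpow (2 * PI) (- s) * eta)).
Proof.
  intros Hs Heta.
  assert (Hlast := alt_chord_last_limit s Hs).
  (* For odd n the half sum has one unpaired term left, the middle one, and it tends to 0. *)
  assert (Hr : Clim (fun n => (csum (alt_chord s n) n - csum (alt_chord s n) (2 * Nat.div2 n))%C)
      (RtoC 0)).
  { apply Clim_bound with (fun n => Cmod (alt_chord s n (n - 1) - RtoC 0)); [|exact Hlast].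
    intros n. replace (alt_chord s n (n - 1) - RtoC 0)%C with (alt_chord s n (n - 1)) by ring.
    assert (H := Nat.div2_odd n). destruct (Nat.odd n); simpl in H.
    - replace (csum (alt_chord s n) n) with (csum (alt_chord s n) (S (2 * Nat.div2 n))) by
        (f_equal; lia).
      rewrite csum_S. replace (2 * Nat.div2 n)%nat with (n - 1)%nat by lia.
      right. f_equal. ring.
    - replace (csum (alt_chord s n) n) with (csum (alt_chord s n) (2 * Nat.div2 n)) by (f_equal;
        lia).
      replace (_ - _ - _)%C with (RtoC 0) by ring. rewrite Cmod_0. apply Cmod_ge_0. }
  assert (H := Clim_minus _ _ _ _ (Clim_scal _ (RtoC 2) _ (Clim_plus _ _ _ _ Hr
      (chord_pairs_limit s eta Hs Heta))) Hlast).
  replace (RtoC 2 * (RtoC 0 + rcpow (2 * PI) (- s) * eta) - RtoC 0)%C with (RtoC 2 * (rcpow (2 *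
      PI) (- s) * eta))%C in H by ring.
  apply Clim_unshift. apply (is_lim_seq_incr_1 _ 0) in H. revert H. apply is_lim_seq_ext. intros
      n. f_equal. f_equal.
  rewrite csum_alt_chord_full by lia. rewrite <- csum_alt_pairs. ring.
Qed.

Lemma rcpow_4 (z : C) : rcpow 4 z = rcpow 2 (RtoC 2 * z).
Proof. replace 4 with (2 ^ 2) by ring. apply rcpow_pow2. lra. Qed.

Lemma chord_rcpow_split (s : C) (n k : nat) : (1 <= n)%nat -> (0 < k < 2 * n)%nat ->
  (rcpow (INR (2 * n)) (- s) * (/ rcpow 4 (s / RtoC 2) * / rcpow (sin (PI * (INR k / (2 * INR
      n)))) (RtoC 2 * (s / RtoC 2))))%C
  = rcpow (chord n k) (- s).
Proof.
  intros Hn Hk. assert (Hpi := PI_RGT_0).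
  assert (Hn1 : 1 <= INR n) by (apply le_INR in Hn; auto).
  assert (Hk1 : 0 < INR k < 2 * INR n).
  { split; [apply lt_0_INR; lia|]. replace 2 with (INR 2) by auto. rewrite <- mult_INR. apply
      lt_INR. lia. }
  assert (Hsin : 0 < sin (PI * (INR k / (2 * INR n)))).
  { assert (0 < INR k / (2 * INR n) < 1).
    { split; [apply Rdiv_lt_0_compat; lra | apply Rlt_div_l; lra]. }
    apply sin_gt_0; [apply Rmult_lt_0_compat; lra|].
    apply Rlt_le_trans with (PI * 1); [apply Rmult_lt_compat_l; lra | lra]. }
  rewrite rcpow_4. replace (RtoC 2 * (s / RtoC 2))%C with s by (field; apply RtoC_neq_0; lra).
  rewrite <- !rcpow_opp, <- !rcpow_mult; try (rewrite mult_INR; simpl); try apply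
      Rmult_lt_0_compat; try lra.
  f_equal. unfold chord. ring.
Qed.

Lemma zeta_cyclic_even (s : C) (n : nat) : (1 <= n)%nat ->
  (rcpow (INR (2 * n)) (- s) * zeta_cyclic (2 * n) (s / RtoC 2))%C =
  csum (fun k => rcpow (chord n (S k)) (- s)) (2 * n - 1).
Proof.
  intros Hn. unfold zeta_cyclic. rewrite sum_n_m_csum, Cmult_assoc, <- csum_scal.
  apply csum_ext. intros k Hk. rewrite <- chord_rcpow_split by lia.
  rewrite <- Cmult_assoc. do 4 f_equal. f_equal.
  rewrite mult_INR. simpl (INR 2). apply le_INR in Hn. simpl in Hn. field. lra.
Qed.

Lemma zeta_cyclic_half (s : C) (n : nat) : (1 <= n)%nat ->
  (rcpow (INR (2 * n)) (- s) * zeta_cyclic n (s / RtoC 2))%C =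
  csum (fun k => rcpow (chord n (2 * S k)) (- s)) (n - 1).
Proof.
  intros Hn. unfold zeta_cyclic. rewrite sum_n_m_csum, Cmult_assoc, <- csum_scal.
  apply csum_ext. intros k Hk. rewrite <- chord_rcpow_split by lia.
  rewrite <- Cmult_assoc. do 4 f_equal. f_equal.
  rewrite mult_INR. simpl (INR 2). apply le_INR in Hn. simpl in Hn. field. lra.
Qed.

(* The contribution of zeta_Z cancels. *)
Lemma h_double (s : C) (n : nat) : (1 <= n)%nat ->
  h (2 * n) s = (rcpow 2 (RtoC 1 - s) * h n s +
    rcpow (4 * PI) (s / RtoC 2) * CGamma (s / RtoC 2) * csum (alt_chord s n) (2 * n - 1))%C.
Proof.
  intros Hn.
  assert (Hn1 : 0 < INR n) by (apply lt_0_INR; lia).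
  unfold alt_chord. rewrite <- (csum_alt_identity (fun k => rcpow (chord n k) (- s)) n Hn).
  rewrite <- zeta_cyclic_even, <- zeta_cyclic_half by auto. unfold h.
  rewrite mult_INR. simpl (INR 2). replace (1 + 1) with 2 by ring.
  rewrite (rcpow_mult 2 (INR n)), RtoC_mult by lra.
  unfold Cminus at 2. rewrite rcpow_plus, rcpow_1_r by lra. ring.
Qed.

(** [X] is the fixed point of x |-> r x + L, the limiting form of [h_double]. Hence h n s - X obeys
    the same recursion with an error tending to 0, and [expanding_recursion] applies since |r| =
    2^(1 - Re s) > 1. *)
Lemma h_limit_of_bounded (s eta : C) (B : R) : 0 < Re s < 1 -> Clim (csum (eta_term s)) eta ->
  (forall n, (1 <= n)%nat -> Cmod (h n s) <= B) ->
  Clim (fun n => h n s)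
    (RtoC 2 * rcpow PI (- (s / RtoC 2)) * CGamma (s / RtoC 2) * eta / (RtoC 1 - rcpow 2 (RtoC 1 -
        s)))%C.
Proof.
  intros Hs Heta HB. assert (Hpi := PI_RGT_0).
  set (A := (rcpow (4 * PI) (s / RtoC 2) * CGamma (s / RtoC 2))%C).
  assert (HL := Clim_scal _ A _ (csum_alt_chord_limit s eta (proj1 Hs) Heta)).
  set (r := rcpow 2 (RtoC 1 - s)) in *.
  assert (Hr : 1 < Cmod r).
  { unfold r. rewrite Cmod_rcpow. apply Rle_lt_trans with (Rpower 2 0); [rewrite Rpower_O; lra|].
      apply Rpower_lt; [lra|]. unfold Re in *; simpl; lra. }
  assert (Hr1 : (RtoC 1 - r)%C <> RtoC 0).
  { intros E. assert (E' : r = RtoC 1) by (replace r with (RtoC 1 - (RtoC 1 - r))%C by ring;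
      rewrite E; ring).
    rewrite E', Cmod_1 in Hr. lra. }
  (* The powers of 2 cancel: (4 PI)^(s/2) (2 PI)^(-s) = PI^(-s/2). *)
  assert (EL : (A * (RtoC 2 * (rcpow (2 * PI) (- s) * eta)))%C =
     (RtoC 2 * rcpow PI (- (s / RtoC 2)) * CGamma (s / RtoC 2) * eta)%C).
  { unfold A. rewrite (rcpow_mult 4), rcpow_4, (rcpow_mult 2), !rcpow_opp by lra.
    replace (rcpow PI s) with (rcpow PI (s / RtoC 2) * rcpow PI (s / RtoC 2))%C
      by (rewrite <- rcpow_plus; f_equal; field; apply RtoC_neq_0; lra).
    replace (RtoC 2 * (s / RtoC 2))%C with s by (field; apply RtoC_neq_0; lra).
    field. split; apply rcpow_nonzero. }
  rewrite EL in HL. set (L := (RtoC 2 * rcpow PI (- (s / RtoC 2)) * CGamma (s / RtoC 2) * eta)%C)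
      in *.
  set (X := (L / (RtoC 1 - r))%C).
  assert (EX : (r * X + L = X)%C) by (unfold X; field; auto).
  assert (Hd : Clim (fun n => (h n s - X)%C) (RtoC 0)).
  { apply (expanding_recursion _ (fun n => (A * csum (alt_chord s n) (2 * n - 1) - L)%C) r (B +
      Cmod X)); auto.
    - intros n Hn. eapply Rle_trans; [apply Cmod_triangle|]. rewrite Cmod_opp. generalize (HB n
        Hn). lra.
    - intros n Hn. rewrite h_double by auto. fold r A. rewrite <- EX at 1. ring.
    - replace (RtoC 0) with (L - L)%C by ring. apply Clim_minus; [exact HL | apply Clim_const]. }
  assert (H := Clim_plus _ _ _ _ Hd (Clim_const X)). replace (RtoC 0 + X)%C with X in H by ring.
  revert H. apply Clim_ext. intros n. ring.
Qed.

(** * Heat traces of the cycle and of the line *)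

Definition exp_sum (y : R) (J : nat) : R := sum_n (fun j => y ^ j / INR (fact j)) J.

Lemma exp_sum_S (y : R) (J : nat) : exp_sum y (S J) = exp_sum y J + y ^ S J / INR (fact (S J)).
Proof. apply sum_n_S. Qed.

Lemma exp_sum_limit (y : R) : is_lim_seq (exp_sum y) (exp y).
Proof.
  assert (H := is_exp_Reals y). apply is_pseries_R in H.
  change (is_series (fun j => y ^ j / INR (fact j)) (exp y)). revert H.
  apply (is_series_ext (V := R_NormedModule)). intros n. unfold Rdiv. apply Rmult_comm.
Qed.

(** The remainder of the exponential series at y is dominated term by term by the one at Y. This
    gives uniformity in x when y = t cos(2 PI x). *)
Lemma exp_sum_error (y Y : R) (J : nat) : Rabs y <= Y ->
  Rabs (exp y - exp_sum y J) <= exp Y - exp_sum Y J.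
Proof.
  intros HY.
  assert (A : forall p, Rabs (exp_sum y (J + p) - exp_sum y J) <= exp_sum Y (J + p) - exp_sum Y J).
  { induction p as [|p IH].
    - rewrite Nat.add_0_r, !Rminus_diag, Rabs_R0. lra.
    - rewrite Nat.add_succ_r, !exp_sum_S.
      replace (exp_sum y (J + p) + y ^ S (J + p) / INR (fact (S (J + p))) - exp_sum y J)
        with ((exp_sum y (J + p) - exp_sum y J) + y ^ S (J + p) / INR (fact (S (J + p)))) by ring.
      eapply Rle_trans; [apply Rabs_triang|].
      assert (Rabs (y ^ S (J + p) / INR (fact (S (J + p)))) <= Y ^ S (J + p) / INR (fact (S (J +
          p)))); [|lra].
      assert (Hf : 0 < / INR (fact (S (J + p)))) by (apply Rinv_0_lt_compat, lt_0_INR, lt_O_fact).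
      unfold Rdiv. rewrite Rabs_mult, (Rabs_pos_eq (/ _)) by lra.
      apply Rmult_le_compat_r; [lra|]. rewrite <- RPow_abs. apply pow_incr. split; [apply
          Rabs_pos | auto]. }
  assert (L1 : is_lim_seq (fun p => Rabs (exp_sum y (J + p) - exp_sum y J)) (Rabs (exp y -
      exp_sum y J))).
  { apply (is_lim_seq_abs _ (Finite _)). apply is_lim_seq_minus'; [|apply is_lim_seq_const].
    apply is_lim_seq_ext with (fun p => exp_sum y (p + J)); [intros; f_equal; lia|].
    apply (is_lim_seq_incr_n (exp_sum y)), exp_sum_limit. }
  assert (L2 : is_lim_seq (fun p => exp_sum Y (J + p) - exp_sum Y J) (exp Y - exp_sum Y J)).
  { apply is_lim_seq_minus'; [|apply is_lim_seq_const].
    apply is_lim_seq_ext with (fun p => exp_sum Y (p + J)); [intros; f_equal; lia|].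
    apply (is_lim_seq_incr_n (exp_sum Y)), exp_sum_limit. }
  exact (is_lim_seq_le _ _ _ _ A L1 L2).
Qed.

Lemma continuous_cos_pow (j : nat) (x : R) : continuous (fun x => cos (2 * PI * x) ^ j) x.
Proof. eapply continuous_is_derive. auto_derive; auto. Qed.

(** The moments of the cosine, against which the series of exp(2t cos(2 PI x)) integrates to the
    Bessel series. *)
Definition wallis (j : nat) : R := RInt (fun x => cos (2 * PI * x) ^ j) 0 1.

Lemma is_RInt_wallis (j : nat) : is_RInt (fun x => cos (2 * PI * x) ^ j) 0 1 (wallis j).
Proof. apply (RInt_correct (V := R_CompleteNormedModule)), ex_RInt_cont, continuous_cos_pow. Qed.

Lemma wallis_0 : wallis 0 = 1.
Proof. unfold wallis. simpl. rewrite RInt_const. unfold scal; simpl; unfold mult; simpl. ring. Qed.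

Lemma sin_2PI_0 : sin (2 * PI * 1) = 0.
Proof. replace (2 * PI * 1) with (2 * PI) by ring. apply sin_2PI. Qed.

Lemma wallis_1 : wallis 1 = 0.
Proof.
  assert (Hpi := PI_RGT_0).
  apply (is_RInt_unique (V := R_CompleteNormedModule)).
  replace 0 with (minus (sin (2 * PI * 1) / (2 * PI)) (sin (2 * PI * 0) / (2 * PI))) at 2.
  - apply (is_RInt_derive (V := R_CompleteNormedModule) (fun x => sin (2 * PI * x) / (2 * PI))).
    + intros x _. auto_derive; auto. field. lra.
    + intros x _. apply continuous_cos_pow.
  - rewrite sin_2PI_0, Rmult_0_r, sin_0. unfold minus, plus, opp; simpl. field. lra.
Qed.

(** The derivative of sin(2 PI x) cos(2 PI x)^(j+1) / (2 PI) is (j + 2) cos^(j+2) - (j + 1) cos^j,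
    and its integral over a period vanishes. *)
Lemma wallis_SS (j : nat) : INR (S (S j)) * wallis (S (S j)) = INR (S j) * wallis j.
Proof.
  assert (Hpi := PI_RGT_0).
  assert (H1 : is_RInt (fun x => INR (S (S j)) * cos (2 * PI * x) ^ S (S j) - INR (S j) * cos (2
      * PI * x) ^ j) 0 1
     (INR (S (S j)) * wallis (S (S j)) - INR (S j) * wallis j)).
  { apply (is_RInt_minus (V := R_NormedModule)); apply (is_RInt_scal (V := R_NormedModule));
      apply is_RInt_wallis. }
  assert (H2 : is_RInt (fun x => INR (S (S j)) * cos (2 * PI * x) ^ S (S j) - INR (S j) * cos (2
      * PI * x) ^ j) 0 1
    (minus (sin (2 * PI * 1) * cos (2 * PI * 1) ^ S j / (2 * PI)) (sin (2 * PI * 0) * cos (2 * PI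
        * 0) ^ S j / (2 * PI)))).
  { apply (is_RInt_derive (V := R_CompleteNormedModule) (fun x => sin (2 * PI * x) * cos (2 * PI
      * x) ^ S j / (2 * PI))).
    - intros x _. assert (Hs := sin2_cos2 (2 * PI * x)). unfold Rsqr in Hs.
      assert (E : forall n : R, (n + 1) * cos (2 * PI * x) ^ S (S j) - n * cos (2 * PI * x) ^ j =
        cos (2 * PI * x) * cos (2 * PI * x) ^ S j - n * (sin (2 * PI * x) * sin (2 * PI * x)) *
            cos (2 * PI * x) ^ j).
      { intros n. replace (sin (2 * PI * x) * sin (2 * PI * x)) with (1 - cos (2 * PI * x) * cos
          (2 * PI * x)) by lra. simpl. ring. }
      rewrite (S_INR (S j)), E. auto_derive; auto.
      change (Nat.pred (S j)) with j. rewrite <- !tech_pow_Rmult. change (match j with O => 1 | S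
          _ => INR j + 1 end) with (INR (S j)). generalize (INR (S j)). intros n. field. lra.
    - intros x _. eapply continuous_is_derive. auto_derive; auto. }
  apply (is_RInt_unique (V := R_CompleteNormedModule)) in H1, H2. rewrite H1 in H2.
  rewrite sin_2PI_0, Rmult_0_r, sin_0 in H2.
  match type of H2 with _ = ?r => replace r with 0 in H2; [lra|] end.
  unfold minus, plus, opp; simpl. field. lra.
Qed.

Lemma wallis_odd (k : nat) : wallis (2 * k + 1) = 0.
Proof.
  induction k as [|k IH]; [exact wallis_1|].
  replace (2 * S k + 1)%nat with (S (S (2 * k + 1))) by lia.
  assert (H := wallis_SS (2 * k + 1)). rewrite IH, Rmult_0_r in H.
  apply Rmult_integral in H. destruct H as [H|H]; auto.
  exfalso. revert H. apply not_0_INR. lia.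
Qed.

Lemma wallis_even (k : nat) : wallis (2 * k) * (2 ^ (2 * k) * INR (fact k) ^ 2) = INR (fact (2 *
    k)).
Proof.
  induction k as [|k IH]; [simpl; rewrite wallis_0; ring|].
  replace (2 * S k)%nat with (S (S (2 * k))) by lia.
  assert (H := wallis_SS (2 * k)).
  rewrite !fact_simpl, !mult_INR, <- IH, <- !tech_pow_Rmult.
  assert (E : INR (S (S (2 * k))) = 2 * INR (S k)) by (rewrite !S_INR, mult_INR; simpl; ring).
  transitivity ((2 * INR (S k) * wallis (S (S (2 * k)))) * (2 * INR (S k)) * (2 ^ (2 * k) * INR
      (fact k) ^ 2)); [ring|].
  rewrite <- E, H. ring.
Qed.

Lemma is_RInt_exp_sum_cos (t : R) (J : nat) :
  is_RInt (fun x => exp_sum (t * cos (2 * PI * x)) J) 0 1 (sum_n (fun j => t ^ j / INR (fact j) *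
      wallis j) J).
Proof.
  induction J as [|J IH].
  - rewrite sum_O. apply (is_RInt_ext (V := R_NormedModule) (fun x => scal (t ^ 0 / INR (fact 0))
      (cos (2 * PI * x) ^ 0))).
    + intros x _. unfold exp_sum. rewrite sum_O. unfold scal; simpl; unfold mult; simpl. field.
    + apply (is_RInt_scal (V := R_NormedModule)), is_RInt_wallis.
  - rewrite sum_Sn.
    apply (is_RInt_ext (V := R_NormedModule) (fun x => plus (exp_sum (t * cos (2 * PI * x)) J)
        (scal (t ^ S J / INR (fact (S J))) (cos (2 * PI * x) ^ S J)))).
    + intros x _. rewrite exp_sum_S, Rpow_mult_distr.
      change (exp_sum (t * cos (2 * PI * x)) J + t ^ S J / INR (fact (S J)) * cos (2 * PI * x) ^
          S J =
        exp_sum (t * cos (2 * PI * x)) J + t ^ S J * cos (2 * PI * x) ^ S J / INR (fact (S J))).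
      field. apply INR_fact_neq_0.
    + apply (is_RInt_plus (V := R_NormedModule)); auto.
      apply (is_RInt_scal (V := R_NormedModule)), is_RInt_wallis.
Qed.

Lemma sum_wallis_bessel (t : R) (N : nat) :
  sum_n (fun j => (2 * t) ^ j / INR (fact j) * wallis j) (2 * N + 1) =
  sum_n (fun k => (2 * t / 2) ^ (2 * k) / INR (fact k) ^ 2) N.
Proof.
  assert (T : forall k, (2 * t) ^ (2 * k) / INR (fact (2 * k)) * wallis (2 * k) = (2 * t / 2) ^
      (2 * k) / INR (fact k) ^ 2).
  { intros k. assert (H := wallis_even k). assert (H2 : 2 ^ (2 * k) <> 0) by (apply pow_nonzero;
      lra).
    assert (H3 := INR_fact_neq_0 k). assert (H4 := INR_fact_neq_0 (2 * k)).
    replace (2 * t / 2) with t by field. rewrite Rpow_mult_distr.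
    replace (wallis (2 * k)) with (INR (fact (2 * k)) / (2 ^ (2 * k) * INR (fact k) ^ 2)).
    - field. auto.
    - rewrite <- H. field. auto. }
  induction N as [|N IH].
  - change (2 * 0 + 1)%nat with 1%nat. rewrite sum_n_S, !sum_O, wallis_1, <- (T O). simpl. ring.
  - replace (2 * S N + 1)%nat with (S (S (2 * N + 1))) by lia. rewrite !sum_n_S, IH.
    replace (S (S (2 * N + 1))) with (2 * S N + 1)%nat by lia. rewrite wallis_odd.
    replace (S (2 * N + 1)) with (2 * S N)%nat by lia. rewrite T, Rmult_0_r, Rplus_0_r. reflexivity.
Qed.

(** At tau = 4t this is e^(-t lambda) with lambda = 4 sin^2(PI x): an eigenvalue of the n-cycle for
    x = k / n, while the average over [0, 1] belongs to the line. *)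
Definition heat_cos (tau x : R) : R := exp (- (tau * sin (PI * x) ^ 2)).

Lemma continuous_heat_cos (tau x : R) : continuous (heat_cos tau) x.
Proof. eapply continuous_is_derive. unfold heat_cos. auto_derive; auto. Qed.

(** The exponential series of exp(2t cos(2 PI x)) converges uniformly in x by [exp_sum_error] and is
    integrated term by term; the factor e^(-2t) enters through 1 - cos(2y) = 2 sin^2 y. *)
Lemma BesselI0_integral (t : R) : 0 <= t -> exp (- 2 * t) * BesselI0 (2 * t) = RInt (heat_cos (4
    * t)) 0 1.
Proof.
  intros Ht.
  assert (Hc : forall x, continuous (fun x => exp (2 * t * cos (2 * PI * x))) x).
  { intros x. eapply continuous_is_derive. auto_derive; auto. }
  set (I := RInt (fun x => exp (2 * t * cos (2 * PI * x))) 0 1).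
  assert (HI : is_RInt (fun x => exp (2 * t * cos (2 * PI * x))) 0 1 I)
    by (apply (RInt_correct (V := R_CompleteNormedModule)), ex_RInt_cont, Hc).
  assert (HB : BesselI0 (2 * t) = I).
  { apply is_series_unique.
    change (is_lim_seq (sum_n (fun k => (2 * t / 2) ^ (2 * k) / INR (fact k) ^ 2)) I).
    apply (is_lim_seq_ext (fun N => sum_n (fun j => (2 * t) ^ j / INR (fact j) * wallis j) (2 * N
        + 1))).
    { intros N. apply sum_wallis_bessel. }
    assert (E : forall J, Rabs (I - sum_n (fun j => (2 * t) ^ j / INR (fact j) * wallis j) J) <=
        exp (2 * t) - exp_sum (2 * t) J).
    { intros J. assert (H := is_RInt_minus (V := R_NormedModule) _ _ _ _ _ _ HI
        (is_RInt_exp_sum_cos (2 * t) J)).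
      replace (exp (2 * t) - exp_sum (2 * t) J) with ((exp (2 * t) - exp_sum (2 * t) J) * (1 -
          0)) by ring.
      refine (Rabs_is_RInt_le _ 0 1 _ _ Rle_0_1 _ H). intros x _. apply exp_sum_error.
      rewrite Rabs_mult, (Rabs_pos_eq (2 * t)) by lra.
      apply Rle_trans with (2 * t * 1); [|lra]. apply Rmult_le_compat_l; [lra | apply Rabs_le,
          COS_bound]. }
    apply is_lim_seq_spec. intros eps.
    assert (L := exp_sum_limit (2 * t)). apply is_lim_seq_spec in L. destruct (L eps) as [N HN].
    exists N. intros n Hn. specialize (HN (2 * n + 1)%nat ltac:(lia)).
    rewrite Rabs_minus_sym. eapply Rle_lt_trans; [apply E|].
    rewrite Rabs_minus_sym in HN. eapply Rle_lt_trans; [apply Rle_abs | exact HN]. }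
  rewrite HB. symmetry. apply (is_RInt_unique (V := R_CompleteNormedModule)).
  apply (is_RInt_ext (V := R_NormedModule) (fun x => scal (exp (- 2 * t)) (exp (2 * t * cos (2 *
      PI * x))))).
  - intros x _. change (exp (- 2 * t) * exp (2 * t * cos (2 * PI * x)) = heat_cos (4 * t) x).
    unfold heat_cos. rewrite <- exp_plus. f_equal.
    replace (2 * PI * x) with (2 * (PI * x)) by ring. rewrite cos_2a_sin. ring.
  - apply (is_RInt_scal (V := R_NormedModule)). exact HI.
Qed.

Lemma heat_cos_bounds (tau x : R) : 0 <= tau -> 0 < heat_cos tau x <= 1.
Proof.
  intros Ht. split; [apply exp_pos|]. rewrite <- exp_0. apply exp_le_compat.
  assert (0 <= tau * sin (PI * x) ^ 2) by (apply Rmult_le_pos; [auto | apply pow2_ge_0]). lra.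
Qed.

Lemma heat_cos_sym (tau x : R) : heat_cos tau (1 - x) = heat_cos tau x.
Proof.
  unfold heat_cos. do 4 f_equal. rewrite <- sin_PI_x. f_equal. ring.
Qed.

Lemma heat_cos_decr (tau x y : R) : 0 <= tau -> 0 <= x <= y -> y <= 1 / 2 -> heat_cos tau y <=
    heat_cos tau x.
Proof.
  intros Ht Hx Hy. unfold heat_cos. apply exp_le_compat. apply Ropp_le_contravar.
  apply Rmult_le_compat_l; auto. apply pow_incr. assert (Hpi := PI_RGT_0). split.
  - apply sin_ge_0; nra.
  - apply sin_incr_1; nra.
Qed.

Lemma heat_cos_incr (tau x y : R) : 0 <= tau -> 1 / 2 <= x <= y -> y <= 1 -> heat_cos tau x <=
    heat_cos tau y.
Proof.
  intros Ht Hx Hy. rewrite <- (heat_cos_sym tau x), <- (heat_cos_sym tau y). apply heat_cos_decr;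
      lra.
Qed.

(* Total variation of heat_cos tau over [0, x]. *)
Definition heat_cos_var (tau x : R) : R :=
  if Rle_dec x (1 / 2) then 1 - heat_cos tau x else 1 - 2 * heat_cos tau (1 / 2) + heat_cos tau x.

Lemma heat_cos_var_spec (tau x y : R) : 0 <= tau -> 0 <= x <= y -> y <= 1 ->
  Rabs (heat_cos tau y - heat_cos tau x) <= heat_cos_var tau y - heat_cos_var tau x.
Proof.
  intros Ht Hx Hy. unfold heat_cos_var. destruct (Rle_dec x (1 / 2)) as [H1|H1], (Rle_dec y (1 /
      2)) as [H2|H2].
  - assert (H := heat_cos_decr tau x y Ht Hx H2). rewrite Rabs_left1; lra.
  - assert (A := heat_cos_decr tau x (1 / 2) Ht ltac:(lra) ltac:(lra)).
    assert (B := heat_cos_incr tau (1 / 2) y Ht ltac:(lra) ltac:(lra)). apply Rabs_le. lra.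
  - lra.
  - assert (H := heat_cos_incr tau x y Ht ltac:(lra) ltac:(lra)). rewrite Rabs_pos_eq; lra.
Qed.

(** On [0, 1/2], Jordan's inequality and e^(-u) <= 1 / (1 + u) reduce the integrand to the
    derivative of an arctangent; the other half follows by symmetry. *)
Lemma RInt_heat_cos_le (tau : R) : 0 < tau -> RInt (heat_cos tau) 0 1 <= 2 / sqrt tau.
Proof.
  intros Ht. assert (Hs := sqrt_lt_R0 tau Ht). set (r := sqrt tau) in *.
  assert (Er : r * r = tau) by (apply sqrt_sqrt; lra).
  assert (Hex : forall a b, ex_RInt (heat_cos tau) a b) by (intros; apply ex_RInt_cont,
      continuous_heat_cos).
  assert (Hhalf : RInt (heat_cos tau) 0 (1 / 2) <= 1 / r).
  { assert (Hat : is_RInt (fun x => / (1 + (2 * r * x) ^ 2)) 0 (1 / 2) (minus (atan (2 * r * (1 /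
      2)) / (2 * r)) (atan (2 * r * 0) / (2 * r)))).
    { apply (is_RInt_derive (V := R_CompleteNormedModule) (fun x => atan (2 * r * x) / (2 * r))).
      - intros x _. auto_derive; auto. simpl. field. split; nra.
      - intros x _. eapply continuous_is_derive. auto_derive; auto. apply Rgt_not_eq. nra. }
    apply Rle_trans with (RInt (fun x => / (1 + (2 * r * x) ^ 2)) 0 (1 / 2)).
    - apply RInt_le; auto; [lra | eexists; exact Hat|]. intros x Hx. unfold heat_cos.
      eapply Rle_trans; [apply exp_opp_le; apply Rmult_le_pos; [lra | apply pow2_ge_0]|].
      apply Rinv_le_contravar; [nra|]. apply Rplus_le_compat_l.
      replace ((2 * r * x) ^ 2) with (tau * (2 * x) ^ 2) by (rewrite <- Er; ring).
      apply Rmult_le_compat_l; [lra|]. apply pow_incr. split; [lra | apply sin_PI_ge; lra].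
    - rewrite (is_RInt_unique (V := R_CompleteNormedModule) _ _ _ _ Hat).
      rewrite Rmult_0_r, atan_0. unfold minus, plus, opp; simpl.
      assert (Hb := atan_bound (2 * r * (1 / 2))). assert (Hp := PI_4).
      apply Rle_trans with (2 / (2 * r)); [|right; field; lra].
      unfold Rdiv at 3. rewrite Rmult_0_l, Ropp_0, Rplus_0_r.
      apply Rmult_le_compat_r; [left; apply Rinv_0_lt_compat; lra | lra]. }
  assert (Hsym : RInt (heat_cos tau) (1 / 2) 1 = RInt (heat_cos tau) 0 (1 / 2)).
  { assert (HI := RInt_correct (V := R_CompleteNormedModule) _ _ _ (Hex 0 (1 / 2))).
    apply (is_RInt_swap (V := R_NormedModule)) in HI.
    replace 0 with (-1 * 1 + 1) in HI at 1 by ring. replace (1 / 2) with (-1 * (1 / 2) + 1) in HI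
        at 1 by field.
    apply (is_RInt_comp_lin (V := R_NormedModule)) in HI.
    apply (is_RInt_opp (V := R_NormedModule)) in HI. rewrite opp_opp in HI.
    apply (is_RInt_unique (V := R_CompleteNormedModule)). revert HI.
    apply (is_RInt_ext (V := R_NormedModule)). intros x _.
    rewrite <- (heat_cos_sym tau x). replace (-1 * x + 1) with (1 - x) by ring.
    change (- (-1 * heat_cos tau (1 - x)) = heat_cos tau (1 - x)). ring. }
  rewrite <- (RInt_Chasles (V := R_CompleteNormedModule) (heat_cos tau) 0 (1 / 2) 1) by auto.
  rewrite Hsym. change (RInt (heat_cos tau) 0 (1 / 2) + RInt (heat_cos tau) 0 (1 / 2) <= 2 / r).
  unfold Rdiv in *. lra.
Qed.

Fixpoint heat_sum (tau : R) (n m : nat) : R :=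
  match m with
  | O => 0
  | S k => heat_sum tau n k + heat_cos tau (INR (S k) / INR n)
  end.

Lemma heat_sum_S (tau : R) (n k : nat) :
  heat_sum tau n (S k) = heat_sum tau n k + heat_cos tau (INR (S k) / INR n).
Proof. reflexivity. Qed.

(** A left Riemann sum misses the integral on each cell by at most the variation there. The total
    variation is at most 2 whatever tau and n are, because the function falls once and rises
    once. *)
Lemma heat_sum_RInt (tau : R) (n : nat) : 0 <= tau -> (1 <= n)%nat ->
  Rabs (heat_sum tau n (n - 1) - INR n * RInt (heat_cos tau) 0 1) <= 3.
Proof.
  intros Ht Hn. assert (Hn1 : 1 <= INR n) by (apply le_INR in Hn; auto).
  assert (Hex : forall a b, ex_RInt (heat_cos tau) a b) by (intros; apply ex_RInt_cont,
      continuous_heat_cos).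
  assert (Hin : 0 < / INR n) by (apply Rinv_0_lt_compat; lra).
  assert (Hcell : forall k, (k < n)%nat ->
    Rabs (heat_cos tau (INR k / INR n) - INR n * RInt (heat_cos tau) (INR k / INR n) (INR (S k) /
        INR n))
      <= heat_cos_var tau (INR (S k) / INR n) - heat_cos_var tau (INR k / INR n)).
  { intros k Hk. assert (Hk0 := pos_INR k). apply le_INR in Hk. rewrite S_INR in *.
    set (a := INR k / INR n). replace ((INR k + 1) / INR n) with (a + / INR n) by (unfold a;
        field; lra).
    assert (Ha : 0 <= a) by (apply Rdiv_le_0_compat; lra).
    assert (Ha1 : a + / INR n <= 1).
    { replace (a + / INR n) with ((INR k + 1) / INR n) by (unfold a; field; lra). apply
        Rle_div_l; lra. }
    assert (HI := is_RInt_minus (V := R_NormedModule) _ _ _ _ _ _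
      (is_RInt_const (V := R_NormedModule) a (a + / INR n) (heat_cos tau a))
      (RInt_correct (V := R_CompleteNormedModule) _ _ _ (Hex a (a + / INR n)))).
    apply (Rabs_is_RInt_le _ _ _ _ (heat_cos_var tau (a + / INR n) - heat_cos_var tau a)) in HI;
        [|lra|].
    - set (J := RInt (heat_cos tau) a (a + / INR n)) in *.
      change (Rabs ((a + / INR n - a) * heat_cos tau a + - J) <= (heat_cos_var tau (a + / INR n)
          - heat_cos_var tau a) * (a + / INR n - a)) in HI.
      replace (a + / INR n - a) with (/ INR n) in HI by ring.
      replace (heat_cos tau a - INR n * J) with (INR n * (/ INR n * heat_cos tau a + - J)) by
          (field; lra).
      rewrite Rabs_mult, (Rabs_pos_eq (INR n)) by lra.
      apply (Rmult_le_compat_l (INR n)) in HI; [|lra].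
      replace (INR n * ((heat_cos_var tau (a + / INR n) - heat_cos_var tau a) * / INR n)) with
          (heat_cos_var tau (a + / INR n) - heat_cos_var tau a) in HI by (field; lra).
      exact HI.
    - intros x Hx. change (Rabs (heat_cos tau a + - heat_cos tau x) <= heat_cos_var tau (a + /
        INR n) - heat_cos_var tau a).
      rewrite <- Rabs_Ropp. replace (- (heat_cos tau a + - heat_cos tau x)) with (heat_cos tau x
          - heat_cos tau a) by ring.
      assert (H1 := heat_cos_var_spec tau a x Ht ltac:(lra) ltac:(lra)).
      assert (H2 := heat_cos_var_spec tau x (a + / INR n) Ht ltac:(lra) ltac:(lra)).
      generalize (Rabs_pos (heat_cos tau (a + / INR n) - heat_cos tau x)). lra. }
  (* The 1 is the value at k = 0, which [heat_sum] omits; giving it up at the end turns the bound 2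
     into 3. *)
  assert (A : forall m, (m < n)%nat ->
    Rabs (1 + heat_sum tau n m - INR n * RInt (heat_cos tau) 0 (INR (S m) / INR n)) <=
        heat_cos_var tau (INR (S m) / INR n) - heat_cos_var tau 0).
  { assert (H0 : heat_cos tau 0 = 1) by (unfold heat_cos; rewrite Rmult_0_r, sin_0; replace (-
      (tau * 0 ^ 2)) with 0 by ring; apply exp_0).
    induction m as [|m IH]; intros Hm.
    - assert (H := Hcell O Hm). simpl INR in *. unfold Rdiv in H at 1 2 4. rewrite !Rmult_0_l, H0
        in H.
      replace (1 + heat_sum tau n 0) with 1 by (simpl; ring).
      unfold Rdiv in H. rewrite Rmult_0_l in H. exact H.
    - specialize (IH ltac:(lia)). assert (H := Hcell (S m) Hm). rewrite heat_sum_S.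
      rewrite <- (RInt_Chasles (V := R_CompleteNormedModule) (heat_cos tau) 0 (INR (S m) / INR n)
          (INR (S (S m)) / INR n)) by auto.
      set (J1 := RInt (heat_cos tau) 0 _) in *. set (J2 := RInt (heat_cos tau) (INR (S m) / INR
          n) _) in *.
      change (plus J1 J2) with (J1 + J2).
      replace (1 + (heat_sum tau n m + heat_cos tau (INR (S m) / INR n)) - INR n * (J1 + J2)) with
        ((1 + heat_sum tau n m - INR n * J1) + (heat_cos tau (INR (S m) / INR n) - INR n * J2))
            by ring.
      eapply Rle_trans; [apply Rabs_triang|]. lra. }
  assert (H := A (n - 1)%nat ltac:(lia)). replace (S (n - 1)) with n in H by lia.
  replace (INR n / INR n) with 1 in H by (field; lra).
  assert (Hv : heat_cos_var tau 1 - heat_cos_var tau 0 <= 2).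
  { unfold heat_cos_var. destruct (Rle_dec 1 (1 / 2)); [lra|]. destruct (Rle_dec 0 (1 / 2)); [|lra].
    assert (B0 := heat_cos_bounds tau 0 Ht). assert (B1 := heat_cos_bounds tau 1 Ht). assert (B2
        := heat_cos_bounds tau (1 / 2) Ht). lra. }
  assert (H' : Rabs (1 + heat_sum tau n (n - 1) - INR n * RInt (heat_cos tau) 0 1) <= 2) by lra.
  apply Rabs_le_between in H'. apply Rabs_le. lra.
Qed.

(** For k <= n/2 Jordan's inequality and PI <= 4 bound the term by e^(-v k^2), hence by 1 / (v (k^2
    - 1/4)), which telescopes as a difference of 1 / (k - 1/2) and 1 / (k + 1/2). The reflection k
    |-> n - k treats the rest, and each half contributes at most 2 / v. *)
Lemma heat_sum_le (v : R) (n : nat) : 0 < v -> (1 <= n)%nat ->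
  0 <= heat_sum (INR n ^ 2 * v / PI) n (n - 1) <= 4 / v.
Proof.
  intros Hv Hn. assert (Hn1 : 1 <= INR n) by (apply le_INR in Hn; auto).
  assert (Hpi := PI_RGT_0). assert (Hpi4 := PI_4).
  set (tau := INR n ^ 2 * v / PI).
  assert (Htau : 0 < tau) by (apply Rdiv_lt_0_compat; [apply Rmult_lt_0_compat; [apply pow_lt;
      lra | auto] | auto]).
  assert (Hone : forall k, (1 <= k)%nat -> 2 * INR k <= INR n -> heat_cos tau (INR k / INR n) <=
      / v * (/ (INR k - 1 / 2) - / (INR k + 1 / 2))).
  { intros k Hk Hkn. apply le_INR in Hk. simpl in Hk.
    assert (Hsin : 2 * (INR k / INR n) <= sin (PI * (INR k / INR n))).
    { apply sin_PI_ge. split; [apply Rdiv_le_0_compat; lra | apply Rle_div_l; lra]. }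
    assert (Hq : 0 < INR k / INR n) by (apply Rdiv_lt_0_compat; lra).
    assert (Hk2 : 0 < v * INR k ^ 2) by (apply Rmult_lt_0_compat; [auto | apply pow_lt; lra]).
    unfold heat_cos. apply Rle_trans with (exp (- (v * INR k ^ 2))).
    - apply exp_le_compat, Ropp_le_contravar.
      apply Rle_trans with (tau * (2 * (INR k / INR n)) ^ 2).
      + replace (tau * (2 * (INR k / INR n)) ^ 2) with (v * INR k ^ 2 * (4 / PI)) by (unfold tau;
          field; lra).
        apply Rle_trans with (v * INR k ^ 2 * 1); [lra|]. apply Rmult_le_compat_l; [lra|].
        apply Rle_div_r; lra.
      + apply Rmult_le_compat_l; [lra|]. apply pow_incr. lra.
    - eapply Rle_trans; [apply exp_opp_le; lra|].
      replace (/ v * (/ (INR k - 1 / 2) - / (INR k + 1 / 2))) with (/ (v * (INR k ^ 2 - 1 / 4)))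
          by (field; repeat split; nra).
      apply Rinv_le_contravar; [apply Rmult_lt_0_compat; nra | nra]. }
  assert (Hiv : 0 < / v) by (apply Rinv_0_lt_compat; auto).
  assert (Hpos : forall k : R, 1 <= k -> 0 <= / (k - 1 / 2) - / (k + 1 / 2)).
  { intros k Hk. assert (/ (k + 1 / 2) <= / (k - 1 / 2)) by (apply Rinv_le_contravar; lra). lra. }
  assert (Hterm : forall k, (1 <= k)%nat -> (k < n)%nat -> heat_cos tau (INR k / INR n) <=
     / v * (/ (INR k - 1 / 2) - / (INR k + 1 / 2)) + / v * (/ (INR n - INR k - 1 / 2) - / (INR n
         - INR k + 1 / 2))).
  { intros k Hk Hkn. assert (Hk1 := le_INR _ _ Hk). simpl in Hk1.
    assert (Hkn1 : INR k + 1 <= INR n) by (rewrite <- S_INR; apply le_INR; lia).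
    assert (P1 := Hpos (INR k) Hk1). assert (P2 := Hpos (INR n - INR k) ltac:(lra)).
    apply (Rmult_le_compat_l (/ v)) in P1, P2; try lra. rewrite Rmult_0_r in P1, P2.
    destruct (Rle_dec (2 * INR k) (INR n)) as [H|H].
    - assert (H1 := Hone k Hk H). lra.
    - assert (H1 := Hone (n - k)%nat ltac:(lia)). rewrite minus_INR in H1 by lia. specialize (H1
        ltac:(lra)).
      rewrite <- (heat_cos_sym tau (INR k / INR n)). replace (1 - INR k / INR n) with ((INR n -
          INR k) / INR n) by (field; lra). lra. }
  assert (A : forall m, (m < n)%nat -> 0 <= heat_sum tau n m <= / v * (2 - / (INR m + 1 / 2)) + /
      v * (/ (INR n - INR m - 1 / 2) - / (INR n - 1 / 2))).
  { induction m as [|m IH]; intros Hm.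
    - simpl INR. simpl heat_sum. split; [lra|]. right.
      replace (2 - / (0 + 1 / 2)) with 0 by field. replace (INR n - 0 - 1 / 2) with (INR n - 1 /
          2) by ring. ring.
    - specialize (IH ltac:(lia)). rewrite heat_sum_S. assert (Ht := Hterm (S m) ltac:(lia) Hm).
      assert (Hb := heat_cos_bounds tau (INR (S m) / INR n) ltac:(lra)).
      split; [lra|]. rewrite S_INR in *.
      replace (INR m + 1 - 1 / 2) with (INR m + 1 / 2) in Ht by field.
      replace (INR n - (INR m + 1) + 1 / 2) with (INR n - INR m - 1 / 2) in Ht by field.
      lra. }
  assert (H := A (n - 1)%nat ltac:(lia)). split; [lra|].
  rewrite minus_INR in H by auto. simpl (INR 1) in H.
  replace (INR n - (INR n - 1) - 1 / 2) with (1 / 2) in H by field.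
  assert (0 < / (INR n - 1 + 1 / 2)) by (apply Rinv_0_lt_compat; lra).
  assert (0 < / (INR n - 1 / 2)) by (apply Rinv_0_lt_compat; lra).
  replace (/ (1 / 2)) with 2 in H by field.
  assert (0 <= / v * / (INR n - 1 + 1 / 2)) by (apply Rmult_le_pos; lra).
  assert (0 <= / v * / (INR n - 1 / 2)) by (apply Rmult_le_pos; lra).
  unfold Rdiv. lra.
Qed.

(** * Mellin transforms of the heat traces and the bound on h *)

Lemma is_RInt_0_infty_0 : is_RInt_0_infty (fun _ => RtoC 0) (RtoC 0).
Proof.
  apply is_RInt_0_infty_eps. intros eps Heps. exists 1, 1. repeat split; try lra.
  intros a b Ha Hb. exists (RtoC 0). split.
  - assert (H := is_RInt_const (V := C_R_CompleteNormedModule) a b (RtoC 0)).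
    rewrite scal_R_Cmult in H. replace (RtoC (b - a) * RtoC 0)%C with (RtoC 0) in H by ring.
        exact H.
  - replace (RtoC 0 - RtoC 0)%C with (RtoC 0) by ring. rewrite Cmod_0. auto.
Qed.

Lemma is_RInt_0_infty_csum (f : nat -> R -> C) (l : nat -> C) (n : nat) :
  (forall k, (k < n)%nat -> is_RInt_0_infty (f k) (l k)) ->
  is_RInt_0_infty (fun t => csum (fun k => f k t) n) (csum l n).
Proof.
  induction n as [|n IH]; intros H; [exact is_RInt_0_infty_0|].
  apply is_RInt_0_infty_plus; auto.
Qed.

Lemma is_RInt_0_infty_bound (f : R -> C) (l : C) (K al be : R) : 0 < al -> 0 < be ->
  (forall t, 0 < t -> continuous (U := C_R_NormedModule) f t) ->
  (forall t, 0 < t <= 1 -> Cmod (f t) <= K * Rpower t (al - 1)) ->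
  (forall t, 1 <= t -> Cmod (f t) <= K * Rpower t (- be - 1)) ->
  is_RInt_0_infty f l -> Cmod l <= K * (/ al + / be).
Proof.
  intros Hal Hbe Hc H0 H1 Hl.
  destruct (is_RInt_0_infty_ex f K al be Hal Hbe Hc H0 H1) as (l' & Hl' & HB).
  rewrite (is_RInt_0_infty_inj _ _ _ Hl Hl'). exact HB.
Qed.

Lemma continuous_Rabs_bound (f : R -> R) (t M : R) : 0 <= M ->
  locally t (fun u => Rabs (f u - f t) <= M * Rabs (u - t)) -> continuous f t.
Proof.
  intros HM HL. apply continuity_pt_filterlim, continuity_pt_locally. intros eps.
  assert (He : 0 < eps / (M + 1)) by (apply Rdiv_lt_0_compat; [apply cond_pos | lra]).
  destruct HL as [d Hd]. assert (Hmin : 0 < Rmin d (eps / (M + 1))) by (apply Rmin_glb_lt; [apply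
      cond_pos | auto]).
  exists (mkposreal _ Hmin). intros u Hu.
  assert (Hu' : Rabs (u - t) < Rmin d (eps / (M + 1))) by exact Hu.
  eapply Rle_lt_trans; [apply Hd|].
  - apply ball_R. eapply Rlt_le_trans; [exact Hu' | apply Rmin_l].
  - assert (Hu2 : Rabs (u - t) < eps / (M + 1)) by (eapply Rlt_le_trans; [exact Hu' | apply
      Rmin_r]).
    apply Rlt_div_r in Hu2; [|lra]. generalize (Rabs_pos (u - t)). lra.
Qed.

Lemma exp_opp_lipschitz (a b : R) : 0 <= a -> 0 <= b -> Rabs (exp (- a) - exp (- b)) <= Rabs (a -
    b).
Proof.
  assert (A : forall x y, 0 <= x <= y -> Rabs (exp (- y) - exp (- x)) <= 1 * (y - x)).
  { intros x y Hxy. apply (Rabs_increment_le (fun t => exp (- t)) (fun t => - exp (- t))); [lra| |].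
    - intros t _. auto_derive; auto. ring.
    - intros t Ht. rewrite Rabs_Ropp, Rabs_pos_eq by (left; apply exp_pos).
      rewrite <- exp_0. apply exp_le_compat. lra. }
  intros Ha Hb. destruct (Rle_dec a b) as [H|H].
  - rewrite (Rabs_minus_sym a b), (Rabs_minus_sym (exp _)), (Rabs_pos_eq (b - a)) by lra.
    assert (H1 := A a b ltac:(lra)). lra.
  - rewrite (Rabs_pos_eq (a - b)) by lra. assert (H1 := A b a ltac:(lra)). lra.
Qed.

Definition heat_trace (tau : R) : R := RInt (heat_cos tau) 0 1.

Lemma is_RInt_heat_trace (tau : R) : is_RInt (heat_cos tau) 0 1 (heat_trace tau).
Proof. apply (RInt_correct (V := R_CompleteNormedModule)), ex_RInt_cont, continuous_heat_cos. Qed.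

Lemma heat_trace_bounds (tau : R) : 0 <= tau -> 0 <= heat_trace tau <= 1.
Proof.
  intros Ht. assert (Hex : ex_RInt (heat_cos tau) 0 1) by (eexists; apply is_RInt_heat_trace).
      split.
  - apply RInt_ge_0; auto; [lra|]. intros x _. left; apply heat_cos_bounds; auto.
  - replace 1 with (RInt (fun _ => 1) 0 1) by (rewrite RInt_const; unfold scal; simpl; unfold
      mult; simpl; ring).
    apply RInt_le; auto; [lra | apply ex_RInt_const|]. intros x _. apply heat_cos_bounds; auto.
Qed.

Lemma continuous_heat_trace (tau : R) : 0 < tau -> continuous heat_trace tau.
Proof.
  intros Ht. apply continuous_Rabs_bound with 1; [lra|].
  exists (mkposreal tau Ht). intros u Hu.
  assert (Hu' : Rabs (u - tau) < tau) by exact Hu.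
  apply Rabs_def2 in Hu'.
  assert (HI := is_RInt_minus (V := R_NormedModule) _ _ _ _ _ _ (is_RInt_heat_trace u)
      (is_RInt_heat_trace tau)).
  replace (1 * Rabs (u - tau)) with (1 * Rabs (u - tau) * (1 - 0)) by ring.
  refine (Rabs_is_RInt_le _ 0 1 _ _ Rle_0_1 _ HI). intros x _.
  change (Rabs (heat_cos u x - heat_cos tau x) <= 1 * Rabs (u - tau)). unfold heat_cos.
  assert (Hs : 0 <= sin (PI * x) ^ 2 <= 1).
  { split; [apply pow2_ge_0|]. assert (H := SIN_bound (PI * x)). nra. }
  eapply Rle_trans; [apply exp_opp_lipschitz; apply Rmult_le_pos; lra|].
  replace (u * sin (PI * x) ^ 2 - tau * sin (PI * x) ^ 2) with (sin (PI * x) ^ 2 * (u - tau)) by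
      ring.
  rewrite Rabs_mult, (Rabs_pos_eq (sin _ ^ 2)) by lra.
  apply Rmult_le_compat_r; [apply Rabs_pos | lra].
Qed.

Lemma div_sqrt_Rpower (t : R) : 0 < t -> / sqrt t = Rpower t (- (1 / 2)).
Proof.
  intros Ht. rewrite Rpower_Ropp. f_equal. replace (1 / 2) with (/ 2) by field. rewrite
      Rpower_sqrt; auto.
Qed.

(** The trace is bounded near 0 and O(t^(-1/2)) at infinity, which is where the two ends of the
    strip come from. *)
Lemma is_RInt_heat_trace_mellin (z : C) : 0 < Re z < 1 / 2 ->
  is_RInt_0_infty (fun t => RtoC (heat_trace (4 * t)) * rcpow t (z - RtoC 1))%C (CGamma z *
      zeta_Z z)%C.
Proof.
  intros Hz.
  destruct (is_RInt_0_infty_ex (fun t => RtoC (heat_trace (4 * t)) * rcpow t (z - RtoC 1))%C 1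
      (Re z) (1 / 2 - Re z))
    as (l & Hl & _); try lra.
  - intros t Ht. apply continuous_Cmult; [|apply continuous_rcpow; auto].
    apply (continuous_RtoC (fun t => heat_trace (4 * t))).
    apply (continuous_comp (U := R_UniformSpace) (V := R_UniformSpace) (W := R_UniformSpace) (fun
        t => 4 * t) heat_trace).
    + eapply continuous_is_derive. auto_derive; auto.
    + apply continuous_heat_trace. lra.
  - intros t Ht. assert (Hb := heat_trace_bounds (4 * t) ltac:(lra)).
    rewrite Cmod_mult, Cmod_RtoC_pos, Cmod_rcpow by lra.
    apply Rmult_le_compat_r; [left; apply Rpower_pos | lra].
  - intros t Ht. assert (Hb := heat_trace_bounds (4 * t) ltac:(lra)).
    rewrite Cmod_mult, Cmod_RtoC_pos, Cmod_rcpow, Rmult_1_l by lra.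
    replace (- (1 / 2 - Re z) - 1) with (- (1 / 2) + (Re z - 1)) by ring. rewrite Rpower_plus, <-
        div_sqrt_Rpower by lra.
    apply Rmult_le_compat_r; [left; apply Rpower_pos|].
    eapply Rle_trans; [apply RInt_heat_cos_le; lra|].
    replace (4 * t) with (2 ^ 2 * t) by ring. rewrite sqrt_mult, sqrt_pow2 by lra.
    right. field. apply Rgt_not_eq, sqrt_lt_R0. lra.
  - replace (CGamma z * zeta_Z z)%C with l; auto.
    unfold zeta_Z. rewrite (is_RInt_0_infty_unique _ l).
    (* [zeta_Z] divides by Gamma, so clearing the denominator relies on the absence of zeros. *)
    + field. apply CGamma_nonzero. lra.
    + revert Hl. apply is_RInt_0_infty_ext. intros t Ht. unfold heat_trace.
      rewrite <- BesselI0_integral by lra. rewrite rcpow_minus, rcpow_1_r by auto.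
      unfold Cdiv. ring.
Qed.

(** The substitution t = n^2 v / (4 PI) produces, at z = s/2, exactly the prefactor (4 PI)^(s/2)
    n^(-s) of [h]. *)
Lemma is_RInt_zeta_Z_scaled (z : C) (n : nat) : 0 < Re z < 1 / 2 -> (1 <= n)%nat ->
  is_RInt_0_infty (fun v => RtoC (heat_trace (INR n ^ 2 * v / PI)) * rcpow v (z - RtoC 1))%C
    (rcpow (4 * PI) z * rcpow (INR n) (- (RtoC 2 * z)) * (CGamma z * zeta_Z z))%C.
Proof.
  intros Hz Hn. assert (Hn0 : 0 < INR n) by (apply lt_0_INR; lia). assert (Hpi := PI_RGT_0).
  assert (Hn2 : 0 < INR n ^ 2) by (apply pow_lt; auto).
  set (lam := INR n ^ 2 * / (4 * PI)).
  assert (Hip : 0 < / (4 * PI)) by (apply Rinv_0_lt_compat; lra).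
  assert (Hlam : 0 < lam) by (apply Rmult_lt_0_compat; auto).
  assert (H := is_RInt_0_infty_scal _ (rcpow lam (- z)) _
    (is_RInt_0_infty_comp_scal _ lam _ Hlam (is_RInt_heat_trace_mellin z Hz))).
  replace (rcpow (4 * PI) z * rcpow (INR n) (- (RtoC 2 * z)))%C with (rcpow lam (- z)).
  - revert H. apply is_RInt_0_infty_ext. intros t Ht. cbv beta.
    replace (4 * (lam * t)) with (INR n ^ 2 * t / PI) by (unfold lam; field; lra).
    rewrite rcpow_mult by assumption. rewrite (rcpow_minus lam), rcpow_1_r, rcpow_opp by assumption.
    field. split; [apply RtoC_neq_0; lra | apply rcpow_nonzero].
  - unfold lam. rewrite rcpow_mult, rcpow_inv, rcpow_pow2 by lra.
    rewrite (rcpow_opp (4 * PI)). replace (RtoC 2 * - z)%C with (- (RtoC 2 * z))%C by ring.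
    field. apply rcpow_nonzero.
Qed.

Lemma sin_fraction_pos (k n : nat) : (0 < k < n)%nat -> 0 < sin (PI * INR k / INR n).
Proof.
  intros [Hk Hn]. assert (Hpi := PI_RGT_0). apply lt_INR in Hk, Hn. simpl in Hk.
  assert (H : 0 < INR k / INR n < 1) by (split; [apply Rdiv_lt_0_compat; lra | apply Rlt_div_l;
      lra]).
  replace (PI * INR k / INR n) with (PI * (INR k / INR n)) by (field; lra).
  apply sin_gt_0; nra.
Qed.

Lemma is_RInt_zeta_cyclic (z : C) (n : nat) : 0 < Re z -> (1 <= n)%nat ->
  is_RInt_0_infty (fun v => csum (fun k => RtoC (heat_cos (INR n ^ 2 * v / PI) (INR (S k) / INR
      n)) * rcpow v (z - RtoC 1))%C (n - 1))
    (rcpow (4 * PI) z * rcpow (INR n) (- (RtoC 2 * z)) * (CGamma z * zeta_cyclic n z))%C.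
Proof.
  intros Hz Hn. assert (Hn0 : 0 < INR n) by (apply lt_0_INR; lia). assert (Hpi := PI_RGT_0).
  set (lam := fun k => INR n ^ 2 / PI * sin (PI * INR (S k) / INR n) ^ 2).
  replace (rcpow (4 * PI) z * rcpow (INR n) (- (RtoC 2 * z)) * (CGamma z * zeta_cyclic n z))%C
    with (csum (fun k => CGamma z * rcpow (lam k) (- z))%C (n - 1)).
  - apply (is_RInt_0_infty_csum (fun k v => RtoC (heat_cos (INR n ^ 2 * v / PI) (INR (S k) / INR
      n)) * rcpow v (z - RtoC 1))%C).
    intros k Hk.
    assert (Hsin := sin_fraction_pos (S k) n ltac:(lia)).
    assert (Hl : 0 < lam k).
    { unfold lam. apply Rmult_lt_0_compat; [apply Rdiv_lt_0_compat; auto; apply pow_lt; auto |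
        apply pow_lt; auto]. }
    assert (H := is_RInt_CGamma_scal (lam k) z Hl Hz). revert H. apply is_RInt_0_infty_ext.
    intros t Ht. do 2 f_equal. unfold heat_cos. f_equal. unfold lam.
    replace (PI * (INR (S k) / INR n)) with (PI * INR (S k) / INR n) by (field; lra). field. lra.
  - unfold zeta_cyclic. rewrite sum_n_m_csum, csum_scal.
    transitivity (CGamma z * (rcpow (4 * PI) z * rcpow (INR n) (- (RtoC 2 * z)) * / rcpow 4 z *
        csum (fun k => / rcpow (sin (PI * INR (S k) / INR n)) (RtoC 2 * z)) (n - 1)))%C; [|ring].
    f_equal. rewrite <- csum_scal. apply csum_ext. intros k Hk.
    assert (Hsin := sin_fraction_pos (S k) n ltac:(lia)).
    unfold lam. assert (Hp2 : 0 < INR n ^ 2) by (apply pow_lt; auto).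
    assert (Hs2 : 0 < sin (PI * INR (S k) / INR n) ^ 2) by (apply pow_lt; auto).
    assert (Hip : 0 < / PI) by (apply Rinv_0_lt_compat; lra).
    unfold Rdiv at 1. rewrite (rcpow_mult (INR n ^ 2 * / PI)), (rcpow_mult (INR n ^ 2)),
        rcpow_inv, !rcpow_pow2, (rcpow_mult 4) by first [assumption | lra | apply
        Rmult_lt_0_compat; assumption].
    replace (RtoC 2 * - z)%C with (- (RtoC 2 * z))%C by ring. rewrite !rcpow_opp.
    field. repeat split; apply rcpow_nonzero.
Qed.

Lemma csum_heat_cos (tau : R) (n m : nat) (c : C) :
  csum (fun k => RtoC (heat_cos tau (INR (S k) / INR n)) * c)%C m = (RtoC (heat_sum tau n m) * c)%C.
Proof.
  induction m as [|m IH]; [simpl; ring|]. rewrite csum_S, IH, heat_sum_S, RtoC_plus. ring.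
Qed.

Definition heat_defect (n : nat) (v : R) : R :=
  heat_sum (INR n ^ 2 * v / PI) n (n - 1) - INR n * heat_trace (INR n ^ 2 * v / PI).

Lemma is_RInt_h (s : C) (n : nat) : 0 < Re s < 1 -> (1 <= n)%nat ->
  is_RInt_0_infty (fun v => RtoC (heat_defect n v) * rcpow v (s / RtoC 2 - RtoC 1))%C (h n s).
Proof.
  intros Hs Hn.
  assert (Hz : 0 < Re (s / RtoC 2) < 1 / 2).
  { replace (Re (s / RtoC 2)) with (Re s / 2) by (unfold Re; simpl; field). lra. }
  assert (H := is_RInt_0_infty_minus _ _ _ _ (is_RInt_zeta_cyclic _ n (proj1 Hz) Hn)
    (is_RInt_0_infty_scal _ (RtoC (INR n)) _ (is_RInt_zeta_Z_scaled _ n Hz Hn))).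
  replace (h n s) with (rcpow (4 * PI) (s / RtoC 2) * rcpow (INR n) (- (RtoC 2 * (s / RtoC 2))) *
      (CGamma (s / RtoC 2) * zeta_cyclic n (s / RtoC 2)) -
    RtoC (INR n) * (rcpow (4 * PI) (s / RtoC 2) * rcpow (INR n) (- (RtoC 2 * (s / RtoC 2))) *
        (CGamma (s / RtoC 2) * zeta_Z (s / RtoC 2))))%C.
  - revert H. apply is_RInt_0_infty_ext. intros t Ht. rewrite csum_heat_cos.
    unfold heat_defect. rewrite RtoC_minus, RtoC_mult. ring.
  - unfold h. replace (RtoC 2 * (s / RtoC 2))%C with s by (field; apply RtoC_neq_0; lra). ring.
Qed.

(** For v >= 1 the two terms are bounded separately by 4 v^(-1/2): the sum by 4 / v, the integral by
    2 sqrt(PI) v^(-1/2), in which n has cancelled. *)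
Lemma heat_defect_bounds (n : nat) (v : R) : (1 <= n)%nat -> 0 < v ->
  Rabs (heat_defect n v) <= 3 /\ (1 <= v -> Rabs (heat_defect n v) <= 8 * Rpower v (- (1 / 2))).
Proof.
  intros Hn Hv. assert (Hn0 : 0 < INR n) by (apply lt_0_INR; lia). assert (Hpi := PI_RGT_0).
      assert (Hpi4 := PI_4).
  assert (Htau : 0 < INR n ^ 2 * v / PI).
  { apply Rdiv_lt_0_compat; auto. apply Rmult_lt_0_compat; auto. apply pow_lt; auto. }
  split; [apply heat_sum_RInt; auto; lra|]. intros Hv1.
  assert (H1 := heat_sum_le v n Hv Hn). assert (H2 := RInt_heat_cos_le _ Htau).
  assert (H3 := heat_trace_bounds _ (Rlt_le _ _ Htau)). fold (heat_trace (INR n ^ 2 * v / PI)) in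
      H2.
  rewrite <- div_sqrt_Rpower by auto. assert (Hs := sqrt_lt_R0 v Hv).
  assert (H4 : INR n * heat_trace (INR n ^ 2 * v / PI) <= 4 * / sqrt v).
  { apply Rle_trans with (INR n * (2 / sqrt (INR n ^ 2 * v / PI))); [apply Rmult_le_compat_l; lra|].
    assert (Hsp : 0 < sqrt PI) by (apply sqrt_lt_R0; auto).
    assert (Hsp2 : sqrt PI <= 2).
    { rewrite <- (sqrt_pow2 2) by lra. apply sqrt_le_1_alt. lra. }
    rewrite sqrt_div_alt, sqrt_mult, sqrt_pow2 by (try lra; apply pow2_ge_0).
    replace (INR n * (2 / (INR n * sqrt v / sqrt PI))) with (2 * sqrt PI * / sqrt v) by (field;
        lra).
    apply Rmult_le_compat_r; [left; apply Rinv_0_lt_compat; auto | lra]. }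
  assert (H5 : 4 / v <= 4 * / sqrt v).
  { apply Rmult_le_compat_l; [lra|]. apply Rinv_le_contravar; auto.
    rewrite <- (sqrt_sqrt v) at 2 by lra. assert (1 <= sqrt v) by (rewrite <- sqrt_1; apply
        sqrt_le_1_alt; auto). nra. }
  assert (H6 : 0 <= INR n * heat_trace (INR n ^ 2 * v / PI)) by (apply Rmult_le_pos; lra).
  unfold heat_defect. apply Rabs_le. lra.
Qed.

Lemma continuous_heat_sum (n m : nat) (v : R) : continuous (fun v => heat_sum (INR n ^ 2 * v /
    PI) n m) v.
Proof.
  induction m as [|m IH]; [apply continuous_const|].
  apply (continuous_plus (V := R_NormedModule)); auto.
  eapply continuous_is_derive. unfold heat_cos. auto_derive; auto.
Qed.

Lemma continuous_heat_defect (n : nat) (v : R) : (1 <= n)%nat -> 0 < v -> continuous (heat_defect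
    n) v.
Proof.
  intros Hn Hv. unfold heat_defect. assert (Hn0 : 0 < INR n) by (apply lt_0_INR; lia).
  apply (continuous_minus (V := R_NormedModule)); [apply continuous_heat_sum|].
  apply (continuous_scal_r (V := R_NormedModule)).
  apply (continuous_comp (U := R_UniformSpace) (V := R_UniformSpace) (W := R_UniformSpace) (fun v
      => INR n ^ 2 * v / PI) heat_trace).
  - eapply continuous_is_derive. auto_derive; auto.
  - apply continuous_heat_trace. apply Rdiv_lt_0_compat; [|apply PI_RGT_0].
    apply Rmult_lt_0_compat; auto. apply pow_lt; auto.
Qed.

(** The bounds on [heat_defect] do not involve n. The constant bound is integrable against v^(Re s /
    2 - 1) near 0 because Re s > 0, the bound v^(-1/2) at infinity because Re s < 1. *)
Lemma h_bounded (s : C) : 0 < Re s < 1 -> exists B, forall n, (1 <= n)%nat -> Cmod (h n s) <= B.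
Proof.
  intros Hs. exists (8 * (/ (Re s / 2) + / ((1 - Re s) / 2))). intros n Hn.
  assert (Hre : Re (s / RtoC 2 - RtoC 1) = Re s / 2 - 1) by (unfold Re; simpl; field).
  apply (is_RInt_0_infty_bound _ _ _ _ _) with (6 := is_RInt_h s n Hs Hn); try lra.
  - intros t Ht. apply continuous_Cmult; [|apply continuous_rcpow; auto].
    apply (continuous_RtoC (heat_defect n)), continuous_heat_defect; auto.
  - intros t Ht. destruct (heat_defect_bounds n t Hn ltac:(lra)) as [H _].
    rewrite Cmod_mult, Cmod_R, Cmod_rcpow, Hre. apply Rmult_le_compat_r; [left; apply Rpower_pos
        | lra].
  - intros t Ht. destruct (heat_defect_bounds n t Hn ltac:(lra)) as [_ H]. specialize (H Ht).
    rewrite Cmod_mult, Cmod_R, Cmod_rcpow, Hre.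
    replace (- ((1 - Re s) / 2) - 1) with (- (1 / 2) + (Re s / 2 - 1)) by field.
    rewrite Rpower_plus, <- Rmult_assoc. apply Rmult_le_compat_r; [left; apply Rpower_pos | lra].
Qed.

(** * Analytic continuation of the eta series *)

Lemma ex_pseries_CV_radius (a : nat -> R) (x : R) : ex_pseries a x -> Rbar_le (Rabs x) (CV_radius
    a).
Proof.
  intros H. apply Rbar_not_lt_le. intros Hlt. apply CV_disk_outside in Hlt. apply Hlt.
  destruct H as [l Hl]. apply is_pseries_R in Hl. apply ex_series_lim_0. exists l. exact Hl.
Qed.

(** The continuation runs along lines in C, so complex functions enter only through their real and
    imaginary parts on a line, as real power series. *)
Definition real_analytic (u : R -> R) (t : R) : Prop :=
  exists (a : nat -> R) (r : R), 0 < r /\ forall h, Rabs h < r -> is_pseries a h (u (t + h)).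

(** Convergence at the midpoint of |h| and r places |h| strictly inside the disk, as Cauchy products
    and continuity require. *)
Lemma real_analytic_radius (a : nat -> R) (r h : R) (u : R -> R) :
  (forall h, Rabs h < r -> is_pseries a h (u h)) -> Rabs h < r -> Rbar_lt (Rabs h) (CV_radius a).
Proof.
  intros H Hh. apply Rbar_lt_le_trans with (Rabs ((Rabs h + r) / 2)).
  - simpl. generalize (Rabs_pos h). intros. rewrite (Rabs_pos_eq (_ / 2)); lra.
  - apply ex_pseries_CV_radius. eexists. apply H. generalize (Rabs_pos h). intros. rewrite
      Rabs_pos_eq; lra.
Qed.

Lemma real_analytic_ext (u v : R -> R) (t : R) : (forall x, u x = v x) -> real_analytic u t ->
    real_analytic v t.
Proof.
  intros E (a & r & Hr & H). exists a, r. split; auto. intros h Hh. rewrite <- E. auto.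
Qed.

Lemma real_analytic_plus (u v : R -> R) (t : R) :
  real_analytic u t -> real_analytic v t -> real_analytic (fun x => u x + v x) t.
Proof.
  intros (a & r & Hr & Ha) (b & r' & Hr' & Hb). exists (PS_plus a b), (Rmin r r').
  split; [apply Rmin_glb_lt; auto|]. intros h Hh.
  apply (is_pseries_plus (V := R_NormedModule)); [apply Ha | apply Hb]; eapply Rlt_le_trans; try
      exact Hh; [apply Rmin_l | apply Rmin_r].
Qed.

Lemma real_analytic_minus (u v : R -> R) (t : R) :
  real_analytic u t -> real_analytic v t -> real_analytic (fun x => u x - v x) t.
Proof.
  intros (a & r & Hr & Ha) (b & r' & Hr' & Hb). exists (PS_minus a b), (Rmin r r').
  split; [apply Rmin_glb_lt; auto|]. intros h Hh.
  apply (is_pseries_minus (V := R_NormedModule)); [apply Ha | apply Hb]; eapply Rlt_le_trans; try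
      exact Hh; [apply Rmin_l | apply Rmin_r].
Qed.

Lemma real_analytic_mult (u v : R -> R) (t : R) :
  real_analytic u t -> real_analytic v t -> real_analytic (fun x => u x * v x) t.
Proof.
  intros (a & r & Hr & Ha) (b & r' & Hr' & Hb). exists (PS_mult a b), (Rmin r r').
  split; [apply Rmin_glb_lt; auto|]. intros h Hh.
  assert (H1 : Rabs h < r) by (eapply Rlt_le_trans; [exact Hh | apply Rmin_l]).
  assert (H2 : Rabs h < r') by (eapply Rlt_le_trans; [exact Hh | apply Rmin_r]).
  apply is_pseries_mult; auto.
  - apply (real_analytic_radius a r h (fun h => u (t + h))); auto.
  - apply (real_analytic_radius b r' h (fun h => v (t + h))); auto.
Qed.

(** The shape, with L = ln 2, of the real and imaginary parts of 1 - 2^(1 - s - x) as functions of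
    x. *)
Lemma real_analytic_exp (c L d t : R) : real_analytic (fun x => c * exp (- (x * L)) + d) t.
Proof.
  apply real_analytic_plus.
  - exists (fun n => c * exp (- (t * L)) * ((- L) ^ n / INR (fact n))), 1. split; [lra|]. intros
      h _.
    apply is_pseries_R. assert (H := is_exp_Reals (- (h * L))). apply is_pseries_R in H.
    apply (is_series_scal_l (K := R_AbsRing) (V := R_NormedModule) (c * exp (- (t * L)))) in H.
    replace (c * exp (- ((t + h) * L))) with (scal (c * exp (- (t * L))) (exp (- (h * L)))).
    + revert H. apply (is_series_ext (V := R_NormedModule)). intros n.
      change (c * exp (- (t * L)) * (/ INR (fact n) * (- (h * L)) ^ n) = c * exp (- (t * L)) *
          ((- L) ^ n / INR (fact n)) * h ^ n).
      replace (- (h * L)) with (- L * h) by ring. rewrite Rpow_mult_distr. field. apply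
          INR_fact_neq_0.
    + change (c * exp (- (t * L)) * exp (- (h * L)) = c * exp (- ((t + h) * L))). rewrite
        Rmult_assoc, <- exp_plus. do 2 f_equal. ring.
  - exists (fun n => match n with O => d | S _ => 0 end), 1. split; [lra|]. intros h _. apply
      is_pseries_R.
    change (is_lim_seq (sum_n (fun n => match n with O => d | S _ => 0 end * h ^ n)) d).
    apply is_lim_seq_ext with (fun _ => d); [|apply is_lim_seq_const].
    induction n as [|n IH]; [rewrite sum_O; simpl; ring|].
    rewrite sum_n_S, <- IH. ring.
Qed.

Lemma real_analytic_continuity (u : R -> R) (t : R) : real_analytic u t -> continuous u t.
Proof.
  intros (a & r & Hr & Ha).
  assert (HC : Rbar_lt (Rabs 0) (CV_radius a)).
  { apply (real_analytic_radius a r 0 (fun h => u (t + h))); auto. rewrite Rabs_R0; auto. }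
  assert (Hc := PSeries_continuity a 0 HC). apply continuity_pt_filterlim in Hc.
  apply (continuous_ext_loc _ (fun x => PSeries a (x - t))).
  - exists (mkposreal r Hr). intros y Hy.
    assert (Hy' : Rabs (y - t) < r) by exact Hy.
    replace (u y) with (u (t + (y - t))) by (f_equal; ring). apply is_pseries_unique, Ha; auto.
  - apply (continuous_comp (U := R_UniformSpace) (V := R_UniformSpace) (W := R_UniformSpace) (fun
      x => x - t) (PSeries a)).
    + eapply continuous_is_derive. auto_derive; auto.
    + rewrite Rminus_diag. exact Hc.
Qed.

(** Vanishing to the right of 0 suffices: continuity of the sum at 0 gives a 0 = 0, and division by
    h > 0 passes to the shifted series. *)
Lemma pseries_zero_coeff (n : nat) : forall (a : nat -> R) (r : R), 0 < r ->
  (forall h, 0 < h < r -> is_pseries a h 0) -> a n = 0.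
Proof.
  assert (H0 : forall (a : nat -> R) (r : R), 0 < r -> (forall h, 0 < h < r -> is_pseries a h 0)
      -> a O = 0).
  { intros a r Hr Ha.
    assert (HC : Rbar_lt (Rabs 0) (CV_radius a)).
    { apply Rbar_lt_le_trans with (Rabs (r / 2)).
      - rewrite Rabs_R0, Rabs_pos_eq by lra. simpl. lra.
      - apply ex_pseries_CV_radius. exists 0. apply Ha. lra. }
    assert (Hc := proj1 (continuity_pt_locally (PSeries a) 0) (PSeries_continuity a 0 HC)).
    destruct (Req_dec (a O) 0) as [E|E]; auto. exfalso.
    assert (Ep := Rabs_pos_lt _ E). destruct (Hc (mkposreal _ Ep)) as [d Hd].
    set (x := Rmin (d / 2) (r / 2)). assert (Hd0 := cond_pos d).
    assert (Hx : 0 < x <= d / 2 /\ x <= r / 2) by (unfold x; split; [split; [apply Rmin_glb_lt;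
        lra | apply Rmin_l] | apply Rmin_r]).
    assert (Hx2 : Rabs (PSeries a x - PSeries a 0) < Rabs (a O)).
    { apply Hd. apply ball_R. rewrite Rabs_pos_eq; lra. }
    rewrite PSeries_0, (is_pseries_unique a x 0) in Hx2 by (apply Ha; lra).
    replace (0 - a O) with (- a O) in Hx2 by ring. rewrite Rabs_Ropp in Hx2. lra. }
  induction n as [|n IH]; intros a r Hr Ha; [apply (H0 a r); auto|].
  change (a (S n)) with (PS_decr_1 a n). apply (IH _ r); auto. intros h Hh.
  assert (H1 := is_pseries_decr_1 (K := R_AbsRing) (V := R_NormedModule) a h (/ h) 0 ltac:(change
      (/ h * h = 1); field; lra) (Ha h Hh)).
  rewrite (H0 a r Hr Ha) in H1.
  match type of H1 with is_pseries _ _ ?l => replace l with 0 in H1; [exact H1|] end.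
  change (0 = / h * (0 + - 0)). ring.
Qed.

(** Let t0 be the least t >= 0 beyond which u vanishes. The power series at t0 is zero to the right
    of its centre, hence identically; so u also vanishes a little to the left, which contradicts
    minimality unless t0 = 0. *)
Lemma real_analytic_identity (u : R -> R) (T : R) :
  (forall t, 0 <= t -> real_analytic u t) -> (forall t, T < t -> u t = 0) -> u 0 = 0.
Proof.
  intros Hra HT.
  (* Negated, because [completeness] yields a supremum while an infimum is wanted. *)
  set (E := fun m => exists t, m = - t /\ 0 <= t /\ forall x, t < x -> u x = 0).
  destruct (completeness E) as [m [Hub Hlub]].
  - exists 0. intros m (t & -> & Ht & _). lra.
  - exists (- Rmax T 0), (Rmax T 0). split; auto. split; [apply Rmax_r|].
    intros x Hx. apply HT. eapply Rle_lt_trans; [apply Rmax_l | exact Hx].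
  - set (t0 := - m).
    assert (Ht0 : 0 <= t0).
    { unfold t0. assert (m <= 0); [|lra]. apply Hlub. intros y (t & -> & Ht & _). lra. }
    assert (Hvan : forall x, t0 < x -> u x = 0).
    { intros x Hx. destruct (Req_dec (u x) 0) as [|Hne]; auto. exfalso.
      assert (Hx2 : m <= - x); [|unfold t0 in Hx; lra].
      apply Hlub. intros y (t & -> & Ht & Htx). apply Ropp_le_contravar. apply Rnot_lt_le.
      intros Hlt. apply Hne, Htx; auto. }
    destruct (Hra t0 Ht0) as (a & r & Hr & Ha).
    assert (Hz : forall n, a n = 0).
    { intros n. apply (pseries_zero_coeff n a r Hr). intros h Hh.
      rewrite <- (Hvan (t0 + h)) by lra. apply Ha. rewrite Rabs_pos_eq; lra. }
    assert (Hnear : forall h, Rabs h < r -> u (t0 + h) = 0).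
    { intros h Hh. rewrite <- (is_pseries_unique _ _ _ (Ha h Hh)).
      rewrite (PSeries_ext _ (fun _ => 0)) by auto. apply is_pseries_unique. apply is_pseries_R.
      change (is_lim_seq (sum_n (fun n => 0 * h ^ n)) 0).
      apply is_lim_seq_ext with (fun _ => 0); [|apply is_lim_seq_const].
      induction n as [|n IH]; [rewrite sum_O; ring|]. rewrite sum_n_S, <- IH. ring. }
    destruct Ht0 as [Ht0 | Ht0].
    + exfalso. set (t1 := Rmax 0 (t0 - r / 2)).
      assert (Ht1 : 0 <= t1 /\ t0 - r / 2 <= t1 /\ t1 < t0).
      { unfold t1. split; [apply Rmax_l|]. split; [apply Rmax_r|]. apply Rmax_lub_lt; lra. }
      assert (Hm : - t1 <= m).
      { apply Hub. exists t1. split; auto. split; [lra|]. intros x Hx.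
        destruct (Rlt_dec t0 x) as [Hlt|Hnlt]; [apply Hvan; auto|].
        replace x with (t0 + (x - t0)) by ring. apply Hnear. rewrite Rabs_left1; lra. }
      unfold t0 in *. lra.
    + replace (u 0) with (u (t0 + 0)) by (rewrite <- Ht0; f_equal; ring). apply Hnear. rewrite
        Rabs_R0. auto.
Qed.

Lemma Rabs_sum_n_le (a : nat -> R) (n : nat) : Rabs (sum_n a n) <= sum_n (fun k => Rabs (a k)) n.
Proof. exact (norm_sum_n_m (K := R_AbsRing) (V := R_NormedModule) a 0 n). Qed.

Lemma is_series_R (a : nat -> R) (l : R) : is_series a l <-> is_lim_seq (sum_n a) l.
Proof. split; intros H; exact H. Qed.

(** Exchange of a double series. Truncated rows and full rows are both dominated by M, so one K
    controls the tails over k for every degree J at once; the finitely many rows up to K converge as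
    J grows. *)
Lemma pseries_of_series (c : nat -> nat -> R) (M : nat -> R) (r h : R) (u : nat -> R) (U : R) :
  0 < r -> Rabs h <= r ->
  (forall k J, sum_n (fun m => Rabs (c k m) * r ^ m) J <= M k) -> ex_series M ->
  (forall k, is_pseries (c k) h (u k)) -> is_series u U ->
  is_pseries (fun m => Series (fun k => c k m)) h U.
Proof.
  intros Hr Hh HM HexM Hu HU.
  assert (Hrm : forall m, 0 < r ^ m) by (intros; apply pow_lt; auto).
  assert (HM0 : forall k, 0 <= M k).
  { intros k. eapply Rle_trans; [|apply (HM k O)]. rewrite sum_O. apply Rmult_le_pos; [apply
      Rabs_pos | left; apply Hrm]. }
  assert (Hnonneg : forall k J m, (m <= J)%nat -> Rabs (c k m) * r ^ m <= sum_n (fun m => Rabs (c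
      k m) * r ^ m) J).
  { intros k J. induction J as [|J IH]; intros m Hm.
    - replace m with O by lia. rewrite sum_O. lra.
    - rewrite sum_n_S.
      assert (P : 0 <= Rabs (c k (S J)) * r ^ S J) by (apply Rmult_le_pos; [apply Rabs_pos |
          left; apply Hrm]).
      destruct (Nat.eq_dec m (S J)) as [->|Hne].
      + assert (P2 := IH O ltac:(lia)). assert (0 <= Rabs (c k 0%nat) * r ^ 0) by (apply
          Rmult_le_pos; [apply Rabs_pos | left; apply Hrm]). lra.
      + specialize (IH m ltac:(lia)). lra. }
  assert (Hc : forall k m, Rabs (c k m) <= / r ^ m * M k).
  { intros k m. apply Rmult_le_reg_r with (r ^ m); auto.
    replace (/ r ^ m * M k * r ^ m) with (M k) by (field; apply Rgt_not_eq, Hrm).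
    eapply Rle_trans; [apply (Hnonneg k m m); lia | apply HM]. }
  assert (Hcol : forall m, is_series (fun k => c k m) (Series (fun k => c k m))).
  { intros m. apply Series_correct. apply (ex_series_le (K := R_AbsRing) (V :=
      R_CompleteNormedModule) _ (fun k => / r ^ m * M k)).
    - intros k. apply Hc.
    - apply (ex_series_scal_l (K := R_AbsRing) (V := R_NormedModule) (/ r ^ m) M HexM). }
  set (C := fun m => Series (fun k => c k m)) in *.
  assert (Hpart : forall k J, Rabs (sum_n (fun m => c k m * h ^ m) J) <= M k).
  { intros k J. eapply Rle_trans; [apply Rabs_sum_n_le|]. eapply Rle_trans; [|apply (HM k J)].
    apply sum_n_m_le. intros m. rewrite Rabs_mult, <- RPow_abs. apply Rmult_le_compat_l; [apply
        Rabs_pos|].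
    apply pow_incr. split; [apply Rabs_pos | auto]. }
  assert (Hlimk : forall k, is_lim_seq (sum_n (fun m => c k m * h ^ m)) (u k)).
  { intros k. assert (H := Hu k). apply is_pseries_R in H. exact H. }
  assert (Hub : forall k, Rabs (u k) <= M k).
  { intros k. exact (is_lim_seq_le _ _ _ _ (fun J => Hpart k J) (is_lim_seq_abs _ (Finite _)
      (Hlimk k)) (is_lim_seq_const (M k))). }
  apply is_pseries_R. apply is_series_R.
  assert (HP : forall J, is_series (fun k => sum_n (fun m => c k m * h ^ m) J) (sum_n (fun m => C
      m * h ^ m) J)).
  { induction J as [|J IH].
    - rewrite sum_O. apply (is_series_ext (V := R_NormedModule) (fun k => c k O * h ^ 0));
        [intros; rewrite sum_O; reflexivity|].
      apply (is_series_scal_r (h ^ 0)), Hcol.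
    - rewrite sum_Sn. apply (is_series_ext (V := R_NormedModule) (fun k => plus (sum_n (fun m =>
        c k m * h ^ m) J) (c k (S J) * h ^ S J))).
      + intros k. rewrite sum_Sn. reflexivity.
      + apply (is_series_plus (V := R_NormedModule)); auto. apply (is_series_scal_r (h ^ S J)),
          Hcol. }
  destruct HexM as [LM HLM].
  apply is_lim_seq_spec. intros eps.
  apply is_series_R, is_lim_seq_spec in HLM. assert (He := cond_pos eps).
  assert (He8 : 0 < eps / 8) by lra.
  destruct (HLM (mkposreal _ He8)) as [K HK]. simpl in HK.
  assert (Htail : forall a, (forall k, Rabs (a k) <= M k) -> forall p, Rabs (sum_n a (K + p) -
      sum_n a K) <= eps / 4).
  { intros a Ha p.
    assert (A : Rabs (sum_n a (K + p) - sum_n a K) <= sum_n M (K + p) - sum_n M K).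
    { induction p as [|p IH]; [rewrite Nat.add_0_r, !Rminus_diag, Rabs_R0; lra|].
      rewrite Nat.add_succ_r, !sum_n_S.
      replace (sum_n a (K + p) + a (S (K + p)) - sum_n a K) with ((sum_n a (K + p) - sum_n a K) +
          a (S (K + p))) by ring.
      eapply Rle_trans; [apply Rabs_triang|]. specialize (Ha (S (K + p))). lra. }
    assert (H1 := HK (K + p)%nat ltac:(lia)). assert (H2 := HK K (le_n K)).
    apply Rabs_def2 in H1, H2. lra. }
  assert (Htail2 : forall a l, (forall k, Rabs (a k) <= M k) -> is_series a l -> Rabs (l - sum_n
      a K) <= eps / 4).
  { intros a l Ha Hl. apply is_series_R in Hl.
    assert (L : is_lim_seq (fun p => Rabs (sum_n a (K + p) - sum_n a K)) (Rabs (l - sum_n a K))).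
    { apply (is_lim_seq_abs _ (Finite _)), is_lim_seq_minus'; [|apply is_lim_seq_const].
      apply is_lim_seq_ext with (fun p => sum_n a (p + K)); [intros; f_equal; lia|]. apply
          (is_lim_seq_incr_n (sum_n a)), Hl. }
    exact (is_lim_seq_le _ _ _ _ (Htail a Ha) L (is_lim_seq_const (eps / 4))). }
  assert (Hfin : is_lim_seq (fun J => sum_n (fun k => sum_n (fun m => c k m * h ^ m) J) K) (sum_n
      u K)).
  { clear - Hlimk. induction K as [|K IH].
    - rewrite sum_O. apply is_lim_seq_ext with (sum_n (fun m => c O m * h ^ m)); [intros; rewrite
        sum_O; reflexivity | apply Hlimk].
    - rewrite sum_Sn. apply is_lim_seq_ext with (fun J => sum_n (fun k => sum_n (fun m => c k m *
        h ^ m) J) K + sum_n (fun m => c (S K) m * h ^ m) J).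
      + intros J. rewrite (sum_Sn _ K). reflexivity.
      + apply is_lim_seq_plus'; auto. }
  apply is_lim_seq_spec in Hfin. destruct (Hfin (mkposreal _ He8)) as [J0 HJ0]. simpl in HJ0.
  exists J0. intros J HJ. specialize (HJ0 J HJ).
  assert (H1 := Htail2 _ _ (fun k => Hpart k J) (HP J)). assert (H2 := Htail2 u U Hub HU).
  apply Rabs_le_between in H1, H2. apply Rabs_def2 in HJ0. apply Rabs_def1; lra.
Qed.

(** X and Y stand for a component of a^(-z) and (a+1)^(-z), a = 2j + 1. Expanding both powers in a
    shift of z must not destroy the pairing: X - Y is small by [rcpow_diff_bound], and ln(a+1) is
    close to ln a. Summed over m, the two effects give |z| a^(-x-1) (a+1)^r and a^(-x) ((a+1)^r -
    a^r), both of order a^(-(x-r)-1). *)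
Lemma eta_coeff_bound (x r : R) (z : C) (X Y : R) (j J : nat) : Re z = x -> 0 < r < x -> r <= 1 ->
  Rabs X <= Cmod (rcpow (INR (2 * j + 1)) (- z)) ->
  Rabs (X - Y) <= Cmod (rcpow (INR (2 * j + 1)) (- z) - rcpow (INR (2 * j + 2)) (- z)) ->
  sum_n (fun m => Rabs ((X * (- ln (INR (2 * j + 1))) ^ m - Y * (- ln (INR (2 * j + 2))) ^ m) /
      INR (fact m)) * r ^ m) J
    <= (2 * Cmod z + 1) * Rpower (INR (S j)) (- (x - r) - 1).
Proof.
  intros Hzx Hr Hr1 HX HXY.
  assert (Hj := pos_INR j).
  assert (E1 : INR (2 * j + 1) = 2 * INR j + 1) by (rewrite plus_INR, mult_INR; simpl; ring).
  assert (E2 : INR (2 * j + 2) = 2 * INR j + 1 + 1) by (rewrite plus_INR, mult_INR; simpl; ring).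
  set (a := 2 * INR j + 1) in *. rewrite E1, E2 in *.
  assert (Ha : 1 <= a) by (unfold a; lra).
  assert (La : 0 <= ln a <= ln (a + 1)).
  { split; [rewrite <- ln_1; destruct Ha as [Ha | <-]; [left; apply ln_increasing; lra | lra] |
      left; apply ln_increasing; lra]. }
  set (al := ln a) in *. set (be := ln (a + 1)) in *.
  rewrite Cmod_rcpow in HX. replace (Re (- z)) with (- x) in HX by (rewrite <- Hzx; reflexivity).
  assert (HD := rcpow_diff_bound a (a + 1) z ltac:(lra) ltac:(lra)). rewrite Hzx in HD.
  replace (Cmod z * (a + 1 - a)) with (Cmod z) in HD by ring.
  set (D := Cmod (rcpow a (- z) - rcpow (a + 1) (- z))) in *.
  assert (HD0 : 0 <= D) by apply Cmod_ge_0.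
  assert (A : forall J, sum_n (fun m => Rabs ((X * (- al) ^ m - Y * (- be) ^ m) / INR (fact m)) *
      r ^ m) J
    <= D * exp_sum (r * be) J + Rpower a (- x) * (exp_sum (r * be) J - exp_sum (r * al) J)).
  { assert (T : forall m, Rabs ((X * (- al) ^ m - Y * (- be) ^ m) / INR (fact m)) * r ^ m <=
       D * ((r * be) ^ m / INR (fact m)) + Rpower a (- x) * ((r * be) ^ m / INR (fact m) - (r *
           al) ^ m / INR (fact m))).
    { intros m. assert (Hf : 0 < / INR (fact m)) by (apply Rinv_0_lt_compat, lt_0_INR, lt_O_fact).
      assert (Hbm : 0 <= be ^ m) by (apply pow_le; lra).
      assert (Hab : al ^ m <= be ^ m) by (apply pow_incr; lra).
      assert (Hrm : 0 <= r ^ m) by (apply pow_le; lra).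
      (* Separates the difference of the powers from the difference of the logarithms. *)
      replace (X * (- al) ^ m - Y * (- be) ^ m) with ((-1) ^ m * ((X - Y) * be ^ m - X * (be ^ m
          - al ^ m))).
      2: { replace (- al) with (-1 * al) by ring. replace (- be) with (-1 * be) by ring. rewrite
          !Rpow_mult_distr. ring. }
      unfold Rdiv. rewrite !Rabs_mult, pow_1_abs, Rmult_1_l, (Rabs_pos_eq (/ _)) by lra.
      rewrite !Rpow_mult_distr.
      replace (D * (r ^ m * be ^ m * / INR (fact m)) + Rpower a (- x) * (r ^ m * be ^ m * / INR
          (fact m) - r ^ m * al ^ m * / INR (fact m)))
        with ((D * be ^ m + Rpower a (- x) * (be ^ m - al ^ m)) * / INR (fact m) * r ^ m) by ring.
      apply Rmult_le_compat_r; auto. apply Rmult_le_compat_r; [lra|].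
      unfold Rminus at 1. eapply Rle_trans; [apply Rabs_triang|]. rewrite Rabs_Ropp, !Rabs_mult.
      rewrite (Rabs_pos_eq (be ^ m)), (Rabs_pos_eq (be ^ m - al ^ m)) by lra.
      apply Rplus_le_compat; apply Rmult_le_compat_r; lra. }
    induction J0 as [|J0 IH].
    - unfold exp_sum. rewrite !sum_O. apply T.
    - rewrite sum_n_S, !exp_sum_S. specialize (T (S J0)). lra. }
  eapply Rle_trans; [apply A|].
  assert (Hra : 0 <= r * al <= r * be) by (split; [apply Rmult_le_pos; lra | apply
      Rmult_le_compat_l; lra]).
  (* [X1] bounds the difference of the partial sums by the difference of the exponentials; the point
     0 in [X2] only says that a partial sum at r * be lies below its limit. *)
  assert (X1 := exp_sum_error (r * al) (r * be) J ltac:(rewrite Rabs_pos_eq; lra)).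
  assert (X2 := exp_sum_error 0 (r * be) J ltac:(rewrite Rabs_R0; lra)).
  assert (X3 := Rabs_pos (exp 0 - exp_sum 0 J)). apply Rabs_le_between in X1.
  assert (Eb : exp (r * be) = Rpower (a + 1) r) by reflexivity.
  assert (Ea : exp (r * al) = Rpower a r) by reflexivity.
  rewrite Eb, Ea in *.
  destruct (MVT_is_derive (fun t => Rpower t r) (fun t => r * Rpower t (r - 1)) a (a + 1)) as (c
      & Hc & EM); [lra| |].
  { intros t Ht. apply is_derive_Rpower. lra. }
  assert (Hc1 : Rpower c (r - 1) <= Rpower a (r - 1)) by (apply Rpower_le_neg; lra).
  assert (Hap := Rpower_pos a (r - 1)). assert (Hcp := Rpower_pos c (r - 1)).
  assert (Hdiff : Rpower (a + 1) r - Rpower a r <= Rpower a (r - 1)).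
  { rewrite EM. replace (a + 1 - a) with 1 by ring. nra. }
  assert (Ea1 : Rpower a r = Rpower a (r - 1) * a).
  { replace r with ((r - 1) + 1) at 1 by ring. rewrite Rpower_plus, Rpower_1 by lra. auto. }
  assert (Hb2 : Rpower (a + 1) r <= 2 * Rpower a (r - 1) * a) by nra.
  assert (Hbig := Rpower_pos a (- x)). assert (HCz := Cmod_ge_0 z).
  apply Rle_trans with ((2 * Cmod z + 1) * Rpower a (- (x - r) - 1)).
  - assert (Y1 : D * exp_sum (r * be) J <= (Cmod z * Rpower a (- x - 1)) * (2 * Rpower a (r - 1)
      * a)).
    { apply Rle_trans with (D * Rpower (a + 1) r); [apply Rmult_le_compat_l; lra|].
      apply Rmult_le_compat; try lra. left; apply Rpower_pos. }
    assert (Y2 : Rpower a (- x) * (exp_sum (r * be) J - exp_sum (r * al) J) <= Rpower a (- x) *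
        Rpower a (r - 1)).
    { apply Rmult_le_compat_l; lra. }
    replace ((2 * Cmod z + 1) * Rpower a (- (x - r) - 1)) with
      ((Cmod z * Rpower a (- x - 1)) * (2 * Rpower a (r - 1) * a) + Rpower a (- x) * Rpower a (r
          - 1)); [lra|].
    replace (- (x - r) - 1) with (- x + (r - 1)) by ring. rewrite Rpower_plus.
    replace (Rpower a (- x)) with (Rpower a (- x - 1) * a).
    + ring.
    + replace (- x) with ((- x - 1) + 1) at 2 by ring. rewrite Rpower_plus, Rpower_1 by lra. auto.
  - apply Rmult_le_compat_l; [lra|]. apply Rpower_le_neg; [rewrite S_INR; unfold a; lra | lra].
Qed.

(* Stands for Re or Im. *)
Definition real_functional (P : C -> R) : Prop :=
  (forall a b, P (a - b)%C = P a - P b) /\ (forall a b, P (a + b)%C = P a + P b) /\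
  (forall r c, P (RtoC r * c)%C = r * P c) /\ (forall c, Rabs (P c) <= Cmod c).

Lemma real_functional_Re : real_functional Re.
Proof.
  repeat split; intros.
  - apply re_scal_l.
  - apply re_le_Cmod.
Qed.

Lemma im_le_Cmod (c : C) : Rabs (Im c) <= Cmod c.
Proof. eapply Rle_trans; [apply Rmax_r | apply Rmax_Cmod]. Qed.

Lemma real_functional_Im : real_functional Im.
Proof.
  repeat split; intros.
  - unfold Im; simpl; ring.
  - apply im_le_Cmod.
Qed.

Lemma Clim_functional (P : C -> R) (u : nat -> C) (l : C) : real_functional P ->
  Clim u l -> is_lim_seq (fun n => P (u n)) (P l).
Proof.
  intros (Hm & _ & _ & HC) H. apply is_lim_seq_spec. intros eps.
  destruct (proj1 (Clim_eps u l) H eps (cond_pos eps)) as [N HN]. exists N. intros n Hn.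
  rewrite <- Hm. eapply Rle_lt_trans; [apply HC | auto].
Qed.

Lemma Clim_components (u : nat -> C) (l : C) :
  is_lim_seq (fun n => Re (u n)) (Re l) -> is_lim_seq (fun n => Im (u n)) (Im l) -> Clim u l.
Proof.
  intros HR HI.
  apply Clim_bound with (fun n => Rabs (Re (u n) - Re l) + Rabs (Im (u n) - Im l)).
  - intros n. replace (u n - l)%C with (RtoC (Re (u n) - Re l) + Ci * RtoC (Im (u n) - Im l))%C.
    + eapply Rle_trans; [apply Cmod_triangle|]. rewrite Cmod_mult, Cmod_Ci, !Cmod_R. lra.
    + apply C_ext; unfold Re, Im; simpl; ring.
  - replace (Finite 0) with (Finite (Rabs (Re l - Re l) + Rabs (Im l - Im l))) by (f_equal;
      rewrite !Rminus_diag, Rabs_R0; ring).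
    apply is_lim_seq_plus'; apply (is_lim_seq_abs _ (Finite _)), is_lim_seq_minus'; auto; apply
        is_lim_seq_const.
Qed.

Lemma functional_csum (P : C -> R) (a : nat -> C) (n : nat) : real_functional P ->
  sum_n (fun k => P (a k)) n = P (csum a (S n)).
Proof.
  intros (_ & Hp & Hs & _). assert (HP0 : P (RtoC 0) = 0).
  { replace (RtoC 0) with (RtoC 0 * RtoC 0)%C by ring. rewrite Hs. ring. }
  induction n as [|n IH].
  - rewrite sum_O. simpl. rewrite Hp, HP0. ring.
  - rewrite sum_Sn, IH, (csum_S _ (S n)), Hp. reflexivity.
Qed.

Lemma functional_series (P : C -> R) (a : nat -> C) (l : C) : real_functional P ->
  Clim (csum a) l -> is_series (fun k => P (a k)) (P l).
Proof.
  intros HP H. apply is_series_R. apply is_lim_seq_ext with (fun n => P (csum a (S n))).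
  - intros n. symmetry. apply functional_csum; auto.
  - apply (is_lim_seq_incr_1 (fun n => P (csum a n))). apply Clim_functional; auto.
Qed.

Definition eta (z : C) : C :=
  (Series (fun j => Re (eta_term z j)), Series (fun j => Im (eta_term z j))).

Lemma eta_Clim (z : C) : 0 < Re z -> Clim (csum (eta_term z)) (eta z).
Proof.
  intros Hz. destruct (eta_ex z Hz) as [l Hl].
  replace (eta z) with l; auto. apply C_ext; symmetry.
  - change (Series (fun j => Re (eta_term z j)) = Re l). apply is_series_unique,
      (functional_series Re); auto. apply real_functional_Re.
  - change (Series (fun j => Im (eta_term z j)) = Im l). apply is_series_unique,
      (functional_series Im); auto. apply real_functional_Im.
Qed.

Lemma rcpow_shift (a : R) (z : C) (h : R) :
  rcpow a (- (z + RtoC h)) = (RtoC (exp (- (h * ln a))) * rcpow a (- z))%C.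
Proof.
  replace (- (z + RtoC h))%C with (RtoC (- h) + - z)%C by (rewrite RtoC_opp; ring).
  rewrite rcpow_plus, rcpow_real. unfold Rpower. do 3 f_equal. ring.
Qed.

Lemma is_pseries_exp_lin (c L h : R) : is_pseries (fun n => c * (- L) ^ n / INR (fact n)) h (c *
    exp (- (h * L))).
Proof.
  apply is_pseries_R. assert (H := is_exp_Reals (- (h * L))). apply is_pseries_R in H.
  apply (is_series_scal_l (K := R_AbsRing) (V := R_NormedModule) c) in H.
  revert H. apply (is_series_ext (V := R_NormedModule)). intros n.
  change (c * (/ INR (fact n) * (- (h * L)) ^ n) = c * (- L) ^ n / INR (fact n) * h ^ n).
  replace (- (h * L)) with (- L * h) by ring. rewrite Rpow_mult_distr. field. apply INR_fact_neq_0.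
Qed.

Lemma real_analytic_eta (P : C -> R) (s : C) (t : R) : real_functional P -> 0 < Re s + t ->
  real_analytic (fun x => P (eta (s + RtoC x))) t.
Proof.
  intros HP Hx. assert (HP' := HP). destruct HP' as (Hm & Hp & Hs & HC).
  set (z := (s + RtoC t)%C). set (x := Re s + t) in *.
  assert (Hzx : Re z = x) by reflexivity.
  (* At most x / 2, so that x - r > 0 and the majorant of [eta_coeff_bound] is summable. *)
  set (r := Rmin 1 (x / 2)).
  assert (Hr : 0 < r /\ r <= 1 /\ r <= x / 2).
  { unfold r. split; [apply Rmin_glb_lt; lra | split; [apply Rmin_l | apply Rmin_r]]. }
  set (c := fun j m => (P (rcpow (INR (2 * j + 1)) (- z)) * (- ln (INR (2 * j + 1))) ^ m -
     P (rcpow (INR (2 * j + 2)) (- z)) * (- ln (INR (2 * j + 2))) ^ m) / INR (fact m)).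
  exists (fun m => Series (fun j => c j m)), r. split; [lra|]. intros h Hh.
  replace (s + RtoC (t + h))%C with (z + RtoC h)%C by (unfold z; rewrite RtoC_plus; ring).
  apply (pseries_of_series c (fun j => (2 * Cmod z + 1) * Rpower (INR (S j)) (- (x - r) - 1)) r h
      (fun j => P (eta_term (z + RtoC h) j))); try lra.
  - intros j J. apply (eta_coeff_bound x r z); auto; try lra. rewrite <- Hm. apply HC.
  - apply ex_series_eta_bound. lra.
  - intros j. unfold eta_term. rewrite Hm, !rcpow_shift, !Hs.
    assert (H1 := is_pseries_exp_lin (P (rcpow (INR (2 * j + 1)) (- z))) (ln (INR (2 * j + 1))) h).
    assert (H2 := is_pseries_exp_lin (P (rcpow (INR (2 * j + 2)) (- z))) (ln (INR (2 * j + 2))) h).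
    assert (H3 := is_pseries_minus (K := R_AbsRing) (V := R_NormedModule) _ _ _ _ _ H1 H2).
    rewrite (Rmult_comm _ (P (rcpow (INR (2 * j + 1)) (- z)))), (Rmult_comm _ (P (rcpow (INR (2 *
        j + 2)) (- z)))).
    revert H3. apply (is_pseries_ext (V := R_NormedModule)). intros n. unfold c.
    change (P (rcpow (INR (2 * j + 1)) (- z)) * (- ln (INR (2 * j + 1))) ^ n / INR (fact n) +
      - (P (rcpow (INR (2 * j + 2)) (- z)) * (- ln (INR (2 * j + 2))) ^ n / INR (fact n)) =
      (P (rcpow (INR (2 * j + 1)) (- z)) * (- ln (INR (2 * j + 1))) ^ n -
      P (rcpow (INR (2 * j + 2)) (- z)) * (- ln (INR (2 * j + 2))) ^ n) / INR (fact n)).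
    field. apply INR_fact_neq_0.
  - apply functional_series; auto. apply eta_Clim.
    apply Rabs_def2 in Hh. replace (Re (z + RtoC h)) with (x + h) by (rewrite <- Hzx;
        reflexivity). lra.
Qed.

(** * The relation between eta and zeta in the strip *)

Lemma is_series_Clim (a : nat -> C) (l : C) :
  is_series (K := C_AbsRing) (V := C_NormedModule) a l -> Clim (csum a) l.
Proof.
  intros Hl. apply Clim_eps. intros eps Heps.
  destruct (Hl _ (locally_C_NormedModule l eps Heps)) as [N HN]. exists (S N). intros n Hn.
  destruct n as [|n]; [lia|]. rewrite <- sum_n_csum. apply HN. lia.
Qed.

Lemma pow_n_real_mult (t : R) (e : C) (k : nat) :
  @pow_n C_AbsRing (RtoC t * e)%C k = (RtoC (t ^ k) * @pow_n C_AbsRing e k)%C.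
Proof.
  induction k as [|k IH].
  - simpl. change (RtoC 1 = (RtoC 1 * RtoC 1)%C). ring.
  - simpl pow_n. rewrite IH. change ((RtoC t * e) * (RtoC (t ^ k) * @pow_n C_AbsRing e k) = RtoC
      (t * t ^ k) * (e * @pow_n C_AbsRing e k))%C.
    rewrite RtoC_mult. ring.
Qed.

(** The unit direction e preserves the radius. It is 1 for the continuation along a horizontal ray
    and i for the vertical limit. *)
Lemma analytic_at_line (P : C -> R) (f : C -> C) (s e : C) (t : R) : real_functional P -> Cmod e
    = 1 ->
  analytic_at f (s + RtoC t * e) -> real_analytic (fun x => P (f (s + RtoC x * e)%C)) t.
Proof.
  intros HP He (a & r & Hr & Ha). assert (HP' := HP). destruct HP' as (Hm & Hp & Hs & HC).
  exists (fun k => P (@pow_n C_AbsRing e k * a k)%C), r. split; auto. intros h Hh.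
  assert (E : (s + RtoC (t + h) * e - (s + RtoC t * e) = RtoC h * e)%C) by (rewrite RtoC_plus;
      ring).
  assert (H := Ha (s + RtoC (t + h) * e)%C). rewrite E in H.
  specialize (H ltac:(rewrite Cmod_mult, Cmod_R, He; lra)).
  apply is_series_Clim in H. apply (functional_series P _ _ HP) in H.
  apply is_pseries_R. revert H. apply (is_series_ext (V := R_NormedModule)). intros k.
  change (P (@pow_n C_AbsRing (RtoC h * e)%C k * a k)%C = P (@pow_n C_AbsRing e k * a k)%C * h ^ k).
  rewrite pow_n_real_mult, <- Cmult_assoc, Hs. ring.
Qed.

(** N pairs are the first 2N terms of the Dirichlet series minus twice those with even index, and
    these carry the factor 2 * 2^(-z) = 2^(1-z). *)
Lemma zeta_eta_convergent (zeta : C -> C) (z : C) : is_Riemann_zeta zeta -> 1 < Re z ->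
  eta z = ((RtoC 1 - rcpow 2 (RtoC 1 - z)) * zeta z)%C.
Proof.
  intros [Hser _] Hz. specialize (Hser z Hz). apply is_series_Clim in Hser.
  set (w := fun k => rcpow (INR (S k)) (- z)) in *.
  apply (Clim_unique (csum (eta_term z))); [apply eta_Clim; lra|].
  assert (H2 : Clim (fun N => csum w (2 * N)) (zeta z)).
  { apply Clim_eps. intros eps Heps. destruct (proj1 (Clim_eps _ _) Hser eps Heps) as [N HN].
    exists N. intros n Hn. apply HN. lia. }
  assert (H := Clim_minus _ _ _ _ H2 (Clim_scal _ (rcpow 2 (RtoC 1 - z)) _ Hser)).
  replace ((RtoC 1 - rcpow 2 (RtoC 1 - z)) * zeta z)%C with (zeta z - rcpow 2 (RtoC 1 - z) * zeta
      z)%C by ring.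
  revert H. apply Clim_ext. intros N.
  rewrite csum_pair, <- csum_scal, <- csum_minus. apply csum_ext. intros j _. unfold eta_term, w.
  replace (S (2 * j)) with (2 * j + 1)%nat by lia. replace (S (2 * j + 1)) with (2 * j + 2)%nat
      by lia.
  replace (INR (2 * j + 2)) with (2 * INR (S j)) by (rewrite plus_INR, mult_INR, (S_INR j);
      simpl; ring).
  assert (Hj : 0 < INR (S j)) by (apply lt_0_INR; lia).
  rewrite rcpow_mult by lra. replace (RtoC 1 - z)%C with (RtoC 1 + - z)%C by ring. rewrite
      (rcpow_plus 2), rcpow_1_r by lra.
  ring.
Qed.

Lemma RtoC_mult_1_r (t : R) : (RtoC t * RtoC 1)%C = RtoC t.
Proof. ring. Qed.

(** The ray s + t, t >= 0, misses the pole because Im s <> 0 and ends in the half-plane of the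
    Dirichlet series. There the difference [D] vanishes, so the identity theorem carries D = 0 back
    to t = 0. *)
Lemma zeta_eta_nonreal (zeta : C -> C) (s : C) : is_Riemann_zeta zeta -> 0 < Re s -> Im s <> 0 ->
  eta s = ((RtoC 1 - rcpow 2 (RtoC 1 - s)) * zeta s)%C.
Proof.
  intros Hzeta Hs Him.
  assert (Hz : forall P t, real_functional P -> real_analytic (fun x => P (zeta (s + RtoC x)%C)) t).
  { intros P t HP. apply (real_analytic_ext (fun x => P (zeta (s + RtoC x * RtoC 1)%C))).
    - intros x. rewrite RtoC_mult_1_r. reflexivity.
    - apply analytic_at_line; auto; [apply Cmod_1|]. apply (proj2 Hzeta).
      intros E. apply (f_equal Im) in E. apply Him. unfold Im in *; simpl in E. lra. }
  set (B := rcpow 2 (RtoC 1 - s)).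
  assert (EB : forall t, rcpow 2 (RtoC 1 - (s + RtoC t)) = (RtoC (exp (- (t * ln 2))) * B)%C).
  { intros t. unfold B. replace (RtoC 1 - (s + RtoC t))%C with (- ((s - RtoC 1) + RtoC t))%C by
      ring.
    rewrite rcpow_shift. do 2 f_equal. ring. }
  set (D := fun t => ((RtoC 1 - rcpow 2 (RtoC 1 - (s + RtoC t))) * zeta (s + RtoC t) - eta (s +
      RtoC t))%C).
  assert (HD0 : forall t, 1 - Re s < t -> D t = RtoC 0).
  { intros t Ht. unfold D. rewrite (zeta_eta_convergent zeta (s + RtoC t)) by (auto; unfold Re in
      *; simpl; lra). ring. }
  assert (A1 : forall t, real_analytic (fun x => (- Re B) * exp (- (x * ln 2)) + 1) t) by
      (intros; apply real_analytic_exp).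
  assert (A2 : forall t, real_analytic (fun x => (- Im B) * exp (- (x * ln 2)) + 0) t) by
      (intros; apply real_analytic_exp).
  assert (HRe : Re (D 0) = 0).
  { apply (real_analytic_identity (fun t => Re (D t)) (1 - Re s)).
    - intros t Ht. apply (real_analytic_ext (fun x => ((- Re B) * exp (- (x * ln 2)) + 1) * Re
        (zeta (s + RtoC x)%C) -
        ((- Im B) * exp (- (x * ln 2)) + 0) * Im (zeta (s + RtoC x)%C) - Re (eta (s + RtoC x)%C))).
      + intros x. unfold D. rewrite EB. generalize (zeta (s + RtoC x)%C) (eta (s + RtoC x)) (exp
          (- (x * ln 2))) B.
        intros u v w b. unfold Re, Im; simpl. ring.
      + apply real_analytic_minus; [apply real_analytic_minus; apply real_analytic_mult; auto;
          apply Hz | apply real_analytic_eta; [|lra]];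
        first [apply real_functional_Re | apply real_functional_Im].
    - intros t Ht. rewrite HD0; auto. }
  assert (HIm : Im (D 0) = 0).
  { apply (real_analytic_identity (fun t => Im (D t)) (1 - Re s)).
    - intros t Ht. apply (real_analytic_ext (fun x => ((- Re B) * exp (- (x * ln 2)) + 1) * Im
        (zeta (s + RtoC x)%C) +
        ((- Im B) * exp (- (x * ln 2)) + 0) * Re (zeta (s + RtoC x)%C) - Im (eta (s + RtoC x)%C))).
      + intros x. unfold D. rewrite EB. generalize (zeta (s + RtoC x)%C) (eta (s + RtoC x)) (exp
          (- (x * ln 2))) B.
        intros u v w b. unfold Re, Im; simpl. ring.
      + apply real_analytic_minus; [apply real_analytic_plus; apply real_analytic_mult; auto;
          apply Hz | apply real_analytic_eta; [|lra]];
        first [apply real_functional_Re | apply real_functional_Im].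
    - intros t Ht. rewrite HD0; auto. }
  assert (E : D 0 = RtoC 0) by (apply C_ext; auto).
  unfold D in E. replace (s + RtoC 0)%C with s in E by ring.
  subst B. replace (eta s) with (((RtoC 1 - rcpow 2 (RtoC 1 - s)) * zeta s) - ((RtoC 1 - rcpow 2
      (RtoC 1 - s)) * zeta s - eta s))%C by ring.
  rewrite E. ring.
Qed.

(** Tannery's theorem for complete series, in contrast with the finite sums of
    [dominated_series]. *)
Lemma dominated_series_limit (a : nat -> nat -> C) (c : nat -> C) (b : nat -> R) (L : nat -> C)
    (l : C) :
  ex_series b -> (forall k, 0 <= b k) -> (forall n k, Cmod (a n k) <= b k) -> (forall k, Cmod (c
      k) <= b k) ->
  (forall k, Clim (fun n => a n k) (c k)) -> (forall n, Clim (csum (a n)) (L n)) ->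
  Clim (csum c) l -> Clim L l.
Proof.
  intros Hb Hb0 Ha Hcb Hc HL Hl. apply Clim_eps. intros eps Heps.
  destruct (series_tail_small b Hb Hb0 (eps / 5) ltac:(lra)) as [K HK].
  assert (T : forall (d : nat -> C) (m : C), (forall k, Cmod (d k) <= b k) -> Clim (csum d) m ->
      Cmod (csum d K - m) < 2 * (eps / 5)).
  { intros d m Hd Hm. destruct (proj1 (Clim_eps _ _) Hm (eps / 5) ltac:(lra)) as [N HN].
    assert (H1 := HK (max N K) ltac:(lia) d (fun k _ => Hd k)). assert (H2 := HN (max N K)
        ltac:(lia)).
    replace (csum d K - m)%C with (- (csum d (max N K) - csum d K) + (csum d (max N K) - m))%C by
        ring.
    eapply Rle_lt_trans; [apply Cmod_triangle|]. rewrite Cmod_opp. lra. }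
  destruct (proj1 (Clim_eps _ _) (Clim_csum a c K Hc) (eps / 5) ltac:(lra)) as [N HN].
  exists N. intros n Hn. assert (H1 := T _ _ (Ha n) (HL n)). assert (H2 := T _ _ Hcb Hl).
      specialize (HN n Hn).
  replace (L n - l)%C with (- (csum (a n) K - L n) + ((csum (a n) K - csum c K) + (csum c K -
      l)))%C by ring.
  eapply Rle_lt_trans; [apply Cmod_triangle|]. eapply Rle_lt_trans; [apply Rplus_le_compat_l,
      Cmod_triangle|].
  rewrite Cmod_opp. lra.
Qed.

Lemma continuous_lim_seq (f : R -> R) (y : nat -> R) (l : R) : continuous f l -> is_lim_seq y l
    -> is_lim_seq (fun n => f (y n)) (f l).
Proof. intros Hf Hy. apply (filterlim_comp _ _ _ y f _ (locally l) (locally (f l)) Hy Hf). Qed.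

Lemma rcpow_vertical_limit (a : R) (s : C) :
  Clim (fun n => rcpow a (s + RtoC (/ INR (S n)) * Ci)) (rcpow a s).
Proof.
  assert (Hs : forall y, rcpow a (s + RtoC y * Ci) =
    (exp (Re s * ln a) * cos ((Im s + y) * ln a), exp (Re s * ln a) * sin ((Im s + y) * ln a))).
  { intros y. unfold rcpow. apply C_ext; unfold Re, Im; simpl; [f_equal; [f_equal; ring |
      f_equal; ring] | f_equal; [f_equal; ring | f_equal; ring]]. }
  apply Clim_ext with (fun n => (exp (Re s * ln a) * cos ((Im s + / INR (S n)) * ln a), exp (Re s
      * ln a) * sin ((Im s + / INR (S n)) * ln a))).
  { intros n. symmetry. apply Hs. }
  replace (rcpow a s) with (rcpow a (s + RtoC 0 * Ci)) by (f_equal; ring). rewrite Hs.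
  apply Clim_components.
  - apply (continuous_lim_seq (fun y => exp (Re s * ln a) * cos ((Im s + y) * ln a)) (fun n => /
      INR (S n)) 0); [|apply is_lim_seq_inv_S].
    eapply continuous_is_derive. auto_derive; auto.
  - apply (continuous_lim_seq (fun y => exp (Re s * ln a) * sin ((Im s + y) * ln a)) (fun n => /
      INR (S n)) 0); [|apply is_lim_seq_inv_S].
    eapply continuous_is_derive. auto_derive; auto.
Qed.

Lemma rcpow_inv_vertical_limit (a : R) (s : C) : 0 < a ->
  Clim (fun n => rcpow a (- (s + RtoC (/ INR (S n)) * Ci))) (rcpow a (- s)).
Proof.
  intros Ha. assert (H := rcpow_vertical_limit (/ a) s). rewrite rcpow_inv, <- rcpow_opp in H by
      auto.
  revert H. apply Clim_ext. intros n. rewrite rcpow_inv, <- rcpow_opp by auto. reflexivity.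
Qed.

Lemma eta_vertical_limit (s : C) : 0 < Re s -> Clim (fun n => eta (s + RtoC (/ INR (S n)) * Ci))
    (eta s).
Proof.
  intros Hs.
  assert (Hre : forall n, Re (s + RtoC (/ INR (S n)) * Ci) = Re s) by (intros; unfold Re; simpl;
      ring).
  apply (dominated_series_limit (fun n => eta_term (s + RtoC (/ INR (S n)) * Ci)) (eta_term s)
    (fun j => (Cmod s + 1) * Rpower (INR (S j)) (- Re s - 1))).
  - apply ex_series_eta_bound; auto.
  - intros k. apply Rmult_le_pos; [generalize (Cmod_ge_0 s); lra | left; apply Rpower_pos].
  - intros n k. assert (H := Cmod_eta_term (s + RtoC (/ INR (S n)) * Ci) k ltac:(rewrite Hre;
      auto)).
    rewrite Hre in H. eapply Rle_trans; [exact H|]. apply Rmult_le_compat_r; [left; apply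
        Rpower_pos|].
    eapply Rle_trans; [apply Cmod_triangle|]. rewrite Cmod_mult, Cmod_Ci, Cmod_R, Rmult_1_r.
    assert (H1 : 1 <= INR (S n)) by (rewrite S_INR; generalize (pos_INR n); lra).
    rewrite Rabs_pos_eq by (left; apply Rinv_0_lt_compat; lra).
    assert (/ INR (S n) <= 1) by (rewrite <- Rinv_1; apply Rinv_le_contravar; lra). lra.
  - intros k. eapply Rle_trans; [apply Cmod_eta_term; auto|]. apply Rmult_le_compat_r; [left;
      apply Rpower_pos | lra].
  - intros k. unfold eta_term. apply Clim_minus; apply rcpow_inv_vertical_limit; apply lt_0_INR;
      lia.
  - intros n. apply eta_Clim. rewrite Hre. auto.
  - apply eta_Clim; auto.
Qed.

Lemma Clim_mult (u v : nat -> C) (l m : C) : Clim u l -> Clim v m -> Clim (fun n => (u n * v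
    n)%C) (l * m)%C.
Proof.
  intros Hu Hv. apply Clim_bound with (fun n => Cmod (u n - l) * Cmod (v n) + Cmod l * Cmod (v n
      - m)).
  - intros n. replace (u n * v n - l * m)%C with ((u n - l) * v n + l * (v n - m))%C by ring.
    eapply Rle_trans; [apply Cmod_triangle|]. rewrite !Cmod_mult. lra.
  - replace (Finite 0) with (Finite (0 * Cmod m + Cmod l * 0)) by (f_equal; ring).
    apply is_lim_seq_plus'.
    + apply is_lim_seq_mult'; [exact Hu | apply Clim_Cmod; auto].
    + apply is_lim_seq_mult'; [apply is_lim_seq_const | exact Hv].
Qed.

(** For real s in (0, 1) the horizontal ray runs into the pole 1. The points s + i/(n+1) are not
    real, and both sides are continuous along the vertical line. *)
Lemma zeta_eta (zeta : C -> C) (s : C) : is_Riemann_zeta zeta -> 0 < Re s < 1 ->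
  eta s = ((RtoC 1 - rcpow 2 (RtoC 1 - s)) * zeta s)%C.
Proof.
  intros Hzeta Hs. destruct (Req_dec (Im s) 0) as [E|E]; [|apply zeta_eta_nonreal; auto; lra].
  apply (Clim_unique (fun n => eta (s + RtoC (/ INR (S n)) * Ci))); [apply eta_vertical_limit;
      lra|].
  assert (Hz : Clim (fun n => zeta (s + RtoC (/ INR (S n)) * Ci)%C) (zeta s)).
  { assert (Ha : forall P, real_functional P -> is_lim_seq (fun n => P (zeta (s + RtoC (/ INR (S
      n)) * Ci)%C)) (P (zeta s))).
    { intros P HP. replace (P (zeta s)) with (P (zeta (s + RtoC 0 * Ci)%C)) by (do 2 f_equal; ring).
      apply (continuous_lim_seq (fun y => P (zeta (s + RtoC y * Ci)%C)) (fun n => / INR (S n))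
          0); [|apply is_lim_seq_inv_S].
      apply real_analytic_continuity. apply analytic_at_line; auto; [apply Cmod_Ci|].
      apply (proj2 Hzeta). intros E1. apply (f_equal Re) in E1. unfold Re in *; simpl in E1. lra. }
    apply Clim_components; apply Ha; [apply real_functional_Re | apply real_functional_Im]. }
  assert (H2 : Clim (fun n => (RtoC 1 - rcpow 2 (RtoC 1 - (s + RtoC (/ INR (S n)) * Ci)))%C)
      (RtoC 1 - rcpow 2 (RtoC 1 - s))).
  { apply Clim_minus; [apply Clim_const|].
    assert (H := Clim_scal _ (RtoC 2) _ (rcpow_inv_vertical_limit 2 s ltac:(lra))).
    unfold Cminus. rewrite rcpow_plus, rcpow_1_r by lra. revert H. apply Clim_ext. intros n.
    rewrite rcpow_plus, rcpow_1_r by lra. reflexivity. }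
  assert (H := Clim_mult _ _ _ _ H2 Hz). revert H. apply Clim_ext. intros n. symmetry.
  apply zeta_eta_nonreal; auto.
  - unfold Re in *; simpl. lra.
  - unfold Im in *; simpl. rewrite E. assert (0 < / INR (S n)) by (apply Rinv_0_lt_compat,
      lt_0_INR; lia).
    simpl in H. lra.
Qed.

(** * The Mellin transform of theta *)

(** The derivative in v brings down PI x^2. Half of the exponent absorbs it, since (u/2) e^(-u/2) <=
    1 for u = PI d x^2, and the other half stays as a factor summable over the integers. *)
Lemma gauss_lipschitz (d v w x : R) : 0 < d -> d <= v -> d <= w ->
  Rabs (gauss v x - gauss w x) <= 2 / d * gauss (d / 2) x * Rabs (v - w).
Proof.
  intros Hd.
  assert (Hpi := PI_RGT_0). assert (Hx := pow2_ge_0 x).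
  assert (A : forall a b, d <= a <= b -> Rabs (gauss b x - gauss a x) <= (2 / d * gauss (d / 2)
      x) * (b - a)).
  { intros a b Hab. apply (Rabs_increment_le (fun t => gauss t x) (fun t => - (PI * x ^ 2) *
      gauss t x)); [lra| |].
    - intros t _. unfold gauss. auto_derive; auto. simpl. ring.
    - intros t Ht. rewrite Rabs_mult, Rabs_Ropp, !Rabs_pos_eq by (first [left; apply gauss_pos |
        apply Rmult_le_pos; lra]).
      set (u := PI * d * x ^ 2).
      assert (Hu : 0 <= u) by (unfold u; apply Rmult_le_pos; [apply Rmult_le_pos; lra | auto]).
      apply Rle_trans with (PI * x ^ 2 * exp (- u)).
      + apply Rmult_le_compat_l; [apply Rmult_le_pos; lra|]. unfold gauss. apply exp_le_compat.
          unfold u.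
        assert (PI * d * x ^ 2 <= PI * t * x ^ 2); [|lra]. apply Rmult_le_compat_r; auto. apply
            Rmult_le_compat_l; lra.
      + replace (PI * x ^ 2 * exp (- u)) with (2 / d * (exp (- (u / 2)) * (u / 2 * exp (- (u /
          2))))).
        * replace (2 / d * gauss (d / 2) x) with (2 / d * (exp (- (u / 2)) * 1)).
          -- apply Rmult_le_compat_l; [apply Rdiv_le_0_compat; lra|]. apply Rmult_le_compat_l;
              [left; apply exp_pos|].
             assert (H := exp_opp_le (u / 2) ltac:(lra)).
             apply Rle_trans with (u / 2 * / (1 + u / 2)); [apply Rmult_le_compat_l; lra|].
             apply Rle_div_l; lra.
          -- unfold gauss. rewrite Rmult_1_r. do 3 f_equal. unfold u. field.
        * rewrite (Rmult_comm (u / 2)), <- (Rmult_assoc (exp _)), <- exp_plus.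
          replace (- (u / 2) + - (u / 2)) with (- u) by field. unfold u. field. lra. }
  intros Hv Hw. destruct (Rle_dec v w) as [H|H].
  - rewrite Rabs_minus_sym, (Rabs_minus_sym v), (Rabs_pos_eq (w - v)) by lra. apply A; lra.
  - rewrite (Rabs_pos_eq (v - w)) by lra. apply A; lra.
Qed.

Lemma continuous_psi (v : R) : 0 < v -> continuous psi v.
Proof.
  intros Hv. set (d := v / 2). assert (Hd : 0 < d) by (unfold d; lra).
  assert (H2d := Rdiv_lt_0_compat 2 d ltac:(lra) Hd).
  assert (Hps := psi_pos (d / 2) ltac:(lra)).
  apply continuous_Rabs_bound with (2 / d * psi (d / 2)); [apply Rmult_le_pos; lra|].
  exists (mkposreal d Hd). intros u Hu.
  assert (Hu' : Rabs (u - v) < d) by exact Hu.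
  apply Rabs_def2 in Hu'.
  assert (S1 := is_series_minus (V := R_NormedModule) _ _ _ _ (is_series_psi u ltac:(unfold d in
      *; lra)) (is_series_psi v Hv)).
  assert (S2 := is_series_scal_r (Rabs (u - v)) _ _ (is_series_scal_l (2 / d) _ _ (is_series_psi
      (d / 2) ltac:(lra)))).
  assert (Hle : forall k, Rabs (gauss u (INR (S k)) - gauss v (INR (S k))) <= 2 / d * gauss (d /
      2) (INR (S k)) * Rabs (u - v)).
  { intros k. apply gauss_lipschitz; unfold d in *; lra. }
  assert (HexA : ex_series (fun k => Rabs (gauss u (INR (S k)) - gauss v (INR (S k))))).
  { apply (ex_series_le (K := R_AbsRing) (V := R_CompleteNormedModule) _ (fun k => 2 / d * gauss
      (d / 2) (INR (S k)) * Rabs (u - v))).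
    - intros k. change (Rabs (Rabs (gauss u (INR (S k)) - gauss v (INR (S k)))) <= 2 / d * gauss
        (d / 2) (INR (S k)) * Rabs (u - v)).
      rewrite Rabs_Rabsolu. apply Hle.
    - eexists; exact S2. }
  replace (psi u - psi v) with (Series (fun k => gauss u (INR (S k)) - gauss v (INR (S k)))) by
      (apply is_series_unique; exact S1).
  eapply Rle_trans; [apply Series_Rabs; exact HexA|].
  replace (2 / d * psi (d / 2) * Rabs (u - v)) with (Series (fun k => 2 / d * gauss (d / 2) (INR
      (S k)) * Rabs (u - v))) by (apply is_series_unique; exact S2).
  apply Series_le; [|eexists; exact S2]. intros k. split; [apply Rabs_pos | apply Hle].
Qed.

Lemma psi_le (v : R) : 0 < v -> psi v <= / v.
Proof.
  intros Hv. destruct (exp_opp_lt_1 v Hv) as [Hq0 Hq1]. set (q := exp (- (PI * v))) in *.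
  assert (Hpi : 3 <= PI) by (generalize PI2_3_2; lra).
  assert (Hgeo : is_series (fun k => q * q ^ k) (q * / (1 - q))).
  { apply (is_series_scal_l (K := R_AbsRing) (V := R_NormedModule) q (fun k => q ^ k)),
      is_series_geom. rewrite Rabs_pos_eq; lra. }
  apply Rle_trans with (q * / (1 - q)).
  - rewrite <- (is_series_unique _ _ Hgeo). apply Series_le; [|eexists; exact Hgeo].
    intros k. split; [left; apply gauss_pos | apply gauss_le_geom; auto].
  - assert (Hq : q <= / (1 + PI * v)) by (apply exp_opp_le; nra).
    assert (Hq2 : q * (1 + PI * v) <= 1) by (apply Rle_div_r; [nra | unfold Rdiv; rewrite
        Rmult_1_l; exact Hq]).
    apply Rle_div_l; [lra|]. apply Rmult_le_reg_l with v; [auto|].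
    rewrite <- Rmult_assoc, Rinv_r, Rmult_1_l by lra. nra.
Qed.

(** theta(v) - 1 - v^(-1/2). Subtracting v^(-1/2) keeps it bounded near 0, and subtracting 1 makes
    it O(v^(-1/2)) at infinity, so that its Mellin integral converges for 0 < Re z < 1/2. *)
Definition theta_defect (v : R) : R := 2 * psi v - / sqrt v.

Lemma theta_defect_inv (v : R) : 0 < v -> theta_defect (/ v) = sqrt v * theta_defect v.
Proof.
  intros Hv. assert (Hs := sqrt_lt_R0 v Hv). assert (H := theta_functional_equation v Hv).
  unfold theta_defect. rewrite sqrt_inv, Rinv_inv.
  replace (psi v) with ((1 / 2 + psi (/ v)) / sqrt v - 1 / 2) by lra.
  replace (sqrt v * (2 * ((1 / 2 + psi (/ v)) / sqrt v - 1 / 2) - / sqrt v)) with (2 * psi (/ v)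
      - sqrt v) by (field; lra). reflexivity.
Qed.

Lemma theta_defect_large (v : R) : 1 <= v -> Rabs (theta_defect v) <= 2 * / sqrt v.
Proof.
  intros Hv. assert (Hs : 1 <= sqrt v) by (rewrite <- sqrt_1; apply sqrt_le_1_alt; auto).
  assert (H1 := psi_le v ltac:(lra)). assert (H2 := psi_pos v ltac:(lra)).
  assert (H3 : / v <= / sqrt v).
  { apply Rinv_le_contravar; [lra|]. rewrite <- (sqrt_sqrt v) at 2 by lra. nra. }
  assert (0 < / sqrt v) by (apply Rinv_0_lt_compat; lra).
  unfold theta_defect. apply Rabs_le. lra.
Qed.

Lemma theta_defect_small (v : R) : 0 < v <= 1 -> Rabs (theta_defect v) <= 2.
Proof.
  intros Hv. assert (Hs := sqrt_lt_R0 v (proj1 Hv)).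
  assert (Hi : 1 <= / v) by (rewrite <- Rinv_1; apply Rinv_le_contravar; lra).
  assert (H := theta_defect_large (/ v) Hi). rewrite theta_defect_inv, sqrt_inv, Rinv_inv in H by
      lra.
  rewrite Rabs_mult, (Rabs_pos_eq (sqrt v)) in H by lra.
  apply Rmult_le_reg_l with (sqrt v); lra.
Qed.

Lemma continuous_theta_defect (v : R) : 0 < v -> continuous theta_defect v.
Proof.
  intros Hv. apply (continuous_minus (V := R_NormedModule)).
  - apply (continuous_scal_r (V := R_NormedModule)), continuous_psi; auto.
  - eapply continuous_is_derive. auto_derive; [|reflexivity].
    split; auto. split; auto. apply Rgt_not_eq, sqrt_lt_R0; auto.
Qed.

Definition theta_mellin (z : C) : C := RInt_0_infty (fun v => RtoC (theta_defect v) * rcpow v (z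
    - RtoC 1))%C.

Lemma Re_minus_1 (z : C) : Re (z - RtoC 1) = Re z - 1.
Proof. reflexivity. Qed.

Lemma continuous_theta_mellin_integrand (z : C) (t : R) : 0 < t ->
  continuous (U := C_R_NormedModule) (fun v => RtoC (theta_defect v) * rcpow v (z - RtoC 1))%C t.
Proof.
  intros Ht. apply continuous_Cmult; [|apply continuous_rcpow; auto].
  apply (continuous_RtoC theta_defect), continuous_theta_defect; auto.
Qed.

Lemma is_RInt_theta_mellin (z : C) : 0 < Re z < 1 / 2 ->
  is_RInt_0_infty (fun v => RtoC (theta_defect v) * rcpow v (z - RtoC 1))%C (theta_mellin z).
Proof.
  intros Hz.
  destruct (is_RInt_0_infty_ex (fun v => RtoC (theta_defect v) * rcpow v (z - RtoC 1))%C 2 (Re z)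
      (1 / 2 - Re z)) as (l & Hl & _); try lra.
  - apply continuous_theta_mellin_integrand.
  - intros t Ht. rewrite Cmod_mult, Cmod_R, Cmod_rcpow, Re_minus_1.
    apply Rmult_le_compat_r; [left; apply Rpower_pos | apply theta_defect_small; auto].
  - intros t Ht. rewrite Cmod_mult, Cmod_R, Cmod_rcpow, Re_minus_1.
    replace (- (1 / 2 - Re z) - 1) with (- (1 / 2) + (Re z - 1)) by ring.
    rewrite Rpower_plus, <- div_sqrt_Rpower, <- Rmult_assoc by lra.
    apply Rmult_le_compat_r; [left; apply Rpower_pos | apply theta_defect_large; auto].
  - unfold theta_mellin. rewrite (is_RInt_0_infty_unique _ l); auto.
Qed.

(** Substituting 1/v for v, the factor sqrt(v) of the theta relation shifts the exponent by 1/2. At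
    z = s/2 this is the reflection s |-> 1 - s. *)
Lemma theta_mellin_reflection (z : C) : 0 < Re z < 1 / 2 -> theta_mellin (RtoC (1 / 2) - z) =
    theta_mellin z.
Proof.
  intros Hz. apply is_RInt_0_infty_unique.
  assert (H := is_RInt_0_infty_comp_inv _ _ (continuous_theta_mellin_integrand z)
      (is_RInt_theta_mellin z Hz)).
  revert H. apply is_RInt_0_infty_ext. intros t Ht.
  rewrite theta_defect_inv, rcpow_inv by auto.
  assert (Hs := sqrt_lt_R0 t Ht).
  replace (RtoC (1 / 2) - z - RtoC 1)%C with (RtoC (1 / 2) + (RtoC 1 - z - RtoC 2))%C by ring_C.
  rewrite rcpow_plus, (rcpow_minus t (RtoC 1 - z)), rcpow_real.
  replace (Rpower t (1 / 2)) with (sqrt t).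
  2: { replace (1 / 2) with (/ 2) by field. rewrite Rpower_sqrt; auto. }
  replace (RtoC 2) with (RtoC 1 + RtoC 1)%C by ring_C. rewrite rcpow_plus, rcpow_1_r by auto.
  replace (RtoC 1 - z)%C with (- (z - RtoC 1))%C by ring. rewrite rcpow_opp.
  rewrite RtoC_mult. replace (/ t ^ 2) with (/ t * / t) by (field; lra). rewrite RtoC_mult,
      RtoC_inv by lra.
  field. split; [apply rcpow_nonzero | apply RtoC_neq_0; lra].
Qed.

(** * The alternating theta series and its Mellin transform *)

Fixpoint alt_theta (v : R) (N : nat) : R :=
  match N with
  | O => 0
  | S j => alt_theta v j + (gauss v (INR (2 * j + 1)) - gauss v (INR (2 * j + 2)))
  end.

Lemma alt_theta_S (v : R) (j : nat) :
  alt_theta v (S j) = alt_theta v j + (gauss v (INR (2 * j + 1)) - gauss v (INR (2 * j + 2))).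
Proof. reflexivity. Qed.

Lemma gauss_double (v x : R) : gauss (4 * v) x = gauss v (2 * x).
Proof. unfold gauss. f_equal. ring. Qed.

(** By [gauss_double] the even-indexed terms at v are the terms at 4v. The - 1/2 is what the two
    constant terms leave. *)
Lemma alt_theta_half_theta (v : R) (N : nat) : alt_theta v N - 1 / 2 = half_theta v (2 * N) - 2 *
    half_theta (4 * v) N.
Proof.
  induction N as [|N IH]; [simpl; field|].
  replace (2 * S N)%nat with (S (S (2 * N))) by lia. rewrite !half_theta_S, alt_theta_S,
      gauss_double.
  replace (2 * INR (S N)) with (INR (2 * N + 2)) by (rewrite plus_INR, mult_INR, (S_INR N);
      simpl; ring).
  replace (S (S (2 * N))) with (2 * N + 2)%nat by lia. replace (S (2 * N)) with (2 * N + 1)%nat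
      by lia. lra.
Qed.

Lemma alt_theta_limit (v : R) : 0 < v -> is_lim_seq (alt_theta v) (psi v - 2 * psi (4 * v)).
Proof.
  intros Hv. apply is_lim_seq_ext with (fun N => (half_theta v (2 * N) - 2 * half_theta (4 * v)
      N) + 1 / 2).
  - intros N. rewrite <- alt_theta_half_theta. ring.
  - replace (Finite (psi v - 2 * psi (4 * v))) with (Finite (((1 / 2 + psi v) - 2 * (1 / 2 + psi
      (4 * v))) + 1 / 2)) by (f_equal; field).
    apply is_lim_seq_plus'; [|apply is_lim_seq_const]. apply is_lim_seq_minus'.
    + apply (is_lim_seq_subseq (half_theta v) _ (fun N => (2 * N)%nat)); [|apply
        half_theta_limit; auto].
      apply eventually_subseq. intros n. lia.
    + apply (is_lim_seq_scal_l _ 2 (Finite _)). apply half_theta_limit. lra.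
Qed.

Lemma gauss_decr (v x y : R) : 0 < v -> 0 <= x <= y -> gauss v y <= gauss v x.
Proof.
  intros Hv Hx. apply exp_le_compat, Ropp_le_contravar. apply Rmult_le_compat_l.
  - apply Rmult_le_pos; [generalize PI_RGT_0; lra | lra].
  - apply pow_incr; lra.
Qed.

(** Leibniz: the terms alternate and decrease, so the remainder lies between 0 and the first omitted
    term. This holds for every v > 0, down to v = 0 where the separate theta series blow up. *)
Lemma alt_theta_remainder (v : R) (N : nat) : 0 < v ->
  Rabs (psi v - 2 * psi (4 * v) - alt_theta v N) <= gauss v (INR (2 * N + 1)).
Proof.
  intros Hv.
  assert (A : forall p, 0 <= alt_theta v (N + p) - alt_theta v N <= gauss v (INR (2 * N + 1)) -
      gauss v (INR (2 * (N + p) + 1))).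
  { induction p as [|p IH]; [rewrite Nat.add_0_r; lra|].
    rewrite Nat.add_succ_r, alt_theta_S.
    assert (H1 : gauss v (INR (2 * (N + p) + 2)) <= gauss v (INR (2 * (N + p) + 1))).
    { apply gauss_decr; auto. split; [apply pos_INR | apply le_INR; lia]. }
    assert (H2 : gauss v (INR (2 * S (N + p) + 1)) <= gauss v (INR (2 * (N + p) + 2))).
    { apply gauss_decr; auto. split; [apply pos_INR | apply le_INR; lia]. }
    lra. }
  assert (L : is_lim_seq (fun p => alt_theta v (N + p) - alt_theta v N) (psi v - 2 * psi (4 * v)
      - alt_theta v N)).
  { apply is_lim_seq_minus'; [|apply is_lim_seq_const].
    apply is_lim_seq_ext with (fun p => alt_theta v (p + N)); [intros; f_equal; lia|].
    apply (is_lim_seq_incr_n (alt_theta v)), alt_theta_limit; auto. }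
  assert (L1 : Rbar_le 0 (psi v - 2 * psi (4 * v) - alt_theta v N)).
  { refine (is_lim_seq_le _ _ _ _ _ (is_lim_seq_const 0) L). intros n. apply A. }
  assert (L2 : Rbar_le (psi v - 2 * psi (4 * v) - alt_theta v N) (gauss v (INR (2 * N + 1)))).
  { refine (is_lim_seq_le _ _ _ _ _ L (is_lim_seq_const _)). intros n. generalize (A n)
      (gauss_pos v (INR (2 * (N + n) + 1))). lra. }
  simpl in L1, L2. rewrite Rabs_pos_eq; auto.
Qed.

Lemma theta_defect_alt (v : R) : 0 < v -> theta_defect v - 2 * theta_defect (4 * v) = 2 * (psi v
    - 2 * psi (4 * v)).
Proof.
  intros Hv. unfold theta_defect. replace (4 * v) with (2 ^ 2 * v) by ring.
  rewrite sqrt_mult, sqrt_pow2 by lra. assert (Hs := sqrt_lt_R0 v Hv). field. lra.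
Qed.

Lemma is_RInt_theta_alt (z : C) : 0 < Re z < 1 / 2 ->
  is_RInt_0_infty (fun v => RtoC (2 * (psi v - 2 * psi (4 * v))) * rcpow v (z - RtoC 1))%C
    ((RtoC 1 - rcpow 2 (RtoC 1 - RtoC 2 * z)) * theta_mellin z)%C.
Proof.
  intros Hz. assert (H := is_RInt_theta_mellin z Hz).
  assert (H4 := is_RInt_0_infty_scal _ (RtoC 2 * rcpow 4 (- z))%C _ (is_RInt_0_infty_comp_scal _
      4 _ ltac:(lra) H)).
  replace ((RtoC 1 - rcpow 2 (RtoC 1 - RtoC 2 * z)) * theta_mellin z)%C with
    (theta_mellin z - (RtoC 2 * rcpow 4 (- z)) * theta_mellin z)%C.
  - assert (HH := is_RInt_0_infty_minus _ _ _ _ H H4). revert HH. apply is_RInt_0_infty_ext.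
    intros t Ht. rewrite <- theta_defect_alt, RtoC_minus, RtoC_mult by auto.
    rewrite (rcpow_mult 4 t), (rcpow_minus 4), rcpow_1_r, rcpow_opp by lra.
    field. repeat split; first [apply rcpow_nonzero | apply RtoC_neq_0; lra].
  - rewrite rcpow_4, rcpow_minus, rcpow_1_r by lra.
    replace (RtoC 2 * - z)%C with (- (RtoC 2 * z))%C by ring. rewrite rcpow_opp. field. apply
        rcpow_nonzero.
Qed.

Lemma is_RInt_gauss_mellin (z : C) (k : nat) : 0 < Re z -> (1 <= k)%nat ->
  is_RInt_0_infty (fun v => RtoC (gauss v (INR k)) * rcpow v (z - RtoC 1))%C
    (CGamma z * rcpow PI (- z) * rcpow (INR k) (- (RtoC 2 * z)))%C.
Proof.
  intros Hz Hk. assert (Hk0 : 0 < INR k) by (apply lt_0_INR; lia). assert (Hpi := PI_RGT_0).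
  assert (Hk2 : 0 < INR k ^ 2) by (apply pow_lt; auto).
  assert (H := is_RInt_CGamma_scal (PI * INR k ^ 2) z ltac:(apply Rmult_lt_0_compat; auto) Hz).
  rewrite rcpow_mult, rcpow_pow2, Cmult_assoc in H by auto.
  replace (RtoC 2 * - z)%C with (- (RtoC 2 * z))%C in H by ring.
  revert H. apply is_RInt_0_infty_ext. intros t Ht. do 2 f_equal. unfold gauss. f_equal. ring.
Qed.

Lemma is_RInt_alt_theta (z : C) (N : nat) : 0 < Re z ->
  is_RInt_0_infty (fun v => RtoC (2 * alt_theta v N) * rcpow v (z - RtoC 1))%C
    (RtoC 2 * (CGamma z * rcpow PI (- z)) * csum (eta_term (RtoC 2 * z)) N)%C.
Proof.
  intros Hz. induction N as [|N IH].
  - simpl csum. rewrite Cmult_0_r. apply (is_RInt_0_infty_ext (fun _ => RtoC 0)); [|apply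
      is_RInt_0_infty_0].
    intros t _. simpl. rewrite Rmult_0_r. ring.
  - assert (H1 := is_RInt_0_infty_scal _ (RtoC 2) _ (is_RInt_0_infty_minus _ _ _ _
       (is_RInt_gauss_mellin z (2 * N + 1) Hz ltac:(lia)) (is_RInt_gauss_mellin z (2 * N + 2) Hz
           ltac:(lia)))).
    assert (H2 := is_RInt_0_infty_plus _ _ _ _ IH H1). rewrite csum_S. unfold eta_term at 2.
    replace (RtoC 2 * (CGamma z * rcpow PI (- z)) * (csum (eta_term (RtoC 2 * z)) N + (rcpow (INR
        (2 * N + 1)) (- (RtoC 2 * z)) - rcpow (INR (2 * N + 2)) (- (RtoC 2 * z)))))%C
      with (RtoC 2 * (CGamma z * rcpow PI (- z)) * csum (eta_term (RtoC 2 * z)) N + RtoC 2 *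
          (CGamma z * rcpow PI (- z) * rcpow (INR (2 * N + 1)) (- (RtoC 2 * z)) - CGamma z *
          rcpow PI (- z) * rcpow (INR (2 * N + 2)) (- (RtoC 2 * z))))%C by ring.
    revert H2. apply is_RInt_0_infty_ext. intros t _. rewrite alt_theta_S, !RtoC_mult, RtoC_plus,
        RtoC_minus. ring.
Qed.

Lemma continuous_alt_theta (N : nat) (v : R) : continuous (fun v => alt_theta v N) v.
Proof.
  induction N as [|N IH]; [apply continuous_const|].
  apply (continuous_plus (V := R_NormedModule)); auto.
  eapply continuous_is_derive. unfold gauss. auto_derive; auto.
Qed.

(** Justifies integrating the alternating series term by term. The remainder is at most e^(-PI k^2
    v) with k = 2N + 1; the substitution t = k^2 v turns this into e^(-PI t) and brings out k^(-2 Re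
    z), which tends to 0. *)
Lemma theta_mellin_partial_bound (z : C) (N : nat) : 0 < Re z < 1 / 2 ->
  Cmod ((RtoC 1 - rcpow 2 (RtoC 1 - RtoC 2 * z)) * theta_mellin z -
    RtoC 2 * (CGamma z * rcpow PI (- z)) * csum (eta_term (RtoC 2 * z)) N)
  <= 2 * Rpower (INR (2 * N + 1)) (- (2 * Re z)) * (/ Re z + / (1 - Re z)).
Proof.
  intros Hz. set (k := INR (2 * N + 1)). assert (Hk : 0 < k) by (apply lt_0_INR; lia).
  assert (Hk2 : 0 < k ^ 2) by (apply pow_lt; auto).
  assert (Hlam : 0 < / k ^ 2) by (apply Rinv_0_lt_compat; auto).
  assert (H := is_RInt_0_infty_comp_scal _ (/ k ^ 2) _ Hlam (is_RInt_0_infty_minus _ _ _ _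
      (is_RInt_theta_alt z Hz) (is_RInt_alt_theta z N (proj1 Hz)))).
  assert (Hb : forall t, 0 < t -> Cmod (RtoC (/ k ^ 2) * (RtoC (2 * (psi (/ k ^ 2 * t) - 2 * psi
      (4 * (/ k ^ 2 * t)))) * rcpow (/ k ^ 2 * t) (z - RtoC 1) -
      RtoC (2 * alt_theta (/ k ^ 2 * t) N) * rcpow (/ k ^ 2 * t) (z - RtoC 1)))%C <= 2 * Rpower k
          (- (2 * Re z)) * (exp (- (PI * t)) * Rpower t (Re z - 1))).
  { intros t Ht. set (u := / k ^ 2 * t). assert (Hu : 0 < u) by (apply Rmult_lt_0_compat; auto).
    replace (RtoC (/ k ^ 2) * (RtoC (2 * (psi u - 2 * psi (4 * u))) * rcpow u (z - RtoC 1) - RtoC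
        (2 * alt_theta u N) * rcpow u (z - RtoC 1)))%C
      with (RtoC (/ k ^ 2 * (2 * (psi u - 2 * psi (4 * u) - alt_theta u N))) * rcpow u (z - RtoC
          1))%C
      by (rewrite !RtoC_mult, !RtoC_minus; ring).
    rewrite Cmod_mult, Cmod_R, Cmod_rcpow, Re_minus_1, !Rabs_mult, (Rabs_pos_eq 2), (Rabs_pos_eq
        (/ k ^ 2)) by lra.
    assert (Hr := alt_theta_remainder u N Hu).
    replace (gauss u (INR (2 * N + 1))) with (exp (- (PI * t))) in Hr.
    2: { unfold gauss. fold k. f_equal. unfold u. field. lra. }
    assert (Hpw : / k ^ 2 * Rpower u (Re z - 1) = Rpower k (- (2 * Re z)) * Rpower t (Re z - 1)).
    { unfold u.
      replace (/ k ^ 2) with (Rpower k (-2)) at 1.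
      2: { rewrite <- (Rpower_pow 2 k), <- Rpower_Ropp by auto. f_equal. }
      replace (/ k ^ 2 * t) with (Rpower k (- 2) * t).
      2: { f_equal. rewrite <- (Rpower_pow 2 k), <- Rpower_Ropp by auto. f_equal. }
      rewrite <- Rpower_mult_distr, Rpower_mult, <- Rmult_assoc, <- Rpower_plus by (first [apply
          Rpower_pos | auto]).
      f_equal. f_equal. ring. }
    replace (/ k ^ 2 * (2 * Rabs (psi u - 2 * psi (4 * u) - alt_theta u N)) * Rpower u (Re z - 1))
      with (2 * (/ k ^ 2 * Rpower u (Re z - 1)) * Rabs (psi u - 2 * psi (4 * u) - alt_theta u N))
          by ring.
    rewrite Hpw.
    replace (2 * Rpower k (- (2 * Re z)) * (exp (- (PI * t)) * Rpower t (Re z - 1)))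
      with (2 * (Rpower k (- (2 * Re z)) * Rpower t (Re z - 1)) * exp (- (PI * t))) by ring.
    apply Rmult_le_compat_l; auto. apply Rmult_le_pos; [lra|]. apply Rmult_le_pos; left; apply
        Rpower_pos. }
  assert (Hpi : 3 <= PI) by (generalize PI2_3_2; lra).
  assert (HKp : 0 <= 2 * Rpower k (- (2 * Re z))) by (generalize (Rpower_pos k (- (2 * Re z)));
      lra).
  refine (is_RInt_0_infty_bound _ _ (2 * Rpower k (- (2 * Re z))) (Re z) (1 - Re z) _ _ _ _ _ H);
      try lra.
  - intros t Ht. assert (Hu : 0 < / k ^ 2 * t) by (apply Rmult_lt_0_compat; auto).
    apply continuous_Cmult; [apply continuous_const|].
    apply (continuous_comp (U := R_UniformSpace) (V := R_UniformSpace) (W := C_R_NormedModule)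
        (fun t => / k ^ 2 * t)
      (fun u => (RtoC (2 * (psi u - 2 * psi (4 * u))) * rcpow u (z - RtoC 1) - RtoC (2 *
          alt_theta u N) * rcpow u (z - RtoC 1))%C)).
    + eapply continuous_is_derive. auto_derive; auto.
    + apply (continuous_minus (V := C_R_NormedModule)); (apply continuous_Cmult; [|apply
        continuous_rcpow; auto]).
      * apply (continuous_RtoC (fun u => 2 * (psi u - 2 * psi (4 * u)))).
        apply (continuous_scal_r (V := R_NormedModule)). apply (continuous_minus (V :=
            R_NormedModule)); [apply continuous_psi; auto|].
        apply (continuous_scal_r (V := R_NormedModule)).
        apply (continuous_comp (U := R_UniformSpace) (V := R_UniformSpace) (W := R_UniformSpace)
            (fun t => 4 * t) psi).
        -- eapply continuous_is_derive. auto_derive; auto.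
        -- apply continuous_psi. lra.
      * apply (continuous_RtoC (fun u => 2 * alt_theta u N)).
        apply (continuous_scal_r (V := R_NormedModule)), continuous_alt_theta.
  - intros t Ht. eapply Rle_trans; [apply Hb; lra|]. apply Rmult_le_compat_l; auto.
    assert (exp (- (PI * t)) <= 1) by (rewrite <- exp_0; apply exp_le_compat; nra).
    generalize (Rpower_pos t (Re z - 1)). nra.
  - intros t Ht. eapply Rle_trans; [apply Hb; lra|]. apply Rmult_le_compat_l; auto.
    replace (- (1 - Re z) - 1) with (Ropp 1 + (Re z - 1)) by ring.
    rewrite Rpower_plus, Rpower_Ropp, Rpower_1 by lra.
    apply Rmult_le_compat_r; [left; apply Rpower_pos|].
    eapply Rle_trans; [apply exp_opp_le; nra|]. apply Rinv_le_contravar; nra.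
Qed.

Lemma theta_mellin_eta (z eta : C) : 0 < Re z < 1 / 2 -> Clim (csum (eta_term (RtoC 2 * z))) eta ->
  ((RtoC 1 - rcpow 2 (RtoC 1 - RtoC 2 * z)) * theta_mellin z = RtoC 2 * rcpow PI (- z) * CGamma z
      * eta)%C.
Proof.
  intros Hz Heta.
  apply (Clim_unique (fun N => RtoC 2 * (CGamma z * rcpow PI (- z)) * csum (eta_term (RtoC 2 *
      z)) N)%C).
  - apply Clim_eps. intros eps Heps. set (K := 2 * (/ Re z + / (1 - Re z))).
    assert (HK : 0 < K). { unfold K. assert (0 < / Re z) by (apply Rinv_0_lt_compat; lra). assert
        (0 < / (1 - Re z)) by (apply Rinv_0_lt_compat; lra). lra. }
    destruct (Rpower_large (2 * Re z) (eps / K)) as (B & HB & HB'); [lra | apply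
        Rdiv_lt_0_compat; auto|].
    destruct (INR_unbounded B) as [N HN]. exists N. intros n Hn.
    rewrite <- Cmod_opp. eapply Rle_lt_trans; [|apply (Rle_lt_trans _ _ _
        (theta_mellin_partial_bound z n Hz))].
    + right. f_equal. ring.
    + assert (H := HB' (INR (2 * n + 1))).
      assert (Hn' : INR N <= INR (2 * n + 1)) by (apply le_INR; lia). specialize (H ltac:(lra)).
      apply Rlt_div_r in H; auto. unfold K in H. lra.
  - replace (RtoC 2 * rcpow PI (- z) * CGamma z * eta)%C with (RtoC 2 * (CGamma z * rcpow PI (-
      z)) * eta)%C by ring.
    apply Clim_scal; auto.
Qed.

(** * The limit *)

Lemma one_minus_rcpow_2_nonzero (s : C) : Re s < 1 -> (RtoC 1 - rcpow 2 (RtoC 1 - s))%C <> RtoC 0.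
Proof.
  intros Hs E.
  assert (Hr : 1 < Cmod (rcpow 2 (RtoC 1 - s))).
  { rewrite Cmod_rcpow. apply Rle_lt_trans with (Rpower 2 0); [rewrite Rpower_O; lra|].
    apply Rpower_lt; [lra|]. unfold Re in *; simpl; lra. }
  replace (rcpow 2 (RtoC 1 - s)) with (RtoC 1 - (RtoC 1 - rcpow 2 (RtoC 1 - s)))%C in Hr by ring.
  rewrite E in Hr. replace (RtoC 1 - RtoC 0)%C with (RtoC 1) in Hr by ring. rewrite Cmod_1 in Hr.
      lra.
Qed.

Lemma half_strip (s : C) : 0 < Re s < 1 -> 0 < Re (s / RtoC 2) < 1 / 2.
Proof. intros Hs. replace (Re (s / RtoC 2)) with (Re s / 2) by (unfold Re; simpl; field). lra. Qed.

Lemma two_mul_half (s : C) : (RtoC 2 * (s / RtoC 2))%C = s.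
Proof. field. Qed.

Lemma theta_mellin_completed (s : C) : 0 < Re s < 1 ->
  ((RtoC 1 - rcpow 2 (RtoC 1 - s)) * theta_mellin (s / RtoC 2) =
    RtoC 2 * rcpow PI (- (s / RtoC 2)) * CGamma (s / RtoC 2) * eta s)%C.
Proof.
  intros Hs. assert (H := theta_mellin_eta (s / RtoC 2) (eta s) (half_strip s Hs)).
  rewrite !two_mul_half in H. apply H. apply eta_Clim. lra.
Qed.

(** The quotient found in [h_limit_of_bounded] is rewritten as a Mellin integral because only this
    form displays the symmetry under s |-> 1 - s. *)
Lemma h_limit (s : C) : 0 < Re s < 1 -> Clim (fun n => h n s) (theta_mellin (s / RtoC 2)).
Proof.
  intros Hs. destruct (h_bounded s Hs) as [B HB].
  assert (H := h_limit_of_bounded s (eta s) B Hs (eta_Clim s (proj1 Hs)) HB).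
  rewrite <- theta_mellin_completed in H by auto.
  replace (theta_mellin (s / RtoC 2)) with ((RtoC 1 - rcpow 2 (RtoC 1 - s)) * theta_mellin (s /
      RtoC 2) / (RtoC 1 - rcpow 2 (RtoC 1 - s)))%C; auto.
  field. apply one_minus_rcpow_2_nonzero; lra.
Qed.

Lemma theta_mellin_nonzero (zeta : C -> C) (s : C) : is_Riemann_zeta zeta -> 0 < Re s < 1 ->
  zeta s <> RtoC 0 -> theta_mellin (s / RtoC 2) <> RtoC 0.
Proof.
  intros Hzeta Hs Hzs E. assert (H := theta_mellin_completed s Hs).
  rewrite E, Cmult_0_r, (zeta_eta zeta) in H by auto. symmetry in H. revert H.
  repeat apply Cmult_neq_0; auto.
  - apply RtoC_neq_0; lra.
  - apply rcpow_nonzero.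
  - apply CGamma_nonzero. apply half_strip; auto.
  - apply one_minus_rcpow_2_nonzero; lra.
Qed.

Theorem corollary5 (zeta : C -> C) (Hzeta : is_Riemann_zeta zeta)
    (s : C) (Hs : 0 < Re s < 1) (Hzs : zeta s <> RtoC 0) :
  eventually (fun n : nat => h n s <> RtoC 0) /\
  is_lim_seq (fun n : nat => Cmod (h n (RtoC 1 - s) / h n s)) 1.
Proof.
  assert (HX := theta_mellin_nonzero zeta s Hzeta Hs Hzs).
  assert (L1 := h_limit s Hs).
  assert (L2 := h_limit (RtoC 1 - s) ltac:(unfold Re in *; simpl; lra)).
  replace ((RtoC 1 - s) / RtoC 2)%C with (RtoC (1 / 2) - s / RtoC 2)%C in L2
    by (rewrite RtoC_div by lra; field; apply RtoC_neq_0; lra).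
  rewrite theta_mellin_reflection in L2 by (apply half_strip; auto).
  set (X := theta_mellin (s / RtoC 2)) in *.
  assert (HX0 : 0 < Cmod X) by (apply Cmod_gt_0; auto).
  (* Once h n s is closer to X than |X| it cannot be 0, so the quotient is a genuine one from some n
     on. *)
  assert (Hev : eventually (fun n : nat => h n s <> RtoC 0)).
  { destruct (proj1 (Clim_eps _ _) L1 (Cmod X) HX0) as [N HN]. exists N. intros n Hn E.
    specialize (HN n Hn). rewrite E in HN. replace (RtoC 0 - X)%C with (- X)%C in HN by ring.
    rewrite Cmod_opp in HN. lra. }
  split; auto.
  apply (is_lim_seq_ext_loc (fun n => Cmod (h n (RtoC 1 - s)) / Cmod (h n s))).
  - revert Hev. apply filter_imp. intros n Hn. rewrite Cmod_div; auto.
  - replace (Finite 1) with (Finite (Cmod X / Cmod X)) by (f_equal; field; lra).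
    apply is_lim_seq_div'; [apply Clim_Cmod; auto | apply Clim_Cmod; auto | lra].
Qed.
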